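(* Let $X(\mathbb{R}^n)$ be a Banach function space and let $\Omega\subseteq\mathbb{R}^n$ be a measurable set of infinite measure such that $X(\Omega)$ has the separated doubling property. If $a\in\mathcal{M}^0_{X(\mathbb{R}^n)}$, then \[ \frac12\,\|a\|_{L^\infty(\mathbb{R}^n)}\le \|W_\Omega(a)\|_{\mathcal{B}(X_2(\Omega),X(\Omega)),\kappa}. \]
   Context: Banach function spaces. Let $\mathfrak{M}(\mathbb{R}^n)$ be the set of Lebesgue measurable complex-valued functions on $\mathbb{R}^n$ and $\mathfrak{M}^+(\mathbb{R}^n)$ the set of measurable functions on $\mathbb{R}^n$ with values in $[0,\infty]$. A mapping $\rho:\mathfrak{M}^+(\mathbb{R}^n)\to[0,\infty]$ is a Banach function norm if for all $f,g,f_k\in\mathfrak{M}^+(\mathbb{R}^n)$ ($k\in\mathbb{N}$), all constants $c\ge 0$ and all measurable $E\subseteq\mathbb{R}^n$: (A1) $\rho(f)=0\Leftrightarrow f=0$ a.e., $\rho(cf)=c\rho(f)$, $\rho(f+g)\le\rho(f)+\rho(g)$; (A2) $0\le g\le f$ a.e. implies $\rho(g)\le\rho(f)$; (A3) $0\le f_k\uparrow f$ a.e. implies $\rho(f_k)\uparrow\rho(f)$; (A4) if $E$ is bounded, then $\rho(\chi_E)<\infty$; (A5) if $E$ is bounded, then $\int_E f(x)\,dx\le C_E\,\rho(f)$ with a constant $C_E\in(0,\infty)$ that may depend on $E$ and $\rho$ but not on $f$. The Banach function space $X(\mathbb{R}^n)$ generated by $\rho$ is the set of $f\in\mathfrak{M}(\mathbb{R}^n)$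 (functions equal a.e. being identified) with $\|f\|_{X(\mathbb{R}^n)}:=\rho(|f|)<\infty$. Spaces on $\Omega$. For a measurable set $\Omega\subseteq\mathbb{R}^n$ of positive measure, $r_\Omega$ is the operator of restriction from $\mathbb{R}^n$ to $\Omega$, $e_\Omega$ is the operator of extension by $0$ from $\Omega$ to $\mathbb{R}^n$, and $X(\Omega)$ is the space of measurable $f:\Omega\to\mathbb{C}$ with $\|f\|_{X(\Omega)}:=\|e_\Omega f\|_{X(\mathbb{R}^n)}<\infty$. $X_2(\Omega)$ is the closure of $L^2(\Omega)\cap X(\Omega)$ in $X(\Omega)$. Multipliers and Wiener-Hopf type operators. $F$ is the Fourier transform, $(Fu)(\xi)=\int_{\mathbb{R}^n}u(x)e^{-ix\xi}\,dx$ for Schwartz functions $u$, and $F^{-1}$ is its inverse; both are extended by continuity to $L^2(\mathbb{R}^n)$. $\mathcal{M}^0_{X(\mathbb{R}^n)}$ is the set of $a\in L^\infty(\mathbb{R}^n)$ such that \[ \sup\left\{\frac{\|F^{-1}aFu\|_{X(\mathbb{R}^n)}}{\|u\|_{X(\mathbb{R}^n)}}: u\in (L^2(\mathbb{R}^n)\cap X(\mathbb{R}^n))\setminus\{0\}\right\}<\infty . \] For $a\in\mathcal{M}^0_{X(\mathbb{R}^n)}$, $W_\Omega(a)u:=r_\Omega F^{-1}aFe_\Omega u$ for $u\in L^2(\Omega)\cap X(\Omega)$; this operator is bounded in the norm of $X(\Omega)$, and $W_\Omega(a)$ also denotes its extension by continuity to a bounded linear operator from $X_2(\Omega)$ to $X(\Omega)$.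 Kuratowski measure of noncompactness. For a bounded subset $G$ of a Banach space $\mathcal{Y}$, $\kappa(G)$ is the infimum of the numbers $r$ such that $G$ can be covered by a finite family of sets of diameter at most $r$. For a bounded linear operator $A\in\mathcal{B}(\mathcal{X},\mathcal{Y})$ between Banach spaces, $\|A\|_{\mathcal{B}(\mathcal{X},\mathcal{Y}),\kappa}:=\frac12\,\kappa(A(B_{\mathcal{X}}))$, where $B_{\mathcal{X}}$ is the closed unit ball of $\mathcal{X}$ (note the factor $\frac12$). Separated doubling property. $B(y,R)=\{x\in\mathbb{R}^n:|x-y|<R\}$. The space $X(\Omega)$ has the separated doubling property if there exist $\tau>1$, $C_\tau\in(0,\infty)$, $R_j\nearrow\infty$ and $y_j\in\Omega$ ($j\in\mathbb{N}$) such that $B(y_j,\tau R_j)\subseteq\Omega$ for all $j$, $B(y_j,\tau R_j)\cap B(y_k,\tau R_k)=\emptyset$ for $k\ne j$, and \[ \frac{\|\chi_{B(y_j,\tau R_j)}\|_{X(\Omega)}}{\|\chi_{B(y_j,R_j)}\|_{X(\Omega)}}\le C_\tau,\quad j\in\mathbb{N}. \] *)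

(* Defs.v *)
From HB Require Import structures.
From mathcomp Require Import all_boot all_order all_algebra.
From mathcomp Require Import complex.
From mathcomp Require Import all_classical all_reals all_analysis.
From mathcomp Require Import measurable_realfun lebesgue_integral_fubini.

Set Implicit Arguments.
Unset Strict Implicit.
Unset Printing Implicit Defensive.

Import Order.TTheory GRing.Theory Num.Theory.
Import numFieldNormedType.Exports.

Local Open Scope classical_set_scope.
Local Open Scope ring_scope.

(* n-dimensional Lebesgue measure: the Borel measure on n.-tuple R is the
   n-fold product of the library's one-dimensional measure; it is then
   completed by Caratheodory's construction and carried over to 'rV[R]_n, where
   the vector space structure and the derivatives live. *)

Section product_lebesgue_measure.
Context {R : realType}.
Let T : measurableType _ := measurableTypeR R.

Definition tuple_uncons n (t : n.+1.-tuple T) : T * n.-tuple T :=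
  (thead t, [tuple of behead t]).

Definition tuple_cons n (p : T * n.-tuple T) : n.+1.-tuple T :=
  [the n.+1.-tuple T of p.1 :: p.2].

Lemma measurable_tuple_cons n : measurable_fun [set: T * n.-tuple T] (@tuple_cons n).
Proof. exact: measurable_cons. Qed.

Lemma measurable_tuple_uncons n :
  measurable_fun [set: n.+1.-tuple T] (@tuple_uncons n).
Proof.
apply/measurable_fun_pairP; split; last exact: measurable_behead.
exact: measurable_tnth.
Qed.

Lemma tuple_consK n : cancel (@tuple_cons n) (@tuple_uncons n).
Proof.
by case=> x t; rewrite /tuple_uncons /tuple_cons /=; congr pair; exact/val_inj.
Qed.

Lemma tuple_unconsK n : cancel (@tuple_uncons n) (@tuple_cons n).
Proof. by move=> t; rewrite [in RHS](tuple_eta t); exact/val_inj. Qed.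

Section step.
Local Open Scope ereal_scope.
Context n (nu : {sigma_finite_measure set (n.-tuple T) -> \bar R}).

Definition lebesgue_step : set (n.+1.-tuple T) -> \bar R :=
  pushforward ((lebesgue_measure : set T -> \bar R) \x nu) (@tuple_cons n).

Let step0 : lebesgue_step set0 = 0.
Proof. by rewrite /lebesgue_step /pushforward preimage_set0 measure0. Qed.

Let step_ge0 A : 0 <= lebesgue_step A.
Proof. exact: (measure_ge0 (lebesgue_measure \x nu)). Qed.

Let step_sigma_additive : semi_sigma_additive lebesgue_step.
Proof.
move=> F mF tF mUF; rewrite /lebesgue_step /pushforward preimage_bigcup.
have mp A : measurable A -> measurable (@tuple_cons n @^-1` A).
  by move=> mA; rewrite -[X in measurable X]setTI; exact: measurable_tuple_cons.
apply: measure_semi_sigma_additive.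
- by move=> k; exact: mp.
- apply/trivIsetP => /= i j _ _ ij; rewrite -preimage_setI.
  by move/trivIsetP : tF => /(_ _ _ _ _ ij) ->//; rewrite preimage_set0.
- by rewrite -preimage_bigcup; exact: mp.
Qed.

HB.instance Definition _ := isMeasure.Build _ _ _ lebesgue_step
  step0 step_ge0 step_sigma_additive.

Let step_sigma_finite : sigma_finite setT lebesgue_step.
Proof.
have /sigma_finiteP[F [TF ndF Foo]] :=
  sigma_finiteT (lebesgue_measure : {sigma_finite_measure set T -> \bar R}).
have /sigma_finiteP[G [TG ndG Goo]] := sigma_finiteT nu.
exists (fun k => @tuple_uncons n @^-1` (F k `*` G k)).
  rewrite -preimage_bigcup predeqE => t; split=> // _.
  have [i _ Fi] : (\bigcup_k F k) (thead t) by rewrite -TF.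
  have [j _ Gj] : (\bigcup_k G k) [tuple of behead t] by rewrite -TG.
  exists (maxn i j) => //; split => /=.
  - by move: Fi; exact/subsetPset/ndF/leq_maxl.
  - by move: Gj; exact/subsetPset/ndG/leq_maxr.
move=> k; have [mF Fk] := Foo k; have [mG Gk] := Goo k; split.
  rewrite -[X in measurable X]setTI; apply: measurable_tuple_uncons => //.
  exact: measurableX.
rewrite /lebesgue_step /pushforward -comp_preimage.
rewrite (_ : _ \o _ = id); last by apply/funext => p; exact: tuple_consK.
by rewrite preimage_id product_measure1E// lte_mul_pinfty// ge0_fin_numE.
Qed.

HB.instance Definition _ := Measure_isSigmaFinite.Build _ _ _ lebesgue_step
  step_sigma_finite.

End step.

Fixpoint lebesgue_tuple n : {sigma_finite_measure set (n.-tuple T) -> \bar R} :=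
  match n with
  | 0 => [the {sigma_finite_measure set (0.-tuple T) -> \bar R} of
            dirac [tuple of [::]]]
  | m.+1 => [the {sigma_finite_measure set (m.+1.-tuple T) -> \bar R} of
            lebesgue_step (lebesgue_tuple m)]
  end.

End product_lebesgue_measure.

Section lebesgue_measure_rV.
Context (R : realType) (n : nat).
Local Open Scope ereal_scope.

Definition row_of_tuple (t : n.-tuple (measurableTypeR R)) : 'rV[R]_n :=
  \row_i tnth t i.

Definition lebesgue_outer (A : set 'rV[R]_n) : \bar R :=
  ((lebesgue_tuple n)^*)%mu (row_of_tuple @^-1` A).

Let outer0 : lebesgue_outer set0 = 0.
Proof. by rewrite /lebesgue_outer preimage_set0 outer_measure0. Qed.

Let outer_ge0 A : 0 <= lebesgue_outer A.
Proof. exact: outer_measure_ge0. Qed.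

Let le_outer : {homo lebesgue_outer : A B / A `<=` B >-> A <= B}.
Proof. by move=> A B AB; apply: le_outer_measure => t; exact: AB. Qed.

Let outer_sigma_subadditive : sigma_subadditive lebesgue_outer.
Proof.
move=> F; rewrite /lebesgue_outer preimage_bigcup.
exact: outer_measure_sigma_subadditive.
Qed.

HB.instance Definition _ := isOuterMeasure.Build R 'rV[R]_n lebesgue_outer
  outer0 outer_ge0 le_outer outer_sigma_subadditive.

(* 'rV[R]_n with its sigma-algebra of Lebesgue measurable sets *)
Definition lebesgueType : Type := caratheodory_type lebesgue_outer.

HB.instance Definition _ := Measurable.on lebesgueType.

Definition leb : set lebesgueType -> \bar R := lebesgue_outer.

Let leb0 : leb set0 = 0.
Proof. exact: outer_measure0. Qed.

Let leb_ge0 A : 0 <= leb A.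
Proof. exact: outer_measure_ge0. Qed.

Let leb_sigma_additive : semi_sigma_additive leb.
Proof. exact: caratheodory_measure_sigma_additive. Qed.

HB.instance Definition _ := isMeasure.Build _ _ _ leb
  leb0 leb_ge0 leb_sigma_additive.

End lebesgue_measure_rV.
Arguments leb {R n}.

(* Functions equal almost everywhere are not identified by a quotient: a space
   is a set of functions together with a [0, +oo]-valued seminorm that vanishes
   exactly on the functions that are 0 almost everywhere. *)

Section seminormed_spaces.
Context {R : realType}.
Local Open Scope ereal_scope.

(* The extension by continuity of T : D -> W, with values in Y, where D and Y
   carry the seminorms ND and NY; the values are determined up to the kernel of
   NY when T is bounded and linear. *)
Definition continuous_extension (V W : zmodType)
    (ND : V -> \bar R) (NY : W -> \bar R) (D : set V) (Y : set W)
    (T : V -> W) (u : V) : W :=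
  xget 0%R [set w | Y w /\ exists u_ : nat -> V,
    [/\ forall k, D (u_ k),
        (fun k => ND (u_ k - u)%R) @ \oo --> 0 &
        (fun k => NY (T (u_ k) - w)%R) @ \oo --> 0]].

Definition kuratowski (W : zmodType) (NY : W -> \bar R) (Y G : set W) : \bar R :=
  ereal_inf [set r%:E | r in [set r : R | (0 <= r)%R /\
    exists m (S : 'I_m -> set W),
      (forall i, S i `<=` Y /\
         forall v w, S i v -> S i w -> NY (v - w)%R <= r%:E) /\
      G `<=` \bigcup_i S i]].

Definition kuratowski_norm (V W : zmodType) (NX : V -> \bar R)
    (NY : W -> \bar R) (X : set V) (Y : set W) (T : V -> W) : \bar R :=
  (2^-1)%:E * kuratowski NY Y (T @` [set u | X u /\ NX u <= 1]).

End seminormed_spaces.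

Section function_spaces.
Context {R : realType} {n : nat}.
Local Notation Rn := 'rV[R]_n.
Local Open Scope ereal_scope.

Definition euclid_norm (x : Rn) : R := Num.sqrt (\sum_i x ord0 i ^+ 2).

Definition euclid_ball (y : Rn) (r : R) : set Rn :=
  [set x | (euclid_norm (x - y) < r)%R].

Definition cmeasurable (f : Rn -> R[i]) : Prop :=
  measurable_fun [set: lebesgueType R n] (fun x : Rn => complex.Re (f x)) /\
  measurable_fun [set: lebesgueType R n] (fun x : Rn => complex.Im (f x)).

Definition cabs (f : Rn -> R[i]) (x : Rn) : \bar R := (Normc.normc (f x))%:E.

Definition cLnorm (p : \bar R) (f : Rn -> R[i]) : \bar R :=
  'N[leb : {measure set (lebesgueType R n) -> \bar R}]_p[cabs f].

Definition cLp (p : \bar R) : set (Rn -> R[i]) :=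
  [set f | cmeasurable f /\ cLnorm p f < +oo].

Definition nonneg_measurable (f : Rn -> \bar R) : Prop :=
  measurable_fun [set: lebesgueType R n] f /\ forall x, 0 <= f x.

Record banach_function_norm (rho : (Rn -> \bar R) -> \bar R) : Prop := {
  bfn_ge0 : forall f, nonneg_measurable f -> 0 <= rho f;
  bfn_eq0 : forall f, nonneg_measurable f ->
    (rho f = 0 <-> \forall x \ae leb, f x = 0);
  bfn_scale : forall (c : R) f, (0 <= c)%R -> nonneg_measurable f ->
    rho (fun x => c%:E * f x) = c%:E * rho f;
  bfn_triangle : forall f g, nonneg_measurable f -> nonneg_measurable g ->
    rho (fun x => f x + g x) <= rho f + rho g;
  bfn_mono : forall f g, nonneg_measurable f -> nonneg_measurable g ->
    (\forall x \ae leb, g x <= f x) -> rho g <= rho f;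
  bfn_fatou : forall (f_ : nat -> Rn -> \bar R) f,
    (forall k, nonneg_measurable (f_ k)) -> nonneg_measurable f ->
    (\forall x \ae leb, nondecreasing_seq (f_^~ x) /\ f_ ^~ x @ \oo --> f x) ->
    nondecreasing_seq (rho \o f_) /\ rho \o f_ @ \oo --> rho f;
  bfn_bounded_fin : forall E : set (lebesgueType R n), measurable E ->
    bounded_set (E : set Rn) -> rho (EFin \o \1_E) < +oo;
  bfn_bounded_int : forall E : set (lebesgueType R n), measurable E ->
    bounded_set (E : set Rn) -> exists C : R, (0 < C)%R /\
      forall f, nonneg_measurable f -> \int[leb]_(x in E) f x <= C%:E * rho f }.

Section bfs.
Variable rho : (Rn -> \bar R) -> \bar R.

Definition bfs_norm (f : Rn -> R[i]) : \bar R := rho (cabs f).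

Definition bfs : set (Rn -> R[i]) :=
  [set f | cmeasurable f /\ bfs_norm f < +oo].

Section restricted.
Variable Omega : set Rn.

Definition ext0 (f : Omega -> R[i]) : Rn -> R[i] := valL_ 0%R f.

Definition restr (f : Rn -> R[i]) : Omega -> R[i] := sigL Omega f.

Definition bfsO_norm (f : Omega -> R[i]) : \bar R := bfs_norm (ext0 f).

(* As Omega is measurable, f is measurable on Omega iff ext0 f is. *)
Definition bfsO : set (Omega -> R[i]) := [set f | bfs (ext0 f)].

Definition L2_bfsO : set (Omega -> R[i]) :=
  [set f | cLp 2%:E (ext0 f) /\ bfsO f].

Definition bfsO2 : set (Omega -> R[i]) :=
  [set f | bfsO f /\ forall e : R, (0 < e)%R ->
    exists2 g, L2_bfsO g & bfsO_norm (f - g)%R < e%:E].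

Definition separated_doubling : Prop :=
  exists (tau C : R) (r : nat -> R) (y : nat -> Rn),
  [/\ (1 < tau)%R /\ (0 < C)%R,
      [/\ forall j, (0 < r j)%R, nondecreasing_seq r & r @ \oo --> +oo%R],
      forall j, Omega (y j) /\ euclid_ball (y j) (tau * r j)%R `<=` Omega,
      forall j k, j <> k ->
        euclid_ball (y j) (tau * r j)%R `&` euclid_ball (y k) (tau * r k)%R
        = set0 &
      forall j,
        bfsO_norm (restr \1_(euclid_ball (y j) (tau * r j)%R)) /
        bfsO_norm (restr \1_(euclid_ball (y j) (r j))) <= C%:E].

End restricted.
End bfs.
End function_spaces.

Arguments restr {R n} Omega f.
Arguments bfsO_norm {R n} rho Omega f.
Arguments bfsO {R n} rho Omega f.
Arguments L2_bfsO {R n} rho Omega f.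
Arguments bfsO2 {R n} rho Omega f.

Section fourier.
Context {R : realType} {n : nat}.
Local Notation Rn := 'rV[R]_n.

Definition partials (s : seq 'I_n) (f : Rn -> R) : Rn -> R :=
  foldr (fun i g x => 'D_(delta_mx ord0 i) g x) f s.

Definition real_schwartz (f : Rn -> R) : Prop :=
  forall s : seq 'I_n,
    (forall x : Rn, differentiable (partials s f) x) /\
    forall k : nat, exists M : R, forall x : Rn,
      (1 + euclid_norm x) ^+ k * `|partials s f x| <= M.

Definition schwartz : set (Rn -> R[i]) :=
  [set u | real_schwartz (fun x => complex.Re (u x)) /\
           real_schwartz (fun x => complex.Im (u x))].

Definition dot (x y : Rn) : R := \sum_i x ord0 i * y ord0 i.

Definition expi (t : R) : R[i] := Complex (cos t) (sin t).

Definition cintegral (f : Rn -> R[i]) : R[i] :=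
  Complex (\int[@leb R n]_x complex.Re (f x)) (\int[@leb R n]_x complex.Im (f x)).

Definition schwartz_fourier (u : Rn -> R[i]) : Rn -> R[i] :=
  fun xi => cintegral (fun x => u x * expi (- dot x xi)).

Definition schwartz_ifourier (v : Rn -> R[i]) : Rn -> R[i] :=
  xget 0 [set u | schwartz u /\ schwartz_fourier u = v].

Definition fourier : (Rn -> R[i]) -> (Rn -> R[i]) :=
  continuous_extension (cLnorm 2%:E) (cLnorm 2%:E) schwartz (cLp 2%:E)
    schwartz_fourier.

Definition ifourier : (Rn -> R[i]) -> (Rn -> R[i]) :=
  continuous_extension (cLnorm 2%:E) (cLnorm 2%:E) schwartz (cLp 2%:E)
    schwartz_ifourier.

Definition multiplier_op (a u : Rn -> R[i]) : Rn -> R[i] :=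
  ifourier (fun xi => a xi * fourier u xi).

Definition multiplier (rho : (Rn -> \bar R) -> \bar R) : set (Rn -> R[i]) :=
  [set a | cLp +oo%E a /\
    (ereal_sup [set bfs_norm rho (multiplier_op a u) / bfs_norm rho u |
       u in [set u | [/\ cLp 2%:E u, bfs rho u &
                         ~ \forall x \ae leb, u x = 0%R]]] < +oo)%E].

Definition wiener_hopf0 (Omega : set Rn) (a : Rn -> R[i]) (u : Omega -> R[i]) :
    Omega -> R[i] :=
  restr Omega (multiplier_op a (ext0 u)).

Definition wiener_hopf (rho : (Rn -> \bar R) -> \bar R) (Omega : set Rn)
    (a : Rn -> R[i]) : (Omega -> R[i]) -> (Omega -> R[i]) :=
  continuous_extension (bfsO_norm rho Omega) (bfsO_norm rho Omega)
    (L2_bfsO rho Omega) (bfsO rho Omega)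
    (wiener_hopf0 a).

End fourier.

(* Main.v *)
(* Let r be such that the image of the unit ball is covered by m sets of diameter
   at most r, and suppose that |a| > r + e on a set E of positive measure.  Test
   W(a) on wave packets u_j(x) = exp(i eta x) f((x - y_j) / R_j) / |chi_j|, where
   f is a smooth cutoff between two concentric balls, R_j is the radius, eta is in
   E and |chi_j| is the norm of the indicator of the larger ball.  The Fourier
   transform of u_j concentrates at eta as R_j grows, so a Lebesgue point argument
   yields an eta in E for which F^-1 a F u_j - a(eta) u_j is uniformly small
   (relative to 1 / |chi_j|) for m + 1 indices j.  Two of the images W(a) u_j,
   W(a) u_k lie in the same set of the cover.  As the supports are disjoint, the
   smaller of the two balls sees |a(eta)| |chi_B(y_j, R_j)| / |chi_j| of their
   difference, up to small errors; subdividing the annuli geometrically makes this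
   ratio of norms as close to 1 as desired, which contradicts |a(eta)| > r + e.
   The Fourier analysis behind this (inversion and Plancherel on Schwartz
   functions, density, extension to L2) is carried out with cosine transforms,
   and its inversion constant is identified only up to positivity. *)
Require Import Defs.
From HB Require Import structures.
From mathcomp Require Import all_boot all_order all_algebra.
From mathcomp Require Import complex.
From mathcomp Require Import all_classical all_reals all_analysis.
From mathcomp Require Import measurable_realfun lebesgue_integral_fubini ess_sup_inf.
From mathcomp Require Import ring lra zify.

Set Implicit Arguments.
Unset Strict Implicit.
Unset Printing Implicit Defensive.

Import Order.TTheory GRing.Theory Num.Theory.
Import numFieldNormedType.Exports.

Local Open Scope classical_set_scope.
Local Open Scope ring_scope.

(** * Affine changes of variables *)

(** Nothing ties [rho] to translations or to L2; quantitatively it is accessible only through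
    monotonicity against multiples of indicators. Hence the estimates must hold pointwise almost
    everywhere: the error F^-1 (a - a(eta)) F u_j is bounded in the supremum norm by the L1 norm of
    (a - a(eta)) F u_j, while the L2 theory mainly gives the operators their meaning. The norms of
    the balls for different j are not comparable. This is why the index with the smaller norm is
    kept: after normalisation the error of the other packet is then the smaller one. The frequency
    eta must serve m + 1 radii at once. It is found by averaging over E rather than by
    differentiation at a point: by Fubini, a small L1 error smoothed by a dilated kernel has a small
    integral over E, uniformly in the radius. The operators are defined through choice, so they are
    additive only up to null functions, and linearity is replaced by almost everywhere statements
    about differences. *)

Lemma ge0_integral_comp_scale d1 d2 (T1 : measurableType d1)
    (T2 : measurableType d2) (R : realType) (mu1 : {measure set T1 -> \bar R})
    (mu2 : {measure set T2 -> \bar R}) (phi : T1 -> T2) (c : {nonneg R}) :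
  measurable_fun setT phi ->
  (forall A, measurable A -> mu1 (phi @^-1` A) = c%:num%:E * mu2 A)%E ->
  forall f : T2 -> \bar R, measurable_fun setT f -> (forall x, 0 <= f x)%E ->
  (\int[mu1]_x f (phi x) = c%:num%:E * \int[mu2]_x f x)%E.
Proof.
move=> mphi H f mf f0.
transitivity (\int[pushforward mu1 phi]_y f y)%E.
  by rewrite (@ge0_integral_pushforward _ _ _ _ _ _ mphi)// preimage_setT.
rewrite -(@ge0_integral_mscale _ _ _ _ _ measurableT c f mf)//.
by apply: eq_measure_integral => A mA _; exact: H.
Qed.

Section affine_invariance.
Context {R : realType}.
Implicit Types (s y : R).
Local Notation T := (measurableTypeR R).

Lemma measurable_affine s y :
  @measurable_fun _ _ T T [set: T] (fun x : T => s * x + y).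
Proof. by apply: measurable_funD => //; exact: measurable_funM. Qed.

(** Uniqueness of Lebesgue measure: [|s|] times the pushforward under the affine map gives every
    half-open interval its length. For s < 0 the preimage is closed on the other side, which does
    not change its length. *)
Lemma lebesgue_measure_affine s y (A : set T) : s != 0 -> measurable A ->
  lebesgue_measure ((fun x => s * x + y) @^-1` A) =
  (`|s^-1|%:E * lebesgue_measure A)%E.
Proof.
move=> s0 mA.
have s10 : 0 < `|s|^-1 by rewrite invr_gt0 normr_gt0.
pose phi (x : T) : T := s * x + y.
pose m : {measure set T -> \bar R} :=
  mscale (NngNum (normr_ge0 s)) (pushforward lebesgue_measure phi).
suff -> : lebesgue_measure A = m (measurable_affine s y) A.
  rewrite /m /mscale /pushforward /= muleA -EFinM normrV ?unitfE// mulVf ?mul1e//.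
  by rewrite normr_eq0.
apply: lebesgue_measure_unique mA => _ [[a b] _ <-] /=.
rewrite /m /mscale /pushforward /=.
have [sgt|slt|seq] := ltgtP 0 s; last by rewrite -seq eqxx in s0.
- rewrite [X in (_ * lebesgue_measure X)%E](_ : _ = `](a - y) / s, (b - y) / s]%classic); last first.
    apply/seteqP; split => x /=; rewrite /phi !in_itv/=.
    + by rewrite ltr_pdivrMr// ler_pdivlMr// ltrBlDr lerBrDr (mulrC x).
    + by rewrite ltr_pdivrMr// ler_pdivlMr// ltrBlDr lerBrDr (mulrC x).
  rewrite !lebesgue_measure_itv/= !lte_fin ltr_pM2r ?invr_gt0// ltrD2r.
  case: ifP => _; last by rewrite mule0.
  by rewrite -!EFinD -EFinM gtr0_norm//; congr EFin; field.
- rewrite [X in (_ * lebesgue_measure X)%E](_ : _ = `[(b - y) / s, (a - y) / s[%classic); last first.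
    apply/seteqP; split => x /=; rewrite /phi !in_itv/=.
    + by rewrite ler_ndivrMr// ltr_ndivlMr// ltrBlDr lerBrDr (mulrC x) andbC.
    + by rewrite ler_ndivrMr// ltr_ndivlMr// ltrBlDr lerBrDr (mulrC x) andbC.
  rewrite !lebesgue_measure_itv/= !lte_fin ltr_nM2r ?invr_lt0// ltrD2r.
  case: ifP => _; last by rewrite mule0.
  by rewrite -!EFinD -EFinM ltr0_norm//; congr EFin; field.
Qed.

Definition tuple_affine n s (y : n.-tuple R) (t : n.-tuple T) : n.-tuple T :=
  [tuple s * tnth t i + tnth y i | i < n].

Lemma measurable_tuple_affine n s (y : n.-tuple R) :
  measurable_fun setT (@tuple_affine n s y).
Proof.
apply/measurable_fun_tnthP => i.
rewrite (_ : _ \o _ = (fun x : T => s * x + tnth y i) \o (@tnth n T ^~ i)).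
  apply: (@measurableT_comp _ _ _ _ _ _ (fun x : T => s * x + tnth y i)).
    exact: measurable_affine.
  exact: measurable_tnth.
by apply/funext => t /=; rewrite tnth_mktuple.
Qed.

Lemma tuple_affine_cons n s (y : n.+1.-tuple R) (p : T * n.-tuple T) :
  tuple_affine s y (tuple_cons p) =
  tuple_cons (s * p.1 + thead y, tuple_affine s [tuple of behead y] p.2).
Proof.
apply: eq_from_tnth => i; rewrite tnth_mktuple.
case: (unliftP ord0 i) => [j ->|->].
  rewrite !tnthS tnth_mktuple; congr (_ * _ + _).
  by rewrite tnth_behead; congr (tnth y _); apply/val_inj; rewrite /= inordK ?ltnS.
by rewrite !tnth0.
Qed.

(** Induction on the dimension by slicing: sections of the preimage are preimages of sections, and
    the outer integral contributes one more factor |1/s|. *)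
Lemma lebesgue_tuple_affine n s (y : n.-tuple R) (A : set (n.-tuple T)) :
  s != 0 -> measurable A ->
  lebesgue_tuple n (tuple_affine s y @^-1` A) =
  ((`|s^-1| ^+ n)%:E * lebesgue_tuple n A)%E.
Proof.
move=> s0; elim: n => [|n IH] in y A *.
  have E (t u : 0.-tuple T) : t = u by rewrite (tuple0 t) (tuple0 u).
  move=> mA; rewrite expr0 mul1e; congr (lebesgue_tuple 0 _).
  by apply/seteqP; split=> t /=; rewrite (E (tuple_affine s y t) t).
move=> mA; rewrite /= /lebesgue_step /pushforward /product_measure1.
set B := @tuple_cons R n @^-1` A.
have mB : measurable B.
  rewrite -[X in measurable X]setTI; exact: measurable_tuple_cons.
have -> : (\int[lebesgue_measure]_x (lebesgue_tuple n \o
    xsection (@tuple_cons R n @^-1` (tuple_affine s y @^-1` A))) x =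
  \int[lebesgue_measure]_x ((`|s^-1| ^+ n)%:E *
     (lebesgue_tuple n \o xsection B) (s * x + thead y)%R))%E.
  apply: eq_integral => x _ /=; rewrite -(IH [tuple of behead y]); last first.
    exact: measurable_xsection.
  congr (lebesgue_tuple n _); apply/seteqP; split=> t /=.
    by rewrite /xsection/= !inE/= tuple_affine_cons.
  by rewrite /xsection/= !inE/= tuple_affine_cons.
have mF : measurable_fun setT (lebesgue_tuple n \o xsection B).
  exact: measurable_fun_xsection.
rewrite ge0_integralZl ?lee_fin ?exprn_ge0//; last first.
  by apply: (measurableT_comp mF); exact: measurable_affine.
rewrite (@ge0_integral_comp_scale _ _ _ _ _ lebesgue_measure lebesgue_measure
  (fun x : T => s * x + thead y) (NngNum (normr_ge0 s^-1)))//.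
- by rewrite muleA -EFinM exprS mulrC.
- exact: measurable_affine.
- by move=> D mD; exact: lebesgue_measure_affine.
Qed.

End affine_invariance.

Section lebesgue_rV.
Context {R : realType} {n : nat}.
Local Notation T := (measurableTypeR R).
Local Notation Rn := 'rV[R]_n.
Local Notation LT := (lebesgueType R n).

Definition tuple_of_row (x : Rn) : n.-tuple T := [tuple x ord0 i | i < n].

Lemma row_of_tupleK : cancel (@row_of_tuple R n) tuple_of_row.
Proof.
by move=> t; apply: eq_from_tnth => i; rewrite tnth_mktuple mxE.
Qed.

Lemma tuple_of_rowK : cancel tuple_of_row (@row_of_tuple R n).
Proof. by move=> x; apply/rowP => i; rewrite mxE tnth_mktuple. Qed.

Lemma row_of_tuple_affine (s : R) (y : Rn) t :
  row_of_tuple (tuple_affine s (tuple_of_row y) t) = s *: row_of_tuple t + y.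
Proof. by apply/rowP => i; rewrite !mxE !tnth_mktuple. Qed.

Lemma leb_measurableE (A : set Rn) :
  measurable (A : set LT) = caratheodory_measurable (@lebesgue_outer R n) A.
Proof. by []. Qed.

Lemma measurable_row (A : set Rn) :
  measurable (@row_of_tuple R n @^-1` A) -> measurable (A : set LT).
Proof.
move=> mA; rewrite leb_measurableE => X; rewrite /lebesgue_outer !preimage_setI preimage_setC.
exact: (@caratheodory_measurable_mu_ext _ _ _ (lebesgue_tuple n) _ mA).
Qed.

Lemma leb_row (A : set Rn) : measurable (@row_of_tuple R n @^-1` A) ->
  leb A = lebesgue_tuple n (@row_of_tuple R n @^-1` A).
Proof. exact: measurable_mu_extE. Qed.

(** Preimages of a cover of A by Borel sets cover the preimage of A. The set A is arbitrary because
    the Caratheodory criterion tests against arbitrary sets. *)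
Lemma lebesgue_outer_affine_le (s : R) (y : Rn) (A : set Rn) : s != 0 ->
  (lebesgue_outer ((fun x => s *: x + y)%R @^-1` A) <=
  (`|s^-1| ^+ n)%:E * lebesgue_outer A)%E.
Proof.
move=> s0; rewrite /lebesgue_outer.
have c0 : 0 < `|s^-1| ^+ n by rewrite exprn_gt0// normr_gt0 invr_eq0.
rewrite -lee_pdivrMl//; apply: le_ereal_inf_tmp => _ [F [mF AF] <-].
rewrite lee_pdivrMl// -nneseriesZl//.
apply: ge_ereal_inf.
exists (\sum_(0 <= i <oo) lebesgue_tuple n
    (tuple_affine s (tuple_of_row y) @^-1` F i))%E.
  exists (fun i => tuple_affine s (tuple_of_row y) @^-1` F i) => //.
  split=> [i|t].
    rewrite -[X in measurable X]setTI; exact: measurable_tuple_affine.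
  rewrite /preimage/= -row_of_tuple_affine => /AF[i _ Fi].
  by exists i.
apply: lee_nneseries => // i _.
by rewrite lebesgue_tuple_affine.
Qed.

Lemma lebesgue_outer_affine (s : R) (y : Rn) (A : set Rn) : s != 0 ->
  lebesgue_outer ((fun x => s *: x + y)%R @^-1` A) =
  ((`|s^-1| ^+ n)%:E * lebesgue_outer A)%E.
Proof.
move=> s0; apply/eqP; rewrite eq_le lebesgue_outer_affine_le//=.
have c0 : 0 < `|s^-1| ^+ n by rewrite exprn_gt0// normr_gt0 invr_eq0.
rewrite -lee_pdivlMl//.
rewrite {1}(_ : A = (fun x => s^-1 *: x + (- (s^-1 *: y)))%R @^-1`
   ((fun x => s *: x + y)%R @^-1` A)); last first.
  apply/seteqP; split=> x;
  by rewrite /preimage/= scalerDr scalerA mulfV// scale1r scalerN scalerA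
    mulfV// scale1r subrK.
apply: le_trans (lebesgue_outer_affine_le _ _ _) _; first by rewrite invr_eq0.
rewrite !invrK lee_wpmul2r ?outer_measure_ge0//.
by rewrite lee_fin normrV ?unitfE// exprVn invrK.
Qed.

(** Each test set of the Caratheodory criterion is itself a preimage, so the criterion for A scales
    to the one for its preimage. *)
Lemma measurable_preimage_affine (s : R) (y : Rn) (A : set Rn) : s != 0 ->
  measurable (A : set LT) ->
  measurable ((fun x => s *: x + y)%R @^-1` A : set LT).
Proof.
move=> s0 mA; rewrite leb_measurableE => X; rewrite /=.
have [X' ->] : exists X', X = (fun x => s *: x + y)%R @^-1` X'.
  exists ((fun x => s^-1 *: x + (- (s^-1 *: y)))%R @^-1` X).
  apply/seteqP; split=> x; rewrite /preimage/= scalerDr scalerA mulVf// scale1r;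
  by rewrite addrK.
have XA : lebesgue_outer X' =
    (lebesgue_outer (X' `&` A) + lebesgue_outer (X' `&` ~` A))%E by exact: mA.
have H B := lebesgue_outer_affine y B s0.
rewrite (H X') XA ge0_muleDr ?outer_measure_ge0//.
by rewrite -!H.
Qed.

Lemma measurable_affine_rV (s : R) (y : Rn) : s != 0 ->
  @measurable_fun _ _ LT LT setT (fun x : Rn => s *: x + y).
Proof.
by move=> s0 _ A mA; rewrite setTI; exact: measurable_preimage_affine.
Qed.

Lemma ge0_integral_leb_affine (s : R) (y : Rn) (f : LT -> \bar R) : s != 0 ->
  measurable_fun setT f -> (forall x, 0 <= f x)%E ->
  (\int[leb]_x f (s *: (x : Rn) + y)%R = (`|s^-1| ^+ n)%:E * \int[leb]_x f x)%E.
Proof.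
move=> s0 mf f0.
have c0 : 0 <= `|s^-1| ^+ n by rewrite exprn_ge0.
have H (A : set LT) : measurable A ->
    leb ((fun x : LT => s *: (x : Rn) + y : LT)%R @^-1` A) =
    ((NngNum c0)%:num%:E * leb A)%E := fun _ => lebesgue_outer_affine y A s0.
exact: (@ge0_integral_comp_scale _ _ LT LT R leb leb _ (NngNum c0)
  (measurable_affine_rV y s0) H f mf f0).
Qed.

Lemma leb_affine (s : R) (y : Rn) (A : set Rn) : s != 0 ->
  leb ((fun x => s *: x + y)%R @^-1` A) = ((`|s^-1| ^+ n)%:E * leb A)%E.
Proof. exact: lebesgue_outer_affine. Qed.

Let leb_sigma_finite : sigma_finite setT (@leb R n).
Proof.
have /sigma_finiteP[F [TF ndF Foo]] := sigma_finiteT (@lebesgue_tuple R n).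
exists (fun k => @tuple_of_row @^-1` F k).
  by rewrite -preimage_bigcup -TF preimage_setT.
have E k : @row_of_tuple R n @^-1` (tuple_of_row @^-1` F k) = F k.
  by apply/seteqP; split=> t; rewrite /preimage/= row_of_tupleK.
move=> k; have [mF Fk] := Foo k; split.
  by apply: measurable_row; rewrite E.
by rewrite leb_row E.
Qed.

HB.instance Definition _ := Measure_isSigmaFinite.Build _ _ _ (@leb R n)
  leb_sigma_finite.

Lemma measurable_coord (i : 'I_n) :
  measurable_fun setT (fun x : LT => (x : Rn) ord0 i).
Proof.
move=> _ A mA; rewrite setTI; apply: measurable_row.
rewrite [X in measurable X](_ : _ = setT `&` (@tnth n T ^~ i) @^-1` A).
  exact: measurable_tnth.
by rewrite setTI; apply/seteqP; split=> t; rewrite /preimage/= mxE.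
Qed.

(** Second countability: an open set is the union of the rational cubes inside it, and the preimage
    of a cube is measurable as soon as the coordinates of [phi] are. The general source X covers
    functions on a product of two copies of R^n. *)
Lemma measurable_continuous_comp d (X : measurableType d) (phi : X -> Rn)
    (g : Rn -> R) :
  (forall i, measurable_fun setT (fun t => phi t ord0 i)) -> continuous g ->
  measurable_fun setT (g \o phi).
Proof.
move=> mphi cg; apply: (measurability (@RGenOInfty.G R)).
  exact: RGenOInfty.measurableE.
move=> _ [_ [a ->] <-]; rewrite setTI comp_preimage.
set U := g @^-1` _.
have oU : open U.
  apply: open_comp; last exact: interval_open.
  by move=> x _; exact: cg.
pose B (p : 'rV[rat]_n * nat) : set Rn :=
  [set x | forall i, `|x ord0 i - ratr (p.1 ord0 i)| < p.2.+1%:R^-1].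
have mB p : measurable (phi @^-1` B p).
  rewrite [X in measurable X](_ : _ = \bigcap_(i in [set` (index_enum 'I_n)])
      [set t | `|phi t ord0 i - ratr (p.1 ord0 i)| < p.2.+1%:R^-1]).
    apply: fin_bigcap_measurable; first exact: finite_seq.
    move=> i _; rewrite -[X in measurable X]setTI.
    apply: measurable_fun_ltr => //.
    apply: measurableT_comp => //; exact: measurable_funB.
  apply/seteqP; split=> t /=.
    by move=> h i _; exact: h.
  by move=> h i; apply: h => /=; rewrite mem_index_enum.
rewrite [X in measurable X](_ : _ =
    \bigcup_(p in [set p | B p `<=` U]) phi @^-1` B p).
  apply: bigcup_measurable_countable || rewrite bigcup_mkcond.
  apply: countable_bigcupT_measurable => // p.
  by case: ifPn.
apply/seteqP; split=> t /=; last by move=> [p pU Bt]; exact: pU.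
move=> Ut.
have /nbhs_ballP[e /= e0 eU] := open_nbhs_nbhs (conj oU Ut).
(* Two points of the cube lie within 1/(k + 1) of its rational centre, hence within 2/(k + 1) < e of
   each other. *)
pose k := Num.truncn (2 / e).
have ke : k.+1%:R^-1 < e / 2.
  rewrite invf_plt ?posrE ?divr_gt0// invf_div; exact: Num.Theory.truncnS_gt.
have d0 : 0 < k.+1%:R^-1 :> R by rewrite invr_gt0.
have Bk c : B (c, k) = [set x | forall i, `|x ord0 i - ratr (c ord0 i)| < k.+1%:R^-1] by [].
move: (k.+1%:R^-1) ke d0 Bk => r ke r0 Bk.
have /choice[c Hc] : forall i : 'I_n, exists q : rat,
    `|phi t ord0 i - ratr q| < r.
  move=> i.
  have : phi t ord0 i - r < phi t ord0 i + r by lra.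
  move=> /rat_in_itvoo[q]; rewrite in_itv/= => /andP[q1 q2].
  by exists q; rewrite ltr_norml; apply/andP; split; lra.
exists (\row_i c i, k) => /=; rewrite Bk.
  move=> x /= Bx; apply: eU; split=> // i j; rewrite ord1 /ball/=.
  have /ltr_normlP[h1 h2] : `|phi t ord0 j - ratr (c j)| < r by exact: Hc.
  have /ltr_normlP[h3 h4] : `|x ord0 j - ratr (c j)| < r.
    by have := Bx j; rewrite mxE.
  by apply/ltr_normlP; split; lra.
by move=> i /=; rewrite mxE.
Qed.

Lemma continuous_measurable_leb (g : Rn -> R) : continuous g ->
  measurable_fun setT (g : LT -> R).
Proof.
exact: (@measurable_continuous_comp _ LT id g measurable_coord).
Qed.

End lebesgue_rV.

(** * Volumes of cubes and integrability of polynomial decay *)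

Section box_measure.
Context {R : realType}.
Local Notation T := (measurableTypeR R).

Definition tuple_box n (r : R) : set (n.-tuple T) :=
  [set t | forall i, `|tnth t i| <= r].

Lemma tuple_box_cons n (r : R) :
  @tuple_cons R n @^-1` @tuple_box n.+1 r = `[- r, r]%classic `*` @tuple_box n r.
Proof.
apply/seteqP; split=> [[x t]|[x t] /= [+ h] i].
- rewrite /tuple_box/= => h; split=> /= [|i].
    by have := h ord0; rewrite tnth0 ler_norml in_itv.
  by have := h (lift ord0 i); rewrite tnthS.
- rewrite in_itv/= => xr.
  case: (unliftP ord0 i) => [j ->|->]; last by rewrite tnth0 ler_norml.
  by rewrite tnthS; exact: h.
Qed.

Lemma measurable_tuple_box n (r : R) : measurable (@tuple_box n r).
Proof.
rewrite (_ : tuple_box r = \bigcap_(i in [set` index_enum 'I_n])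
    (@tnth n T ^~ i @^-1` `[- r, r])).
  apply: fin_bigcap_measurable; first exact: finite_seq.
  move=> i _; rewrite -[X in measurable X]setTI; exact: measurable_tnth.
apply/seteqP; split=> t /= h i; first by rewrite /= in_itv/= -ler_norml.
by have := h i (mem_index_enum i); rewrite /= in_itv/= -ler_norml.
Qed.

Lemma lebesgue_tuple_box n (r : R) : 0 <= r ->
  lebesgue_tuple n (@tuple_box n r) = (((r *+ 2) ^+ n)%:E).
Proof.
move=> r0; elim: n => [|n IH].
  by rewrite expr0 /= diracE mem_set// => -[].
rewrite /= /lebesgue_step /pushforward tuple_box_cons.
rewrite product_measure1E//; last exact: measurable_tuple_box.
rewrite exprS EFinM; congr (_ * _)%E; last exact: IH.
etransitivity; first exact: lebesgue_measure_itv.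
rewrite /= lte_fin; case: ltP => h; first by rewrite -EFinD opprK mulr2n.
have -> : r = 0 by lra.
by rewrite mul0rn.
Qed.

End box_measure.

Section rV_norm.
Context {R : realType} {n : nat}.
Implicit Types x y : 'rV[R]_n.

Lemma rV_norm_le x (c : R) : 0 <= c -> (forall i, `|x ord0 i| <= c) -> `|x| <= c.
Proof.
move=> c0 h; rewrite [leLHS]mx_normrE; apply: bigmax_le => // -[i j] _ /=.
by rewrite ord1.
Qed.

Lemma rV_norm_coord x i : `|x ord0 i| <= `|x|.
Proof.
rewrite [leRHS]mx_normrE; exact: (le_bigmax _ (fun ij => `|x ij.1 ij.2|) (ord0, i)).
Qed.

Lemma euclid_norm_ge0 x : 0 <= euclid_norm x.
Proof. exact: sqrtr_ge0. Qed.

Lemma sqr_euclid_norm x : euclid_norm x ^+ 2 = \sum_i x ord0 i ^+ 2.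
Proof. by rewrite sqr_sqrtr// sumr_ge0// => i _; rewrite sqr_ge0. Qed.

Lemma euclid_norm_coord x i : `|x ord0 i| <= euclid_norm x.
Proof.
rewrite -sqrtr_sqr ler_wsqrtr// (bigD1 i)//= lerDl sumr_ge0// => j _.
exact: sqr_ge0.
Qed.

Lemma rV_norm_le_euclid x : `|x| <= euclid_norm x.
Proof.
by apply: rV_norm_le => [|i]; [exact: euclid_norm_ge0|exact: euclid_norm_coord].
Qed.

Lemma euclid_norm_le x : euclid_norm x <= n%:R * `|x|.
Proof.
rewrite -[leRHS]ger0_norm ?mulr_ge0// -[leRHS]sqrtr_sqr ler_wsqrtr//.
apply: (@le_trans _ _ (\sum_(i < n) `|x| ^+ 2)).
  apply: ler_sum => i _; rewrite -[leLHS]real_normK ?num_real//.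
  by rewrite lerXn2r ?nnegrE// rV_norm_coord.
rewrite sumr_const card_ord exprMn -[leLHS]mulr_natl ler_wpM2r ?sqr_ge0//.
have [->|n0] := posnP n; first by rewrite expr0n.
by rewrite -natrX ler_nat expnS expn1 leq_pmulr.
Qed.

Lemma euclid_norm_scale (s : R) x : euclid_norm (s *: x) = `|s| * euclid_norm x.
Proof.
rewrite /euclid_norm -sqrtr_sqr -sqrtrM ?sqr_ge0//; congr Num.sqrt.
by rewrite mulr_sumr; apply: eq_bigr => i _; rewrite mxE exprMn.
Qed.

End rV_norm.

Section lebesgue_box.
Context {R : realType} {n : nat}.
Local Notation Rn := 'rV[R]_n.
Local Notation LT := (lebesgueType R n).

Definition cube (r : R) : set Rn := [set x | forall i, `|x ord0 i| <= r].

Let preimage_cube (r : R) : @row_of_tuple R n @^-1` cube r = @tuple_box R n r.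
Proof.
by apply/seteqP; split=> t h i; have := h i; rewrite /= mxE.
Qed.

Lemma measurable_cube (r : R) : measurable (cube r : set LT).
Proof. by apply: measurable_row; rewrite preimage_cube; exact: measurable_tuple_box. Qed.

Lemma leb_cube (r : R) : 0 <= r -> leb (cube r) = ((r *+ 2) ^+ n)%:E.
Proof.
move=> r0; rewrite leb_row preimage_cube; first exact: lebesgue_tuple_box.
exact: measurable_tuple_box.
Qed.

Lemma cube_norm (r : R) : 0 <= r -> cube r = [set x | `|x| <= r].
Proof.
move=> r0; apply/seteqP; split=> x /= h; first exact: rV_norm_le.
by move=> i; apply: le_trans h; exact: rV_norm_coord.
Qed.

Lemma continuous_decay k : continuous (fun x : Rn => ((1 + `|x|) ^+ k)^-1).
Proof.
move=> x; apply: (@continuousV R Rn (fun x => (1 + `|x|) ^+ k) x).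
  by rewrite gt_eqF// exprn_gt0// ltr_pwDl.
apply: (@continuous_comp _ _ _ (fun x : Rn => 1 + `|x|) (fun t : R => t ^+ k)).
  apply: (@continuousD R R Rn (fun=> 1) (fun x : Rn => `|x|)).
    exact: (@cst_continuous Rn R 1 x).
  exact: norm_continuous.
exact: exprn_continuous.
Qed.

(** Comparison with a series over dyadic cubes: if 2^k is the least dyadic half-side reaching x, the
    integrand is at most [c k], and [c k] times the volume of that cube decays like 2^-k. *)
Lemma integral_decay_fin :
  (\int[@leb R n]_x (((1 + `|x : Rn|) ^+ n.+1)^-1)%:E < +oo)%E.
Proof.
(* This is 2^-((k - 1)(n + 1)), a bound for the integrand where |x| > 2^(k - 1). *)
pose c (k : nat) : R := 2 ^+ n.+1 * (2 ^+ n.+1) ^- k.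
have c0 k : 0 <= c k by rewrite mulr_ge0// ?exprn_ge0// invr_ge0 !exprn_ge0.
pose F k (x : LT) : \bar R := (c k * \1_(cube (2 ^+ k)) (x : Rn))%:E.
have F0 k x : (0 <= F k x)%E by rewrite lee_fin mulr_ge0// indicE.
have mF k : measurable_fun setT (F k).
  apply/measurable_EFinP; apply: measurable_funM; first exact: measurable_cst.
  apply: measurable_indic; exact: measurable_cube.
have mN : measurable_fun [set: LT] (fun x : LT => ((1 + `|x : Rn|) ^+ n.+1)^-1).
  exact: continuous_measurable_leb (@continuous_decay n.+1).
apply: (@le_lt_trans _ _ (\int[@leb R n]_x (\sum_(0 <= k <oo) F k x))%E).
  apply: ge0_le_integral.
  - exact: measurableT.
  - by move=> x _; rewrite lee_fin invr_ge0 exprn_ge0// addr_ge0.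
  - by apply/measurable_EFinP; exact: mN.
  - by apply: (@ge0_emeasurable_sum _ LT R setT F xpredT) => [k x _ _|k _].
  move=> x _.
  have ex : exists k, [forall i, `|(x : Rn) ord0 i| <= 2 ^+ k :> R].
    exists (Num.truncn `|x : Rn|).+1; apply/forallP => i.
    apply: le_trans (rV_norm_coord _ _) _.
    apply: le_trans (ltW (Num.Theory.truncnS_gt _)) _.
    by rewrite -natrX ler_nat ltnW// ltn_expl.
  pose k := ex_minn ex.
  apply: (@le_trans _ _ (F k x)); last first.
    apply: le_trans (nneseries_lim_ge k.+1 (fun i _ _ => F0 i x)).
    rewrite big_nat_recr//= -[leLHS]add0e leeD//.
    by apply: sume_ge0 => i.
  rewrite /F lee_fin /k; case: ex_minnP => {}k /forallP hk kmin.
  rewrite indicE mem_set ?mulr1; last exact: hk.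
  rewrite /c -exprVn.
  have gt1 : 1 <= 1 + `|x : Rn| by rewrite lerDl.
  case: k hk kmin => [|k] _ kmin.
    rewrite expr0 mulr1 (@le_trans _ _ 1)//.
      by rewrite invf_le1 ?exprn_ege1// exprn_gt0//; apply: lt_le_trans gt1.
    by rewrite exprn_ege1// ler1n.
  have : ~~ [forall i, `|(x : Rn) ord0 i| <= 2 ^+ k :> R].
    by apply/negP => /kmin; rewrite ltnn.
  rewrite negb_forall => /existsP[i hi]; move: hi; rewrite -ltNge => hi.
  rewrite [X in _ * X]exprS mulrA mulfV ?mul1r; last by rewrite expf_neq0.
  rewrite exprVn -exprM mulnC exprM lef_pV2 ?posrE; last 2 first.
  - by apply: exprn_gt0; exact: lt_le_trans gt1.
  - by do 2 apply: exprn_gt0.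
  apply: lerXn2r.
  - by rewrite nnegrE exprn_ge0.
  - by rewrite nnegrE (le_trans _ gt1).
  apply: le_trans (ltW hi) _; apply: le_trans (rV_norm_coord _ _) _.
  by rewrite lerDr.
rewrite integral_nneseries; last 3 first.
- exact: measurableT.
- exact: mF.
- by move=> k x _.
have E k : (\int[@leb R n]_x F k x = (2 ^+ n.+1 * 2 ^+ n * (2^-1) ^+ k)%:E)%E.
  rewrite /F; under eq_integral do rewrite EFinM.
  rewrite ge0_integralZl_EFin; last 4 first.
  - exact: measurableT.
  - by move=> x _; rewrite lee_fin indicE.
  - apply/measurable_EFinP; apply: measurable_indic; exact: measurable_cube.
  - exact: c0.
  rewrite integral_indic; [|exact: measurableT|exact: measurable_cube].
  rewrite [X in (_ * X)%E](_ : _ = (((2 ^+ k *+ 2) ^+ n)%:E)); last first.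
    by rewrite setIT; apply: leb_cube; rewrite exprn_ge0.
  rewrite -EFinM; congr EFin.
  rewrite /c -!mulrA; congr (_ * _).
  have -> : (2 ^+ k *+ 2) ^+ n = 2 ^+ n * (2 ^+ n) ^+ k :> R.
    by rewrite -mulr_natr exprMn mulrC -!exprM mulnC.
  rewrite exprS exprMn invfM exprVn.
  have : (2 ^+ n) ^+ k != 0 :> R by rewrite !expf_neq0.
  move: ((2 ^+ n) ^+ k) => a a0; rewrite mulrCA; congr (_ * _).
  by rewrite -mulrA mulVf ?mulr1.
under eq_eseriesr do rewrite E.
have := @cvg_geometric_series R (2 ^+ n.+1 * 2 ^+ n) (2^-1).
rewrite ger0_norm// invf_lt1// ltr1n => /(_ isT) h.
rewrite (_ : limn _ = (2 ^+ n.+1 * 2 ^+ n / (1 - 2^-1))%:E) ?ltry//.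
apply/cvg_lim => //.
rewrite (_ : (fun m => _) = EFin \o series (geometric (2 ^+ n.+1 * 2 ^+ n) (2^-1))).
  by apply: cvg_EFin => //; exact: nearW.
by apply/funext => m; rewrite /= /series/= sumEFin.
Qed.

End lebesgue_box.

(** * Integrals of real functions *)

Section real_integral.
Context {d} {T : measurableType d} {R : realType}.
Implicit Types (f g : T -> R) (mu : {measure set T -> \bar R}).

Definition rmeas f : Prop := measurable_fun [set: T] f.

Definition lint mu f : \bar R := (\int[mu]_x (f x)%:E)%E.

Definition L1 mu f : Prop := mu.-integrable [set: T] (EFin \o f).

Definition rint mu f : R := Rintegral mu [set: T] f.

Lemma rmeas_ext f g : f =1 g -> rmeas f -> rmeas g.
Proof. by move=> /funext ->. Qed.

Lemma rmeas_EFin f : rmeas f -> measurable_fun setT (EFin \o f).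
Proof. by move=> mf; apply/measurable_EFinP. Qed.

Lemma rmeas_cst (c : R) : rmeas (fun=> c). Proof. exact: measurable_cst. Qed.

Lemma rmeasD f g : rmeas f -> rmeas g -> rmeas (fun x => f x + g x).
Proof. exact: measurable_funD. Qed.

Lemma rmeasN f : rmeas f -> rmeas (fun x => - f x).
Proof. exact: measurable_funN. Qed.

Lemma rmeasB f g : rmeas f -> rmeas g -> rmeas (fun x => f x - g x).
Proof. exact: measurable_funB. Qed.

Lemma rmeasM f g : rmeas f -> rmeas g -> rmeas (fun x => f x * g x).
Proof. exact: measurable_funM. Qed.

Lemma rmeasX f k : rmeas f -> rmeas (fun x => f x ^+ k).
Proof. exact: measurable_funX. Qed.

Lemma rmeas_norm f : rmeas f -> rmeas (fun x => `|f x|).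
Proof. by move=> mf; apply: (measurableT_comp (@normr_measurable R setT) mf). Qed.

Lemma rmeas_indic (A : set T) : measurable A -> rmeas (\1_A : T -> R).
Proof. exact: measurable_indic. Qed.

Lemma rmeas_comp (h : R -> R) f : continuous h -> rmeas f ->
  rmeas (fun x => h (f x)).
Proof.
move=> ch mf; apply: (measurableT_comp (f := h)) mf.
exact: continuous_measurable_fun.
Qed.

Lemma rmeas_cvg (h : nat -> T -> R) f : (forall k, rmeas (h k)) ->
  (forall x, h ^~ x @ \oo --> f x) -> rmeas f.
Proof. by move=> mh hf; apply: (measurable_fun_cvg mh) => x _; exact: hf. Qed.

Lemma lint_ge0 mu f : (forall x, 0 <= f x) -> (0 <= lint mu f)%E.
Proof. by move=> f0; apply: integral_ge0 => x _; rewrite lee_fin. Qed.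

Lemma lint_le mu f g : rmeas f -> rmeas g -> (forall x, 0 <= f x) ->
  (forall x, f x <= g x) -> (lint mu f <= lint mu g)%E.
Proof.
move=> mf mg f0 fg; apply: ge0_le_integral => //.
- by move=> x _; rewrite lee_fin.
- exact: rmeas_EFin.
- exact: rmeas_EFin.
- by move=> x _; rewrite lee_fin.
Qed.

Lemma lint_le_ae mu f g : rmeas f -> rmeas g -> (forall x, 0 <= f x) ->
  (forall x, 0 <= g x) ->
  (\forall x \ae mu, f x <= g x) -> (lint mu f <= lint mu g)%E.
Proof.
move=> mf mg f0 g0 fg; apply: ae_ge0_le_integral => //.
- by move=> x _; rewrite lee_fin.
- exact: rmeas_EFin.
- by move=> x _; rewrite lee_fin.
- exact: rmeas_EFin.
- by apply: filterS fg => x fg _; rewrite lee_fin.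
Qed.

Lemma lintD mu f g : rmeas f -> rmeas g -> (forall x, 0 <= f x) ->
  (forall x, 0 <= g x) ->
  lint mu (fun x => f x + g x) = (lint mu f + lint mu g)%E.
Proof.
move=> mf mg f0 g0; rewrite /lint -ge0_integralD//.
- by move=> x _; rewrite lee_fin.
- exact: rmeas_EFin.
- by move=> x _; rewrite lee_fin.
- exact: rmeas_EFin.
Qed.

Lemma lintZ mu (c : R) f : rmeas f -> (forall x, 0 <= f x) -> 0 <= c ->
  lint mu (fun x => c * f x) = (c%:E * lint mu f)%E.
Proof.
move=> mf f0 c0; rewrite /lint -ge0_integralZl_EFin//.
- by move=> x _; rewrite lee_fin.
- exact: rmeas_EFin.
Qed.

Lemma lint_eq0P mu f : rmeas f -> (forall x, 0 <= f x) ->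
  lint mu f = 0%E <-> \forall x \ae mu, f x = 0.
Proof.
move=> mf f0.
have := ae_eq_integral_abs mu measurableT (rmeas_EFin mf).
rewrite (_ : (fun x => _) = EFin \o f); last first.
  by apply/funext => x /=; rewrite ger0_norm.
move=> h; apply: (iff_trans h); split; apply: filterS => x.
  by move=> /(_ I)[].
by move=> /= -> _.
Qed.

Lemma lint_ae_eq mu f g : rmeas f -> rmeas g -> (forall x, 0 <= f x) ->
  (forall x, 0 <= g x) -> (\forall x \ae mu, f x = g x) -> lint mu f = lint mu g.
Proof.
move=> mf mg f0 g0 fg; apply/eqP; rewrite eq_le !lint_le_ae//.
- by apply: filterS fg => x ->.
- by apply: filterS fg => x ->.
Qed.

Lemma lint_fatou mu (h : nat -> T -> R) f (M : \bar R) : (forall k, rmeas (h k)) ->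
  (forall k x, 0 <= h k x) -> rmeas f -> (forall x, 0 <= f x) ->
  (\forall x \ae mu, h ^~ x @ \oo --> f x) ->
  (\forall k \near \oo, lint mu (h k) <= M)%E -> (lint mu f <= M)%E.
Proof.
move=> mh h0 mf f0 hf hM.
have mF k : measurable_fun setT (fun x => (h k x)%:E) by exact: rmeas_EFin.
have mL : measurable_fun setT (fun x => limn_einf (fun k => (h k x)%:E)).
  rewrite (_ : (fun x => _) = (fun x => - limn_esup (fun k => - (h k x)%:E))%E).
    apply: measurableT_comp => //.
    apply: measurable_fun_limn_esup => k.
    by apply: measurableT_comp.
  by apply/funext => x; rewrite limn_esupN oppeK.
have L0 x : (0 <= limn_einf (fun k => (h k x)%:E))%E.
  rewrite limn_einf_lim; apply: lime_ge; first exact: is_cvg_einfs.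
  apply: nearW => k; apply: le_ereal_inf_tmp => _ [j _ <-].
  by rewrite lee_fin.
have fE : lint mu f = (\int[mu]_x limn_einf (fun k => (h k x)%:E))%E.
  apply: ge0_ae_eq_integral => //.
  - exact: rmeas_EFin.
  - by move=> x _; rewrite lee_fin.
  apply: filterS hf => x hf _.
  have h1 : (fun k => (h k x)%:E) @ \oo --> (f x)%:E.
    by apply: cvg_EFin; [exact: nearW|exact: hf].
  by have [-> _] := cvg_limn_einf_sup h1.
rewrite fE; apply: (le_trans (fatou mu measurableT mF _)).
  by move=> k x _; rewrite lee_fin.
rewrite limn_einf_lim; apply: lime_le; first exact: is_cvg_einfs.
case: hM => N _ hN.
apply: nearW => k; apply: ge_ereal_inf.
exists (lint mu (h (maxn N k))); first by exists (maxn N k) => //=; exact: leq_maxr.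
by apply: hN => /=; exact: leq_maxl.
Qed.

Lemma L1P mu f : L1 mu f <-> rmeas f /\ (lint mu (fun x => `|f x|%R) < +oo)%E.
Proof.
rewrite /L1; split.
  by move=> /integrableP[mf fi]; split => //; apply/measurable_EFinP.
by move=> [mf fi]; apply/integrableP; split => //; exact: rmeas_EFin.
Qed.

Lemma L1_rmeas mu f : L1 mu f -> rmeas f.
Proof. by move=> /L1P[]. Qed.

Lemma L1_ext mu f g : f =1 g -> L1 mu f -> L1 mu g.
Proof. by move=> /funext ->. Qed.

Lemma L1_dom mu f g : rmeas f -> (forall x, `|f x| <= g x) -> L1 mu g -> L1 mu f.
Proof.
move=> mf fg; apply: le_integrable => //; first exact: rmeas_EFin.
move=> x _ /=; rewrite lee_fin; apply: le_trans (fg x) _; exact: ler_norm.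
Qed.

Lemma L1D mu f g : L1 mu f -> L1 mu g -> L1 mu (fun x => f x + g x).
Proof. by move=> f1 g1; exact: (integrableD measurableT f1 g1). Qed.

Lemma L1Z mu (c : R) f : L1 mu f -> L1 mu (fun x => c * f x).
Proof. by move=> f1; exact: (integrableZl measurableT c f1). Qed.

Lemma L1N mu f : L1 mu f -> L1 mu (fun x => - f x).
Proof. by move=> /(L1Z (-1)); apply: L1_ext => x; rewrite mulN1r. Qed.

Lemma L1B mu f g : L1 mu f -> L1 mu g -> L1 mu (fun x => f x - g x).
Proof. by move=> f1 /L1N; exact: L1D. Qed.

Lemma L1_norm mu f : L1 mu f -> L1 mu (fun x => `|f x|).
Proof.
move=> f1; have mf := L1_rmeas f1; move: f1 => /L1P[_ h]; apply/L1P; split.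
  exact: rmeas_norm.
rewrite (_ : (fun x => _) = (fun x => `|f x|))//.
by apply/funext => x; rewrite normr_id.
Qed.

Lemma lintE mu f : L1 mu f -> lint mu f = (rint mu f)%:E.
Proof.
by move=> f1; rewrite /rint /Rintegral fineK//; exact: integrable_fin_num.
Qed.

Lemma rint_ext mu f g : f =1 g -> rint mu f = rint mu g.
Proof. by move=> /funext ->. Qed.

Lemma rintD mu f g : L1 mu f -> L1 mu g ->
  rint mu (fun x => f x + g x) = rint mu f + rint mu g.
Proof. by move=> f1 g1; exact: RintegralD. Qed.

Lemma rintZ mu (c : R) f : L1 mu f -> rint mu (fun x => c * f x) = c * rint mu f.
Proof. by move=> f1; exact: RintegralZl. Qed.

Lemma rintN mu f : L1 mu f -> rint mu (fun x => - f x) = - rint mu f.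
Proof.
move=> f1; rewrite -mulN1r -rintZ//; apply: rint_ext => x.
by rewrite mulN1r.
Qed.

Lemma rintB mu f g : L1 mu f -> L1 mu g ->
  rint mu (fun x => f x - g x) = rint mu f - rint mu g.
Proof. by move=> f1 g1; rewrite rintD ?rintN//; exact: L1N. Qed.

Lemma rint_le mu f g : L1 mu f -> L1 mu g -> (forall x, f x <= g x) ->
  rint mu f <= rint mu g.
Proof. by move=> f1 g1 fg; exact: le_Rintegral. Qed.

Lemma rint_norm mu f : L1 mu f -> `|rint mu f| <= rint mu (fun x => `|f x|).
Proof. by move=> f1; exact: le_normr_Rintegral. Qed.

Lemma rint_ge0 mu f : (forall x, 0 <= f x) -> 0 <= rint mu f.
Proof. by move=> f0; apply: Rintegral_ge0. Qed.

Lemma rint_dct mu (h : nat -> T -> R) f g : (forall k, rmeas (h k)) ->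
  (forall x, h ^~ x @ \oo --> f x) -> L1 mu g ->
  (forall k x, `|h k x| <= g x) ->
  (fun k => rint mu (h k)) @ \oo --> rint mu f.
Proof.
move=> mh hf g1 hg.
have mf := rmeas_cvg mh hf.
have h1 : \forall x \ae mu, setT x -> (h k x)%:E @[k --> \oo] --> (f x)%:E.
  by apply: aeW => x _; apply: cvg_EFin; [exact: nearW|exact: hf].
have h2 : \forall x \ae mu, forall k, setT x -> (`|(h k x)%:E| <= (g x)%:E)%E.
  by apply: aeW => x k _; rewrite lee_fin.
have [f1 _ H] := @dominated_convergence _ _ _ mu setT measurableT
  (fun k x => (h k x)%:E) (EFin \o f) (EFin \o g) (fun k => rmeas_EFin (mh k))
  (rmeas_EFin mf) h1 g1 h2.
rewrite /rint /Rintegral; apply: fine_cvg.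
rewrite fineK; first exact: H.
exact: integrable_fin_num.
Qed.

Lemma lint_dct0 mu (h : nat -> T -> R) g : (forall k, rmeas (h k)) ->
  (forall x, h ^~ x @ \oo --> 0) -> L1 mu g ->
  (forall k x, 0 <= h k x <= g x) ->
  (fun k => lint mu (h k)) @ \oo --> 0%E.
Proof.
move=> mh hf g1 hg.
have hg' k x : `|h k x| <= g x.
  by have /andP[a b] := hg k x; rewrite ger0_norm.
have := rint_dct mh hf g1 hg'.
rewrite (_ : rint mu (fun=> 0) = 0); last first.
  by rewrite /rint /Rintegral integral0.
move=> H; rewrite (_ : (fun k => lint mu (h k)) = EFin \o (fun k => rint mu (h k))).
  by apply: cvg_EFin => //; exact: nearW.
apply/funext => k /=; apply: lintE.
exact: L1_dom (mh k) (hg' k) g1.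
Qed.

End real_integral.

Section real_fubini.
Context {d1 d2} {T1 : measurableType d1} {T2 : measurableType d2} {R : realType}.
Context (m1 : {sigma_finite_measure set T1 -> \bar R})
  (m2 : {sigma_finite_measure set T2 -> \bar R}).

(** A bounded kernel times a product of integrable functions is integrable on the product space.
    This serves both the multiplication formula of the Fourier transform and the averages over
    frequencies. *)
Lemma rint_fubini (u : T1 -> R) (v : T2 -> R) (k : T1 -> T2 -> R) (M : R) :
  L1 m1 u -> L1 m2 v -> rmeas (fun p : T1 * T2 => k p.1 p.2) ->
  (forall x y, `|k x y| <= M) ->
  rint m1 (fun x => u x * rint m2 (fun y => v y * k x y)) =
  rint m2 (fun y => v y * rint m1 (fun x => u x * k x y)).
Proof.
move=> u1 v1 mk kM.
pose F (p : T1 * T2) := u p.1 * v p.2 * k p.1 p.2.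
have mF : rmeas F.
  apply: rmeasM => //; apply: rmeasM.
    apply: (measurableT_comp (f := u)); [exact: L1_rmeas u1|exact: measurable_fst].
  apply: (measurableT_comp (f := v)); [exact: L1_rmeas v1|exact: measurable_snd].
have M0 (x : T1) (y : T2) : 0 <= M by exact: (le_trans _ (kM x y)).
have mk1 x : rmeas (k x) by exact: (measurableT_comp mk (pair1_measurable x)).
have mk2 y : rmeas (k ^~ y) by exact: (measurableT_comp mk (pair2_measurable y)).
have F1 x : L1 m2 (fun y => v y * k x y).
  apply: (@L1_dom _ _ _ _ _ (fun y => M * `|v y|)).
  - by apply: rmeasM => //; exact: L1_rmeas v1.
  - by move=> y; rewrite normrM mulrC ler_wpM2r.
  - exact: L1Z (L1_norm v1).
have F2 y : L1 m1 (fun x => u x * k x y).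
  apply: (@L1_dom _ _ _ _ _ (fun x => M * `|u x|)).
  - by apply: rmeasM => //; exact: L1_rmeas u1.
  - by move=> x; rewrite normrM mulrC ler_wpM2r.
  - exact: L1Z (L1_norm u1).
have iF : (m1 \x m2)%E.-integrable setT (EFin \o F).
  apply/integrable12ltyP; first exact: rmeas_EFin.
  pose N := rint m2 (fun y => `|v y|).
  apply: (@le_lt_trans _ _ (lint m1 (fun x => `|M| * N * `|u x|))).
    apply: ge0_le_integral => //.
    - by move=> x _; apply: integral_ge0 => y _; rewrite abse_ge0.
    - have mF' : measurable_fun setT (fun p => `|(F p)%:E|%E).
        by apply: measurableT_comp => //; exact: rmeas_EFin.
      have F0 p : (0 <= `|(F p)%:E|)%E by rewrite abse_ge0.
      exact: (@measurable_fun_fubini_tonelli_F _ _ _ _ _ m2 _ mF' F0).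
    - apply: rmeas_EFin; apply: rmeasM; first exact: rmeas_cst.
      exact: rmeas_norm (L1_rmeas u1).
    move=> x _.
    rewrite (_ : (`|M| * N * `|u x|)%:E = lint m2 (fun y => (`|M| * `|u x|) * `|v y|)).
      apply: lint_le.
      + exact: rmeas_norm (measurableT_comp mF (pair1_measurable x)).
      + apply: rmeasM; first exact: rmeas_cst.
        exact: rmeas_norm (L1_rmeas v1).
      + by move=> y.
      + move=> y; rewrite /F/= !normrM [leLHS]mulrC -mulrA ler_wpM2r ?mulr_ge0//.
        by rewrite (ger0_norm (M0 x y)).
    rewrite lintZ ?mulr_ge0//; last exact: rmeas_norm (L1_rmeas v1).
    rewrite lintE; last exact: L1_norm.
    by rewrite -EFinM mulrAC.
  rewrite lintE ?ltry//; exact: L1Z (L1_norm u1).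
have := Fubini iF.
have -> : (\int[m1]_x \int[m2]_y (EFin \o F) (x, y) =
    \int[m1]_x (u x * rint m2 (fun y => v y * k x y))%:E)%E.
  apply: eq_integral => x _; rewrite -rintZ// -lintE; last exact: L1Z.
  by apply: eq_integral => y _; rewrite /F/= mulrA.
have -> : (\int[m2]_y \int[m1]_x (EFin \o F) (x, y) =
    \int[m2]_y (v y * rint m1 (fun x => u x * k x y))%:E)%E.
  apply: eq_integral => y _; rewrite -rintZ// -lintE; last exact: L1Z.
  by apply: eq_integral => x _; rewrite /F/= mulrA (mulrC (u x)).
by rewrite /rint /Rintegral => ->.
Qed.

End real_fubini.

(** * Rapid decay and polynomial growth on R^n *)

Section leb_integral.
Context {R : realType} {n : nat}.
Local Notation Rn := 'rV[R]_n.
Local Notation LT := (lebesgueType R n).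
Local Notation leb := (@leb R n).
Implicit Types f g : Rn -> R.

Lemma rmeas_continuous f : continuous f -> rmeas (f : LT -> R).
Proof. exact: continuous_measurable_leb. Qed.

Lemma rmeas_coord (i : 'I_n) : rmeas (fun x : LT => (x : Rn) ord0 i).
Proof. exact: measurable_coord. Qed.

Lemma rmeas_affine (s : R) (y : Rn) f : s != 0 -> rmeas (f : LT -> R) ->
  rmeas (fun x : LT => f (s *: (x : Rn) + y)).
Proof.
move=> s0 mf; exact: (measurableT_comp mf (measurable_affine_rV y s0)).
Qed.

Lemma lint_affine (s : R) (y : Rn) f : s != 0 -> rmeas (f : LT -> R) ->
  (forall x, 0 <= f x) ->
  lint leb (fun x : LT => f (s *: (x : Rn) + y)) =
  ((`|s^-1| ^+ n)%:E * lint leb f)%E.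
Proof.
move=> s0 mf f0.
have f0' (x : LT) : (0 <= (f x)%:E)%E by rewrite lee_fin.
exact: (ge0_integral_leb_affine y s0 (rmeas_EFin mf) f0').
Qed.

Lemma L1_affine (s : R) (y : Rn) f : s != 0 -> L1 leb f ->
  L1 leb (fun x : LT => f (s *: (x : Rn) + y)).
Proof.
move=> s0 /L1P[mf fi]; apply/L1P; split; first exact: rmeas_affine s0 mf.
rewrite (lint_affine y s0 (rmeas_norm mf) (fun x => normr_ge0 _)).
by rewrite lte_mul_pinfty// lee_fin exprn_ge0.
Qed.

Lemma rint_affine (s : R) (y : Rn) f : s != 0 -> L1 leb f ->
  rint leb (fun x : LT => f (s *: (x : Rn) + y)) = `|s^-1| ^+ n * rint leb f.
Proof.
move=> s0 f1.
have mf := L1_rmeas f1.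
pose fp x := `|f x| + f x.
have fp1 : L1 leb fp by exact: L1D (L1_norm f1) f1.
have fE x : f x = fp x - `|f x| by rewrite /fp addrAC subrr add0r.
have H g : L1 leb g -> (forall x, 0 <= g x) ->
    rint leb (fun x : LT => g (s *: (x : Rn) + y)) = `|s^-1| ^+ n * rint leb g.
  move=> g1 g0; apply: EFin_inj.
  rewrite -lintE; last exact: L1_affine.
  by rewrite (lint_affine y s0 (L1_rmeas g1) g0) lintE.
rewrite (rint_ext leb (fun x : LT => fE (s *: (x : Rn) + y))) (rint_ext leb fE).
rewrite !rintB.
- rewrite (H _ fp1); last by move=> x; rewrite /fp -lerBlDr sub0r lerNl lerNnormlW.
  by rewrite (H _ (L1_norm f1))// mulrBr.
- exact: fp1.
- exact: L1_norm.
- exact: (L1_affine y s0 fp1).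
- exact: (L1_affine y s0 (L1_norm f1)).
Qed.

Lemma L1_decay : L1 leb (fun x : LT => ((1 + `|x : Rn|) ^+ n.+1)^-1).
Proof.
apply/L1P; split; first exact: rmeas_continuous (@continuous_decay _ _ _).
rewrite (_ : (fun x => _) = (fun x : LT => ((1 + `|x : Rn|) ^+ n.+1)^-1)).
  exact: integral_decay_fin.
by apply/funext => x; rewrite ger0_norm// invr_ge0 exprn_ge0// addr_ge0.
Qed.

(** Decay is measured in the maximum norm of row vectors; the Euclidean norm of [real_schwartz] is
    at least this norm and at most n times it. *)
Definition rapid f := forall k, exists M, forall x, (1 + `|x|) ^+ k * `|f x| <= M.

Definition pbound f := exists k M, forall x, `|f x| <= M * (1 + `|x|) ^+ k.

Lemma one_norm_gt0 (x : Rn) : 0 < 1 + `|x|.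
Proof. by rewrite ltr_pwDl. Qed.

Lemma one_norm_ge1 (x : Rn) : 1 <= 1 + `|x|.
Proof. by rewrite lerDl. Qed.

Lemma rapid_decay f : rapid f -> forall k, exists2 M, 0 <= M &
  forall x, `|f x| <= M * ((1 + `|x|) ^+ k)^-1.
Proof.
move=> rf k; have [M hM] := rf k; exists `|M| => // x.
rewrite ler_pdivlMr ?exprn_gt0 ?one_norm_gt0// mulrC.
by apply: le_trans (hM x) _; exact: ler_norm.
Qed.

Lemma rapid_L1 f : rmeas (f : LT -> R) -> rapid f -> L1 leb f.
Proof.
move=> mf /rapid_decay/(_ n.+1)[M M0 hM].
exact: (L1_dom mf hM (L1Z M L1_decay)).
Qed.

Lemma rapid_bounded f : rapid f -> exists2 M, 0 <= M & forall x, `|f x| <= M.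
Proof.
by move=> /rapid_decay/(_ 0)[M M0 hM]; exists M => // x; have := hM x;
  rewrite expr0 invr1 mulr1.
Qed.

Lemma rapidD f g : rapid f -> rapid g -> rapid (fun x => f x + g x).
Proof.
move=> rf rg k; have [M hM] := rf k; have [N hN] := rg k; exists (M + N) => x.
apply: le_trans (lerD (hM x) (hN x)); rewrite -mulrDr.
by rewrite ler_wpM2l ?ler_normD// exprn_ge0// ltW// one_norm_gt0.
Qed.

Lemma rapidM_pbound f g : pbound g -> rapid f -> rapid (fun x => g x * f x).
Proof.
move=> [m [C hC]] rf k; have [M hM] := rf (k + m)%N; exists (`|C| * `|M|) => x.
have p0 j : 0 <= (1 + `|x|) ^+ j by rewrite exprn_ge0// ltW// one_norm_gt0.
apply: (@le_trans _ _ ((1 + `|x|) ^+ k * (`|C| * (1 + `|x|) ^+ m * `|f x|))).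
  rewrite ler_wpM2l// normrM ler_wpM2r//; apply: le_trans (hC x) _.
  by rewrite ler_wpM2r// ler_norm.
rewrite -!mulrA mulrCA ler_wpM2l// mulrA -exprD.
by apply: le_trans (hM x) _; exact: ler_norm.
Qed.

Lemma rapid_pbound f : rapid f -> pbound f.
Proof.
move=> /rapid_bounded[M M0 hM]; exists 0%N, M => x.
by rewrite expr0 mulr1.
Qed.

Lemma pbound_bounded f (M : R) : (forall x, `|f x| <= M) -> pbound f.
Proof. by move=> h; exists 0%N, M => x; rewrite expr0 mulr1. Qed.

Lemma pboundP f : pbound f -> exists k M, 0 <= M /\
  forall m x, (k <= m)%N -> `|f x| <= M * (1 + `|x|) ^+ m.
Proof.
move=> [k [M hM]]; exists k, `|M|; split => // m x km.
apply: le_trans (hM x) _; apply: (@le_trans _ _ (`|M| * (1 + `|x|) ^+ k)).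
  by rewrite ler_wpM2r ?ler_norm// exprn_ge0// ltW// one_norm_gt0.
by rewrite ler_wpM2l// ler_weXn2l// one_norm_ge1.
Qed.

Lemma pboundD f g : pbound f -> pbound g -> pbound (fun x => f x + g x).
Proof.
move=> /pboundP[k [M [M0 hM]]] /pboundP[l [N [N0 hN]]].
exists (k + l)%N, (M + N) => x; rewrite mulrDl.
apply: le_trans (ler_normD _ _) _; apply: lerD.
  by apply: hM; rewrite leq_addr.
by apply: hN; rewrite leq_addl.
Qed.

Lemma pboundM f g : pbound f -> pbound g -> pbound (fun x => f x * g x).
Proof.
move=> [k [M hM]] [l [N hN]]; exists (k + l)%N, (M * N) => x.
by rewrite exprD mulrACA normrM; apply: ler_pM.
Qed.

(** The weight changes by a bounded factor: 1 + |x| is at most [c] times 1 + |s x + y|. *)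
Lemma rapid_affine (s : R) (y : Rn) f : s != 0 -> rapid f ->
  rapid (fun x => f (s *: x + y)).
Proof.
move=> s0 rf k; have [M hM] := rf k.
pose c := 1 + `|s^-1| + `|s^-1| * `|y|.
have c1 : 1 <= c by rewrite /c -addrA lerDl addr_ge0// mulr_ge0.
exists (c ^+ k * `|M|) => x.
have h : 1 + `|x| <= c * (1 + `|s *: x + y|).
  have -> : `|x| = `|s^-1 *: (s *: x + y) - s^-1 *: y|.
    by rewrite scalerDr scalerA mulVf// scale1r addrK.
  apply: (@le_trans _ _ (1 + (`|s^-1| * `|s *: x + y| + `|s^-1| * `|y|))).
    by rewrite lerD2l; apply: le_trans (ler_normB _ _) _; rewrite !normrZ.
  have : 0 <= `|s *: x + y| by []; have : 0 <= `|y| by []; have : 0 <= `|s^-1| by [].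
  rewrite /c; move: `|s^-1| `|y| `|s *: x + y| => a b z a0 b0 z0.
  by have := mulr_ge0 a0 b0; have := mulr_ge0 (mulr_ge0 a0 b0) z0; nra.
apply: (@le_trans _ _ ((c * (1 + `|s *: x + y|)) ^+ k * `|f (s *: x + y)|)).
  by rewrite ler_wpM2r// lerXn2r// nnegrE ?(le_trans _ h)// ltW// one_norm_gt0.
rewrite exprMn -mulrA ler_wpM2l ?exprn_ge0 ?(le_trans _ c1)//.
by apply: le_trans (hM _) _; exact: ler_norm.
Qed.

Lemma rmeas_dot :
  rmeas (fun p : LT * LT => dot (p.1 : Rn) (p.2 : Rn)).
Proof.
rewrite /dot; elim: (index_enum _) => [|i s ih].
  rewrite (_ : (fun p => _) = fun=> 0); first exact: rmeas_cst.
  by apply/funext => p; rewrite big_nil.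
rewrite (_ : (fun p => _) = (fun p : LT * LT => (p.1 : Rn) ord0 i * (p.2 : Rn) ord0 i +
  \sum_(j <- s) (p.1 : Rn) ord0 j * (p.2 : Rn) ord0 j)).
  apply: rmeasD ih; apply: rmeasM.
    exact: (measurableT_comp (rmeas_coord i) measurable_fst).
  exact: (measurableT_comp (rmeas_coord i) measurable_snd).
by apply/funext => p; rewrite big_cons.
Qed.

(** Measurability refers to the product of two Lebesgue sigma-algebras, which is not the Lebesgue
    sigma-algebra of R^2n, so it is obtained from the coordinates. *)
Lemma rmeas_continuous_lin (s t : R) (y : Rn) f : continuous f ->
  rmeas (fun p : LT * LT => f (s *: (p.1 : Rn) + t *: (p.2 : Rn) + y)).
Proof.
move=> cf.
apply: (@measurable_continuous_comp R n _ (LT * LT)%type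
  (fun p => s *: (p.1 : Rn) + t *: (p.2 : Rn) + y) f _ cf) => i.
rewrite (_ : (fun p => _) = (fun p : LT * LT =>
  s * (p.1 : Rn) ord0 i + t * (p.2 : Rn) ord0 i + y ord0 i)); last first.
  by apply/funext => p; rewrite !mxE.
apply: rmeasD (rmeas_cst _); apply: rmeasD; apply: rmeasM (rmeas_cst _) _.
  exact: (measurableT_comp (rmeas_coord i) measurable_fst).
exact: (measurableT_comp (rmeas_coord i) measurable_snd).
Qed.

End leb_integral.

(** * Schwartz functions *)

Section flat_functions.
Context {R : realType}.

(** For k = 0 this is the standard flat function exp(-1/t). The powers t^-k make the linear span of
    the family closed under differentiation. *)
Definition flat_exp (k : nat) (t : R) : R :=
  if 0 < t then t ^- k * expR (- t^-1) else 0.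

Lemma flat_exp_ge0 k t : 0 <= flat_exp k t.
Proof.
rewrite /flat_exp; case: ifP => // t0.
by rewrite mulr_ge0 ?expR_ge0// invr_ge0 exprn_ge0// ltW.
Qed.

(** With u = 1/(k t), the inequality u <= exp u is raised to the power k. For k = 0 the bound is 0^0
    = 1. *)
Lemma flat_exp_le k t : flat_exp k t <= k%:R ^+ k.
Proof.
rewrite /flat_exp; case: ifP => [t0|_]; last by rewrite exprn_ge0.
rewrite expRN ler_pdivrMr ?expR_gt0//.
case: k => [|k]; first by rewrite expr0 invr1 mul1r -expR0 ler_expR invr_ge0 ltW.
have -> : t^-1 = k.+1%:R * (t^-1 / k.+1%:R) by rewrite mulrC divfK.
rewrite expRM_natl -exprMn -exprVn lerXn2r ?nnegrE ?mulr_ge0 ?invr_ge0 ?expR_ge0//.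
  exact: ltW.
rewrite -ler_pdivrMl// mulrC.
by apply: le_trans (expR_ge1Dx _); rewrite lerDr.
Qed.

Lemma flat_expM k t : t * flat_exp k.+1 t = flat_exp k t.
Proof.
rewrite /flat_exp; case: ifP => [t0|_]; last by rewrite mulr0.
by rewrite mulrA exprS invfM mulrA mulfV ?mul1r// gt_eqF.
Qed.

(** At 0 the difference quotient is [flat_exp k.+1 h] = h [flat_exp k.+2 h], which tends to 0
    because [flat_exp k.+2] is bounded. *)
Lemma flat_exp_derive k (t : R) :
  is_derive t 1 (flat_exp k) (- k%:R * flat_exp k.+1 t + flat_exp k.+2 t).
Proof.
have [t0|t0|<-] := ltgtP 0 t.
- pose g (t : R) := t ^- k * expR (- t^-1).
  have tn0 : t != 0 by rewrite gt_eqF.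
  apply: (@near_eq_is_derive _ _ _ g).
    near=> u; rewrite /flat_exp ifT//; near: u; exact: lt_nbhsr.
  have d1 : is_derive t 1 (fun u : R => u^-1) (- t ^- 2).
    apply: is_derive_eq (is_deriveV tn0 _) _.
    by rewrite /GRing.scale/= mulr1.
  have d2 : is_derive t 1 (fun u : R => u ^- k) (- k%:R * t ^- k.+1).
    rewrite (_ : (fun u => _) = (fun u : R => u^-1) ^+ k); last first.
      by apply/funext => u; rewrite -exprVn fctE.
    apply: is_derive_eq (is_deriveX k d1) _.
    rewrite /GRing.scale/= -!exprVn.
    case: (k) => [|m]; first by rewrite !mul0r oppr0 mul0r.
    by rewrite /= !exprS; ring.
  have d3 : is_derive t 1 (fun u : R => expR (- u^-1)) (expR (- t^-1) * t ^- 2).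
    have d4 : is_derive t 1 (fun u : R => - u^-1) (t ^- 2).
      by apply: is_derive_eq (is_deriveN d1) _; rewrite opprK.
    exact: is_derive1_comp (is_derive_expR _) d4.
  apply: is_derive_eq (is_deriveM d2 d3) _.
  by rewrite /flat_exp t0 /GRing.scale/= -!exprVn !exprS; ring.
- apply: (@near_eq_is_derive _ _ _ (fun=> 0)).
    near=> u; rewrite /flat_exp ifF//; apply/negbTE; rewrite -leNgt ltW//.
    by near: u; exact: lt_nbhsl.
  apply: is_derive_eq; rewrite /flat_exp [0 < t]ltNge ltW//=.
  by rewrite mulr0 addr0.
- have F0 j : flat_exp j 0 = 0 by rewrite /flat_exp ltxx.
  rewrite !F0 mulr0 addr0.
  have H : (fun h : R => h^-1 *: ((flat_exp k \o shift 0) (h *: 1) - flat_exp k 0))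
      @ 0^' --> (0 : R).
    apply/cvgrPdist_lt => e e0; near=> h.
    have h0 : h != 0 by near: h; exact: nbhs_dnbhs_neq.
    rewrite /= F0 subr0 addr0 /GRing.scale/= mulr1 sub0r normrN.
    rewrite -flat_expM mulrA mulVf// mul1r -flat_expM normrM.
    rewrite (ger0_norm (flat_exp_ge0 _ _)).
    apply: (@le_lt_trans _ _ (`|h| * (k.+2%:R ^+ k.+2 + 1))).
      by rewrite ler_wpM2l// (le_trans (flat_exp_le _ _))// lerDl.
    have c0 : 0 < k.+2%:R ^+ k.+2 + 1 :> R by rewrite ltr_wpDl// exprn_ge0.
    rewrite -ltr_pdivlMr//; near: h; apply: dnbhs0_lt; exact: divr_gt0.
  apply: DeriveDef; first by apply/cvg_ex; exists 0.
  exact: cvg_lim H.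
Unshelve. all: by end_near. Qed.

End flat_functions.

Section calculus.
Context {R : realType} {n : nat}.
Local Notation Rn := 'rV[R]_n.
Implicit Types (f g : Rn -> R) (h : R -> R).

Definition pderiv (i : 'I_n) f : Rn -> R := fun x => 'D_(delta_mx ord0 i) f x.

Definition diffble f := forall x, differentiable f x.

Lemma diffble_continuous f : diffble f -> continuous f.
Proof. by move=> df x; exact: differentiable_continuous. Qed.

Lemma diffbleD f g : diffble f -> diffble g -> diffble (fun x => f x + g x).
Proof. by move=> df dg x; exact: (differentiableD (df x) (dg x)). Qed.

Lemma diffbleM f g : diffble f -> diffble g -> diffble (fun x => f x * g x).
Proof. by move=> df dg x; exact: (differentiableM (df x) (dg x)). Qed.

Lemma diffble_cst (c : R) : diffble (fun=> c).
Proof. by move=> x; exact: differentiable_cst. Qed.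

Lemma diffble_coord (i : 'I_n) : diffble (fun x => x ord0 i).
Proof. by move=> x; exact: differentiable_coord. Qed.

Lemma pderivD i f g : diffble f -> diffble g ->
  pderiv i (fun x => f x + g x) = (fun x => pderiv i f x + pderiv i g x).
Proof.
move=> df dg; apply/funext => x; rewrite /pderiv.
by apply: (@deriveD _ _ _ f g); exact: diff_derivable.
Qed.

Lemma pderivM i f g : diffble f -> diffble g ->
  pderiv i (fun x => f x * g x) = (fun x => pderiv i f x * g x + f x * pderiv i g x).
Proof.
move=> df dg; apply/funext => x; rewrite /pderiv.
rewrite (@deriveM _ _ f g); [|exact: diff_derivable|exact: diff_derivable].
by rewrite addrC /GRing.scale/= (mulrC (g x)).
Qed.

Lemma pderiv_cst i (c : R) : pderiv i (fun=> c) = fun=> 0.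
Proof. by apply/funext => x; rewrite /pderiv derive_cst. Qed.

Lemma pderiv_coord i j : pderiv i (fun x => x ord0 j) = fun=> (i == j)%:R.
Proof.
apply/funext => x; apply: cvg_lim => //; apply/cvgrPdist_lt => e e0.
near=> t; have t0 : t != 0 by near: t; exact: nbhs_dnbhs_neq.
rewrite /= !mxE addrK /GRing.scale/= mulrA mulVf// mul1r ?eqxx/= (eq_sym j).
by rewrite subrr normr0.
Unshelve. all: by end_near. Qed.

Lemma comp_derive i f h (h' : R) x : diffble f -> is_derive (f x) 1 h h' ->
  differentiable (fun x => h (f x)) x /\
  pderiv i (fun x => h (f x)) x = h' * pderiv i f x.
Proof.
move=> df dh.
have dh1 : differentiable h (f x).
  by apply/derivable1_diffP; exact: ex_derive.
split; first exact: (differentiable_comp (df x) dh1).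
have dc := differentiable_comp (df x) dh1.
rewrite /pderiv (deriveE _ dc) diff_comp// /= diff1E// -deriveE//.
by rewrite derive1E derive_val /GRing.scale/= mulrC.
Qed.

End calculus.

(** * Closure properties of the Schwartz space *)

Section schwartz_closure.
Context {R : realType} {n : nat}.
Local Notation Rn := 'rV[R]_n.
Implicit Types (f g : Rn -> R).

(* An explicit class of smooth functions, closed under partial derivatives,
   all of whose members grow at most polynomially. *)
Inductive slow : (Rn -> R) -> Prop :=
| slow_cst c : slow (fun=> c)
| slow_coord i : slow (fun x => x ord0 i)
| slowD f g : slow f -> slow g -> slow (fun x => f x + g x)
| slowM f g : slow f -> slow g -> slow (fun x => f x * g x)
| slow_cos f : slow f -> slow (fun x => cos (f x))
| slow_flat k f : slow f -> slow (fun x => flat_exp k (f x)).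

Lemma slow_sum (I : Type) (s : seq I) (F : I -> Rn -> R) :
  (forall i, slow (F i)) -> slow (fun x => \sum_(i <- s) F i x).
Proof.
move=> sF; elim: s => [|i s ih].
  by rewrite (_ : (fun x => _) = fun=> 0); [exact: slow_cst|];
    apply/funext => x; rewrite big_nil.
rewrite (_ : (fun x => _) = fun x => F i x + \sum_(j <- s) F j x).
  exact: slowD.
by apply/funext => x; rewrite big_cons.
Qed.

Lemma slow_diffble f : slow f -> diffble f.
Proof.
elim=> [c|i|{}f g _ df _ dg|{}f g _ df _ dg|{}f _ df|k {}f _ df].
- exact: diffble_cst.
- exact: diffble_coord.
- exact: diffbleD.
- exact: diffbleM.
- move=> x; apply/(@differentiable_comp _ _ _ _ f cos) => //.
  apply/derivable1_diffP.
  exact: (@ex_derive _ _ _ _ _ _ _ (is_derive_cos (f x))).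
- move=> x; apply/(@differentiable_comp _ _ _ _ f (flat_exp k)) => //.
  apply/derivable1_diffP.
  exact: (@ex_derive _ _ _ _ _ _ _ (flat_exp_derive k (f x))).
Qed.

Lemma slow_pbound f : slow f -> pbound f.
Proof.
elim=> [c|i|{}f g _ df _ dg|{}f g _ df _ dg|{}f _ df|k {}f _ df].
- exact: (@pbound_bounded _ _ _ `|c|).
- exists 1%N, 1 => x; rewrite expr1 mul1r (le_trans (rV_norm_coord _ _))//.
  by rewrite lerDr.
- exact: pboundD.
- exact: pboundM.
- apply: (@pbound_bounded _ _ _ 1) => x; exact: cos_max.
- apply: (@pbound_bounded _ _ _ (k%:R ^+ k)) => x.
  by rewrite ger0_norm ?flat_exp_ge0// flat_exp_le.
Qed.

Lemma slow_pderiv i f : slow f -> slow (pderiv i f).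
Proof.
elim=> [c|j|{}f g sf df sg dg|{}f g sf df sg dg|{}f sf df|k {}f sf df].
- by rewrite pderiv_cst; exact: slow_cst.
- by rewrite pderiv_coord; exact: slow_cst.
- rewrite pderivD; [exact: slowD|exact: slow_diffble|exact: slow_diffble].
- rewrite pderivM; [|exact: slow_diffble|exact: slow_diffble].
  by apply: slowD; apply: slowM.
(* Writing minus sine as a shifted cosine spares the class a constructor for sine. *)
- rewrite (_ : pderiv i _ = (fun x => cos (f x + pi / 2) * pderiv i f x)).
    apply: slowM => //; apply: slow_cos; apply: slowD => //; exact: slow_cst.
  apply/funext => x; rewrite cosDpihalf.
  exact: (comp_derive i (slow_diffble sf) (is_derive_cos (f x))).2.
- rewrite (_ : pderiv i _ = (fun x => (- k%:R * flat_exp k.+1 (f x) +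
      flat_exp k.+2 (f x)) * pderiv i f x)).
    apply: slowM => //; apply: slowD; last exact: slow_flat.
    by apply: slowM; [exact: slow_cst|exact: slow_flat].
  apply/funext => x.
  exact: (comp_derive i (slow_diffble sf) (flat_exp_derive k (f x))).2.
Qed.

Lemma partials_pderiv s i f : partials s (pderiv i f) = partials (rcons s i) f.
Proof. by rewrite /partials -cats1 foldr_cat. Qed.

(** A coinduction principle: all iterated derivatives stay in K, where differentiability and decay
    are known. The factor n + 1 passes from the maximum norm to the Euclidean norm. *)
Lemma real_schwartz_coind (K : set (Rn -> R)) :
  (forall f, K f -> [/\ diffble f, rapid f & forall i, K (pderiv i f)]) ->
  K `<=` real_schwartz.
Proof.
move=> HK.
have Kp s : forall f, K f -> K (partials s f).
  elim/last_ind: s => [//|s i ih] f Kf; rewrite -partials_pderiv.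
  by apply: ih; have [_ _] := HK f Kf.
move=> f Kf s; have [df rf _] := HK _ (Kp s f Kf).
split=> // k; have [M hM] := rf k; exists (n.+1%:R ^+ k * `|M|) => x.
have h : 1 + euclid_norm x <= n.+1%:R * (1 + `|x|).
  rewrite -natr1 mulrDl mul1r mulrDr mulr1.
  have := euclid_norm_le x; have : 0 <= n%:R :> R by [].
  have : 0 <= `|x| by [].
  lra.
apply: (@le_trans _ _ ((n.+1%:R * (1 + `|x|)) ^+ k * `|partials s f x|)).
  rewrite ler_wpM2r// lerXn2r// nnegrE.
    by rewrite addr_ge0// euclid_norm_ge0.
  by apply: le_trans h; rewrite addr_ge0// euclid_norm_ge0.
rewrite exprMn -mulrA ler_wpM2l ?exprn_ge0//.
by apply: le_trans (hM x) _; exact: ler_norm.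
Qed.

Lemma real_schwartzP f : real_schwartz f ->
  [/\ diffble f, rapid f & forall i, real_schwartz (pderiv i f)].
Proof.
move=> Sf; split.
- by have [] := Sf [::].
- have [_ h] := Sf [::] => k; have [M hM] := h k; exists M => x.
  apply: le_trans (hM x); rewrite ler_wpM2r// lerXn2r// ?nnegrE.
  + by rewrite addr_ge0.
  + by rewrite addr_ge0// euclid_norm_ge0.
  + by rewrite lerD2l rV_norm_le_euclid.
- by move=> i s; rewrite partials_pderiv; exact: Sf.
Qed.

(** The module generated by S over the slow functions. By the product rule it is closed under
    derivatives once it contains those of the generators, so it can serve as the class K of the
    coinduction. *)
Inductive slow_span (S : set (Rn -> R)) : (Rn -> R) -> Prop :=
| slow_span_in f : S f -> slow_span S f
| slow_spanM g f : slow g -> slow_span S f -> slow_span S (fun x => g x * f x)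
| slow_spanD f g : slow_span S f -> slow_span S g ->
    slow_span S (fun x => f x + g x).

Lemma slow_span_schwartz (S : set (Rn -> R)) :
  (forall f, S f -> [/\ diffble f, rapid f & forall i, slow_span S (pderiv i f)]) ->
  slow_span S `<=` real_schwartz.
Proof.
move=> HS; apply: real_schwartz_coind => f.
elim=> [{}f /HS//|g {}f sg Sf [df rf pf]|{}f g _ [df rf pf] _ [dg rg pg]].
- have dg := slow_diffble sg; split.
  + exact: diffbleM.
  + by apply: rapidM_pbound => //; exact: slow_pbound.
  move=> i; rewrite pderivM//.
  by apply: slow_spanD; apply: slow_spanM => //; exact: slow_pderiv.
- split; [exact: diffbleD|exact: rapidD|move=> i].
  by rewrite pderivD//; exact: slow_spanD.
Qed.

Let schwartz_span : slow_span real_schwartz `<=` (real_schwartz : set (Rn -> R)).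
Proof.
apply: slow_span_schwartz => f /real_schwartzP[df rf pf]; split => // i.
by apply: slow_span_in; exact: pf.
Qed.

Lemma schwartz_slowM g f : slow g -> real_schwartz f ->
  real_schwartz (fun x => g x * f x).
Proof.
by move=> sg Sf; apply: schwartz_span; apply: slow_spanM => //; exact: slow_span_in.
Qed.

Lemma schwartzD f g : real_schwartz f -> real_schwartz g ->
  real_schwartz (fun x => f x + g x).
Proof.
by move=> Sf Sg; apply: schwartz_span; apply: slow_spanD; exact: slow_span_in.
Qed.

Lemma schwartzZ (c : R) f : real_schwartz f -> real_schwartz (fun x => c * f x).
Proof. exact: schwartz_slowM (slow_cst c). Qed.

Lemma schwartzN f : real_schwartz f -> real_schwartz (fun x => - f x).
Proof.
by move=> /(schwartzZ (-1)); rewrite (_ : (fun x => - 1 * f x) = (fun x => - f x))//;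
  apply/funext => x; rewrite mulN1r.
Qed.

Lemma schwartzB f g : real_schwartz f -> real_schwartz g ->
  real_schwartz (fun x => f x - g x).
Proof. by move=> Sf /schwartzN; exact: schwartzD. Qed.

Lemma schwartz_diffble f : real_schwartz f -> diffble f.
Proof. by move=> /real_schwartzP[]. Qed.

Lemma schwartz_rapid f : real_schwartz f -> rapid f.
Proof. by move=> /real_schwartzP[]. Qed.

Lemma schwartz_pderiv i f : real_schwartz f -> real_schwartz (pderiv i f).
Proof. by move=> /real_schwartzP[]. Qed.

Lemma schwartz_continuous f : real_schwartz f -> continuous f.
Proof. by move=> /schwartz_diffble; exact: diffble_continuous. Qed.

Lemma schwartz_rmeas f : real_schwartz f -> rmeas (f : lebesgueType R n -> R).
Proof. by move=> /schwartz_continuous; exact: rmeas_continuous. Qed.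

Lemma schwartz_L1 f : real_schwartz f -> L1 (@leb R n) f.
Proof.
by move=> Sf; apply: rapid_L1; [exact: schwartz_rmeas|exact: schwartz_rapid].
Qed.

Lemma schwartz0 : real_schwartz (fun _ : Rn => 0 : R).
Proof.
apply: (@real_schwartz_coind [set (fun _ : Rn => 0 : R)]) => // f ->; split.
- exact: diffble_cst.
- by move=> k; exists 0 => x; rewrite normr0 mulr0.
- by move=> i; rewrite pderiv_cst.
Qed.

(** The function vanishes where P <= 0, so its support is bounded. The generators comprise all
    orders at once, since a derivative raises the order by 1 and by 2. *)
Lemma schwartz_flat k P (M : R) : slow P -> (forall x, 0 < P x -> `|x| <= M) ->
  real_schwartz (fun x => flat_exp k (P x)).
Proof.
move=> sP PM.
pose S := [set f | exists k, f = fun x => flat_exp k (P x)].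
apply: (@slow_span_schwartz S); last by apply: slow_span_in; exists k.
move=> _ [{}k ->]; split.
- exact: slow_diffble (slow_flat k sP).
- move=> j; exists ((1 + `|M|) ^+ j * k%:R ^+ k) => x.
  rewrite ger0_norm ?flat_exp_ge0//; have [Px|Px] := ltP 0 (P x).
    apply: ler_pM; rewrite ?exprn_ge0 ?flat_exp_ge0 ?flat_exp_le ?addr_ge0//.
    rewrite lerXn2r// ?nnegrE ?addr_ge0// lerD2l.
    by apply: le_trans (PM x Px) _; exact: ler_norm.
  rewrite /flat_exp ltNge Px mulr0 mulr_ge0// exprn_ge0// addr_ge0//.
- move=> i; rewrite (_ : pderiv i _ = (fun x =>
      (fun x => (- k%:R * pderiv i P x)) x * flat_exp k.+1 (P x) +
      pderiv i P x * flat_exp k.+2 (P x))).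
    apply: slow_spanD; apply: slow_spanM.
    + apply: slowM; [exact: slow_cst|exact: slow_pderiv].
    + by apply: slow_span_in; exists k.+1.
    + exact: slow_pderiv.
    + by apply: slow_span_in; exists k.+2.
  apply/funext => x.
  rewrite (comp_derive i (slow_diffble sP) (flat_exp_derive k (P x))).2.
  by rewrite mulrDl mulrAC (mulrC (flat_exp _ _)).
Qed.

Lemma diffble_affine (s : R) (y : Rn) f : diffble f ->
  diffble (fun x => f (s *: x + y)) /\
  forall i, pderiv i (fun x => f (s *: x + y)) = (fun x => s * pderiv i f (s *: x + y)).
Proof.
move=> df; split=> [x|i].
  apply: (@differentiable_comp _ _ _ _ (fun x => s *: x + y) f) => //.
apply/funext => x.
rewrite /pderiv.
transitivity ('D_(s *: delta_mx ord0 i) f (s *: x + y)).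
  rewrite /derive; congr (lim _).
  rewrite (_ : (fun h : R => _) = (fun h : R => h^-1 *:
    ((f \o shift (s *: x + y)) (h *: (s *: delta_mx ord0 i)) - f (s *: x + y))))//.
  apply/funext => h /=; congr (_ *: (f _ - _)).
  by rewrite scalerDr !scalerA mulrC addrA.
by rewrite !deriveE// linearZ.
Qed.

Lemma schwartz_affine (s : R) (y : Rn) f : s != 0 -> real_schwartz f ->
  real_schwartz (fun x => f (s *: x + y)).
Proof.
move=> s0 Sf.
pose S := [set g | exists2 f, real_schwartz f & g = fun x => f (s *: x + y)].
apply: (@slow_span_schwartz S); last by apply: slow_span_in; exists f.
move=> _ [g Sg ->]; have [dg pg] := diffble_affine s y (schwartz_diffble Sg).
split=> //; first exact: rapid_affine (schwartz_rapid Sg).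
move=> i; rewrite pg; apply: slow_spanM (slow_cst s) _.
by apply: slow_span_in; exists (pderiv i g) => //; exact: schwartz_pderiv.
Qed.

End schwartz_closure.

(** * Fourier inversion and Plancherel *)

Section mean_value.
Context {R : realType}.
Implicit Types f df : R -> R.

Lemma mean_value_le f df (M a b : R) :
  (forall x : R, is_derive x 1 f (df x)) ->
  (forall x, `|x - a| <= `|b - a| -> `|df x| <= M) ->
  `|f b - f a| <= M * `|b - a|.
Proof.
move=> dff dfM.
have cf : continuous f.
  move=> x; apply: differentiable_continuous; apply/derivable1_diffP.
  exact: (@ex_derive _ _ _ _ _ _ _ (dff x)).
have [ab|ba|->] := ltgtP a b; last by rewrite !subrr normr0 mulr0.
- have [] := @MVT R f df a b ab (fun x _ => dff x) (continuous_subspaceT cf).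
  move=> c; rewrite in_itv/= => /andP[ac cb] ->; rewrite normrM ler_wpM2r//.
  by apply: dfM; rewrite !ger0_norm ?subr_ge0 ?lerD2r// ltW.
- have [] := @MVT R f df b a ba (fun x _ => dff x) (continuous_subspaceT cf).
  move=> c; rewrite in_itv/= => /andP[bc ca] E.
  rewrite distrC E normrM distrC ler_wpM2r//.
  apply: dfM; rewrite !ler0_norm ?subr_le0; [|exact: ltW|exact: ltW].
  by rewrite lerN2 lerD2r ltW.
Qed.

Lemma sin_lip (a b : R) : `|sin b - sin a| <= `|b - a|.
Proof.
rewrite -[leRHS]mul1r; apply: (mean_value_le (df := cos)) => // x _.
exact: cos_max.
Qed.

(** The mean value theorem for t -> cos (a + t) + t sin a, whose derivative is at most |t| in
    modulus because sine is 1-Lipschitz. *)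
Lemma cos_taylor (a b : R) : `|cos (a + b) - cos a + b * sin a| <= b ^+ 2.
Proof.
pose f t := cos (a + t) + t * sin a.
pose df t := - sin (a + t) + sin a.
have dff (x : R) : is_derive x 1 f (df x).
  have d1 : is_derive x 1 (fun t : R => a + t) 1.
    by apply: is_derive_eq (is_deriveD (is_derive_cst a x 1) (is_derive_id x 1)) _; rewrite add0r.
  have d2 : is_derive x 1 (fun t : R => cos (a + t)) (- sin (a + x)).
    apply: is_derive_eq (is_derive1_comp (is_derive_cos (a + x)) d1) _.
    by rewrite mulr1.
  have d3 : is_derive x 1 (fun t : R => t * sin a) (sin a).
    apply: is_derive_eq (is_deriveM (is_derive_id x 1) (is_derive_cst (sin a) x 1)) _.
    by rewrite /GRing.scale/= mulr0 mulr1 add0r.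
  exact: is_derive_eq (is_deriveD d2 d3) _.
have -> : cos (a + b) - cos a + b * sin a = f b - f 0.
  by rewrite /f addr0 mul0r addr0 addrAC.
have -> : b ^+ 2 = `|b| * `|b - 0| by rewrite subr0 -normrM -expr2 ger0_norm// sqr_ge0.
apply: (mean_value_le dff) => x; rewrite !subr0 => xb.
rewrite /df addrC -opprB normrN; apply: le_trans (sin_lip _ _) _.
by rewrite addrAC subrr add0r.
Qed.

End mean_value.

Section quadratic_remainder.
Context {R : realType}.

(** Meant for differentiation under the integral sign: the transform minus its first-order expansion
    is such an r. *)
Lemma diff_quadratic (V W : normedModType R) (r : V -> W) (x : V) (C : R) :
  (forall y, `|r y| <= C * `|y - x| ^+ 2) ->
  differentiable r x /\ forall v, 'D_v r x = 0.
Proof.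
move=> rC.
have rx : r x = 0.
  apply/eqP; rewrite -normr_le0; apply: le_trans (rC x) _.
  by rewrite subrr normr0 expr0n/= mulr0.
have c0 : continuous (\0 : V -> W) by exact: cst_continuous.
have E : r \o shift x = cst (r x) + \0 +o_ 0 id.
  apply/eqaddoP => e e0.
  near=> h.
  have -> : (r \o shift x - (cst (r x) + \0)) h = r (h + x).
    by rewrite rx fctE /= !fctE /cst /= addr0 subr0.
  rewrite /=.
  apply: le_trans (rC _) _; rewrite addrK expr2 mulrA ler_wpM2r//.
  apply: (@le_trans _ _ ((`|C| + 1) * `|h|)).
    by rewrite ler_wpM2r// (le_trans (ler_norm C))// lerDl.
  rewrite mulrC -ler_pdivlMr ?ltr_wpDl//; near: h; apply: nbhs0_le.
  by rewrite divr_gt0 ?ltr_wpDl.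
have d0 : 'd r x = \0 :> (V -> W).
  exact: (@diff_unique _ _ _ r (\0 : {linear V -> W}) x c0 E).
have dr : differentiable r x by apply/diff_locallyP; rewrite d0.
by split => // v; rewrite deriveE// d0.
Unshelve. all: by end_near. Qed.

End quadratic_remainder.

Section pderiv_line.
Context {R : realType} {n : nat}.
Local Notation Rn := 'rV[R]_n.

Lemma pderiv_line i (q : Rn -> R) (x : Rn) (c : R) :
  (forall t : R, q (t *: delta_mx ord0 i + x) = q x + t * c) -> pderiv i q x = c.
Proof.
move=> qc; apply: cvg_lim => //; apply/cvgrPdist_lt => e e0.
near=> t; have t0 : t != 0 by near: t; exact: nbhs_dnbhs_neq.
by rewrite /= qc addrAC subrr add0r /GRing.scale/= mulrA mulVf// mul1r subrr normr0.
Unshelve. all: by end_near. Qed.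

End pderiv_line.

Section rint_sum.
Context {d} {T : measurableType d} {R : realType}.
Variable mu : {measure set T -> \bar R}.

Lemma L1_sum (I : Type) (s : seq I) (F : I -> T -> R) :
  (forall i, L1 mu (F i)) -> L1 mu (fun x => \sum_(i <- s) F i x).
Proof.
move=> F1; elim: s => [|i s ih].
  apply: (@L1_ext _ _ _ mu (fun=> 0)); first by move=> x; rewrite big_nil.
  exact: integrable0.
by apply: L1_ext (L1D (F1 i) ih) => x; rewrite big_cons.
Qed.

Lemma rint_sum (I : Type) (s : seq I) (F : I -> T -> R) :
  (forall i, L1 mu (F i)) ->
  rint mu (fun x => \sum_(i <- s) F i x) = \sum_(i <- s) rint mu (F i).
Proof.
move=> F1; elim: s => [|i s ih].
  rewrite big_nil (rint_ext mu (g := fun=> 0)); last by move=> x; rewrite big_nil.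
  by rewrite /rint /Rintegral integral0.
rewrite big_cons -ih -rintD//; last exact: L1_sum.
by apply: rint_ext => x; rewrite big_cons.
Qed.

End rint_sum.

(** * Cosine transforms with a phase *)

Section cosine_transform.
Context {R : realType} {n : nat}.
Local Notation Rn := 'rV[R]_n.
Local Notation LT := (lebesgueType R n).
Local Notation leb := (@leb R n).
Implicit Types (f g : Rn -> R) (th : R).

(** The phase [th] unifies the cosine transform (phase 0) and the sine transform (phase -pi/2).
    Differentiating the transform or the function shifts the phase by pi/2, so the family is closed
    under both. *)
Definition cosft th f (xi : Rn) : R :=
  rint leb (fun x : LT => f x * cos (dot (x : Rn) xi + th)).

Lemma dotC (x y : Rn) : dot x y = dot y x.
Proof. by apply: eq_bigr => i _; rewrite mulrC. Qed.

Lemma dotDr (x y z : Rn) : dot x (y + z) = dot x y + dot x z.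
Proof. by rewrite /dot -big_split; apply: eq_bigr => i _; rewrite mxE mulrDr. Qed.

Lemma dotZr (s : R) (x y : Rn) : dot x (s *: y) = s * dot x y.
Proof. by rewrite /dot mulr_sumr; apply: eq_bigr => i _; rewrite mxE mulrCA. Qed.

Lemma dotNr (x y : Rn) : dot x (- y) = - dot x y.
Proof. by rewrite -scaleN1r dotZr mulN1r. Qed.

Lemma dot_delta (x : Rn) i : dot x (delta_mx ord0 i) = x ord0 i.
Proof.
rewrite /dot (bigD1 i)//= big1 => [|j ji]; rewrite mxE eqxx/=.
  by rewrite eqxx mulr1 addr0.
by rewrite (negbTE ji) mulr0.
Qed.

Lemma dot_le (x y : Rn) : `|dot x y| <= n%:R * `|x| * `|y|.
Proof.
apply: le_trans (ler_norm_sum _ _ _) _.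
apply: (@le_trans _ _ (\sum_(i < n) `|x| * `|y|)).
  by apply: ler_sum => i _; rewrite normrM ler_pM// rV_norm_coord.
by rewrite sumr_const card_ord -[leLHS]mulr_natl mulrA.
Qed.

Lemma slow_dot (y : Rn) : slow (fun x => dot x y).
Proof. by apply: slow_sum => i; apply: slowM; [exact: slow_coord|exact: slow_cst]. Qed.

Lemma slow_wave (y : Rn) th : slow (fun x => cos (dot x y + th)).
Proof.
by apply/slow_cos/slowD; [exact: slow_dot|exact: slow_cst].
Qed.

Lemma rmeas_wave (y : Rn) th : rmeas (fun x : LT => cos (dot (x : Rn) y + th)).
Proof. exact/rmeas_continuous/diffble_continuous/slow_diffble/slow_wave. Qed.

Lemma L1_wave f (y : Rn) th : L1 leb f ->
  L1 leb (fun x : LT => f x * cos (dot (x : Rn) y + th)).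
Proof.
move=> f1; apply: (L1_dom _ _ (L1_norm f1)).
  exact: rmeasM (L1_rmeas f1) (rmeas_wave _ _).
by move=> x; rewrite normrM ler_piMr// cos_max.
Qed.

Lemma cosftD th f g xi : L1 leb f -> L1 leb g ->
  cosft th (fun x => f x + g x) xi = cosft th f xi + cosft th g xi.
Proof.
move=> f1 g1; rewrite /cosft -rintD; [|exact: L1_wave|exact: L1_wave].
by apply: rint_ext => x; rewrite mulrDl.
Qed.

Lemma cosftZ th (c : R) f xi : L1 leb f ->
  cosft th (fun x => c * f x) xi = c * cosft th f xi.
Proof.
move=> f1; rewrite /cosft -rintZ; last exact: L1_wave.
by apply: rint_ext => x; rewrite mulrA.
Qed.

Lemma cosft_le th f xi : L1 leb f ->
  `|cosft th f xi| <= rint leb (fun x : LT => `|f x|).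
Proof.
move=> f1; apply: le_trans (rint_norm (L1_wave xi th f1)) _.
apply: rint_le; [exact: L1_norm (L1_wave _ _ f1)|exact: L1_norm|].
by move=> x; rewrite normrM ler_piMr// cos_max.
Qed.

(** The second-order bound on cosine, integrated against f, leaves a remainder of at most |xi -
    xi0|^2 times the integral of (n |x|)^2 |f| after the affine part [q] is removed. *)
Lemma cosft_diff th f : real_schwartz f ->
  diffble (cosft th f) /\
  forall i, pderiv i (cosft th f) = cosft (th + pi / 2) (fun x => x ord0 i * f x).
Proof.
move=> Sf.
have Sxf i : real_schwartz (fun x => x ord0 i * f x).
  by apply: schwartz_slowM => //; exact: slow_coord.
have f1 := schwartz_L1 Sf; have xf1 i := schwartz_L1 (Sxf i).
suff H xi0 : differentiable (cosft th f) xi0 /\ forall i,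
    pderiv i (cosft th f) xi0 = cosft (th + pi / 2) (fun x => x ord0 i * f x) xi0.
  by split=> [xi0|i]; [exact: (H xi0).1|apply/funext => xi0; exact: (H xi0).2].
pose c i := cosft (th + pi / 2) (fun x => x ord0 i * f x) xi0.
pose q (xi : Rn) := cosft th f xi0 + \sum_i (xi ord0 i - xi0 ord0 i) * c i.
pose r xi := cosft th f xi - q xi.
pose G x := (n%:R * `|x|) ^+ 2 * `|f x|.
have G1 : L1 leb G.
  apply: rapid_L1.
    apply: rmeasM; last exact: rmeas_norm (schwartz_rmeas Sf).
    apply: rmeasX; apply: rmeasM; first exact: rmeas_cst.
    by apply: rmeas_continuous; exact: norm_continuous.
  apply: rapidM_pbound.
    exists 2%N, (n%:R ^+ 2) => x; rewrite ger0_norm ?sqr_ge0// exprMn.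
    by rewrite ler_wpM2l ?sqr_ge0// lerXn2r ?nnegrE ?addr_ge0// lerDr.
  by move=> k; have [M hM] := schwartz_rapid Sf k; exists M => x; rewrite normr_id.
have rE xi : r xi = rint leb (fun x : LT => f x *
    (cos (dot (x : Rn) xi0 + th + dot (x : Rn) (xi - xi0)) - cos (dot (x : Rn) xi0 + th) +
      dot (x : Rn) (xi - xi0) * sin (dot (x : Rn) xi0 + th))).
  have w1 i : L1 leb (fun x : LT => (xi ord0 i - xi0 ord0 i) *
      ((x : Rn) ord0 i * f x * cos (dot (x : Rn) xi0 + (th + pi / 2)))).
    by apply: L1Z; exact: L1_wave.
  have qE : q xi = rint leb (fun x : LT => f x * cos (dot (x : Rn) xi0 + th)) +
      rint leb (fun x : LT => \sum_(i < n) (xi ord0 i - xi0 ord0 i) *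
      ((x : Rn) ord0 i * f x * cos (dot (x : Rn) xi0 + (th + pi / 2)))).
    rewrite rint_sum//; congr (_ + _); apply: eq_bigr => i _.
    by rewrite rintZ//; exact: L1_wave.
  rewrite /r qE -rintD; [|exact: L1_wave|exact: L1_sum].
  rewrite -rintB; [|exact: L1_wave|by apply: L1D; [exact: L1_wave|exact: L1_sum]].
  apply: rint_ext => x.
  have -> : \sum_(i < n) (xi ord0 i - xi0 ord0 i) *
      ((x : Rn) ord0 i * f x * cos (dot (x : Rn) xi0 + (th + pi / 2))) =
      - (f x * (dot (x : Rn) (xi - xi0) * sin (dot (x : Rn) xi0 + th))).
    rewrite addrA cosDpihalf /dot mulr_suml mulr_sumr -sumrN.
    by apply: eq_bigr => i _; rewrite !mxE; ring.
  have -> : dot (x : Rn) xi0 + th + dot (x : Rn) (xi - xi0) = dot (x : Rn) xi + th.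
    by rewrite dotDr dotNr; ring.
  by ring.
have rC xi : `|r xi| <= rint leb G * `|xi - xi0| ^+ 2.
  rewrite rE mulrC -rintZ//.
  have h x : `|f x * (cos (dot x xi0 + th + dot x (xi - xi0)) - cos (dot x xi0 + th) +
      dot x (xi - xi0) * sin (dot x xi0 + th))| <= `|xi - xi0| ^+ 2 * G x.
    rewrite normrM /G mulrA [leLHS]mulrC ler_wpM2r//.
    apply: le_trans (cos_taylor _ _) _.
    rewrite -exprMn -[leLHS]real_normK ?num_real// lerXn2r ?nnegrE ?mulr_ge0//.
    by apply: le_trans (dot_le _ _) _; rewrite mulrC.
  have m : rmeas (fun x : LT => f x * (cos (dot (x : Rn) xi0 + th +
      dot (x : Rn) (xi - xi0)) - cos (dot (x : Rn) xi0 + th) +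
      dot (x : Rn) (xi - xi0) * sin (dot (x : Rn) xi0 + th))).
    apply: rmeasM; first exact: schwartz_rmeas.
    have md y : rmeas (fun x : LT => dot (x : Rn) y).
      exact/rmeas_continuous/diffble_continuous/slow_diffble/slow_dot.
    apply: rmeasD; last first.
      apply: rmeasM; first exact: md.
      apply: rmeas_comp; first exact: continuous_sin.
      by apply: rmeasD; [exact: md|exact: rmeas_cst].
    apply: rmeasB; last exact: rmeas_wave.
    apply: rmeas_comp; first exact: continuous_cos.
    by apply: rmeasD; [apply: rmeasD; [exact: md|exact: rmeas_cst]|exact: md].
  have G1' := L1Z (`|xi - xi0| ^+ 2) G1.
  have F1 := L1_dom m h G1'.
  apply: le_trans (rint_norm F1) _.
  by apply: rint_le => //; exact: L1_norm.
have [dr pr] := @diff_quadratic R Rn R r xi0 _ rC.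
have sq : slow q.
  apply: slowD; first exact: slow_cst.
  apply: slow_sum => i; apply: slowM; last exact: slow_cst.
  by apply: slowD; [exact: slow_coord|exact: slow_cst].
have fE : cosft th f = (fun xi => q xi + r xi).
  by apply/funext => xi; rewrite /r addrC subrK.
have dq := slow_diffble sq.
rewrite fE; split; first exact: (differentiableD (dq xi0) dr).
move=> i; rewrite /pderiv (@deriveD _ _ _ q r); try exact: diff_derivable.
rewrite [X in _ + X](pr _) addr0.
apply: pderiv_line => t; rewrite /q -addrA; congr (_ + _).
rewrite (bigD1 i)//= [in RHS](bigD1 i)//= addrAC; congr (_ + _).
  by rewrite !mxE !eqxx mulr1 subrr mul0r add0r addrK.
by apply: eq_bigr => j ji; rewrite !mxE (negbTE ji) andbF mulr0 add0r.
Qed.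

End cosine_transform.

Section cosft_schwartz.
Context {R : realType} {n : nat}.
Local Notation Rn := 'rV[R]_n.
Local Notation LT := (lebesgueType R n).
Local Notation leb := (@leb R n).
Implicit Types (f g : Rn -> R) (th : R).

Lemma is_derive_line f (v x : Rn) (t : R) : diffble f ->
  is_derive t 1 (fun s : R => f (x + s *: v))
    ('D_v f (x + t *: v)).
Proof.
move=> df.
have D := @diff_derivable _ _ _ f (x + t *: v) (v) (df _).
have E : (fun h : R => h^-1 *: (((fun s : R => f (x + s *: v)) \o shift t) (h *: 1)
    - f (x + t *: v))) =
  (fun h : R => h^-1 *: ((f \o shift (x + t *: v)) (h *: v)
    - f (x + t *: v))).
  apply/funext => h /=; congr (_ *: (f _ - _)).
  have -> : h *: (1 : R) = h by rewrite /GRing.scale/= mulr1.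
  by rewrite scalerDl addrCA.
apply: DeriveDef; first by rewrite /derivable E; exact: D.
by rewrite /derive E.
Qed.

Lemma rV_norm_delta (i : 'I_n) : `|delta_mx ord0 i : Rn| <= 1.
Proof.
apply: rV_norm_le => // j; rewrite mxE; case: (_ && _) => /=.
  by rewrite normr1.
by rewrite normr0.
Qed.

(** Difference quotients have integral 0 by translation invariance, and they converge to the
    derivative under a common integrable bound. *)
Lemma rint_pderiv i f : real_schwartz f -> rint leb (pderiv i f) = 0.
Proof.
move=> Sf; have df := schwartz_diffble Sf; have f1 := schwartz_L1 Sf.
pose e : Rn := delta_mx ord0 i.
pose D k (x : Rn) := k.+1%:R * (f (1 *: x + k.+1%:R^-1 *: e) - f x).
have n10 : (1 : R) != 0 by exact: oner_neq0.
have D1 k : L1 leb (D k) by apply/L1Z/L1B => //; exact: L1_affine.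
have D0 k : rint leb (D k) = 0.
  rewrite rintZ; last by apply/L1B => //; exact: L1_affine.
  rewrite rintB//; last exact: L1_affine.
  by rewrite rint_affine// invr1 normr1 expr1n mul1r subrr mulr0.
have [C C0 hC] := rapid_decay (schwartz_rapid (schwartz_pderiv i Sf)) n.+1.
have cvgD x : D ^~ x @ \oo --> pderiv i f x.
  have H : (fun h : R => h^-1 *: ((f \o shift x) (h *: e) - f x)) @ 0^' --> pderiv i f x.
    exact: (@diff_derivable _ _ _ f x e (df x)).
  have h0 : (fun k => k.+1%:R^-1 : R) @ \oo --> (0 : R)^'.
    move=> A HA; have := @cvg_harmonic R _ HA.
    move=> [N _ hN]; exists N => // k /hN /= hk; apply: hk.
    by rewrite invr_eq0 pnatr_eq0.
  have := cvg_comp _ _ h0 H; apply: cvg_trans; apply: near_eq_cvg; apply: nearW => k.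
  by rewrite /D /= invrK scale1r [x + _]addrC.
have Dle k x : `|D k x| <= C * 2 ^+ n.+1 * ((1 + `|x|) ^+ n.+1)^-1.
  rewrite /D scale1r normrM.
  have h := mean_value_le (fun t => is_derive_line e x t df)
    (M := C * 2 ^+ n.+1 * ((1 + `|x|) ^+ n.+1)^-1) (a := 0) (b := k.+1%:R^-1).
  rewrite -ler_pdivlMl ?normr_gt0// mulrC -normfV.
  have -> : f x = f (x + 0 *: e) by rewrite scale0r addr0.
  rewrite -[X in _ * `|X|](subr0); apply: h => t; rewrite !subr0 => tk.
  have t1 : `|t| <= 1.
    by apply: le_trans tk _; rewrite ger0_norm ?invr_ge0// invf_le1// ler1n.
  (* For |t| <= 1 one has 1 + |x| <= 2 (1 + |x + t e|), which is the origin of the factor 2^(n +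
     1). *)
  apply: le_trans (hC _) _; rewrite -mulrA ler_wpM2l//.
  rewrite -ler_pdivrMl ?exprn_gt0// -invfM lef_pV2 ?posrE; last 2 first.
  - by rewrite mulr_gt0// exprn_gt0// one_norm_gt0.
  - by rewrite exprn_gt0// one_norm_gt0.
  rewrite -exprMn lerXn2r ?nnegrE ?mulr_ge0 ?addr_ge0//.
  have -> : `|x| = `|(x + t *: e) - t *: e| by rewrite addrK.
  have te : `|t *: e| <= 1.
    by rewrite normrZ mulr_ile1// rV_norm_delta.
  apply: (@le_trans _ _ (1 + (`|x + t *: e| + `|t *: e|))).
    by rewrite lerD2l ler_normB.
  have : 0 <= `|x + t *: e| by [].
  lra.
have := rint_dct (fun k => L1_rmeas (D1 k)) cvgD
  (L1Z (C * 2 ^+ n.+1) L1_decay) Dle.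
rewrite (_ : (fun k => rint leb (D k)) = fun=> 0); last exact/funext.
move=> H; apply/esym; have := cvg_unique _ (@cvg_cst _ (0 : R) _ \oo _) H.
exact.
Qed.

Lemma pderiv_wave i (xi : Rn) th :
  pderiv i (fun x => cos (dot x xi + th)) =
  (fun x => xi ord0 i * cos (dot x xi + (th + pi / 2))).
Proof.
apply/funext => x.
have sd : slow (fun x => dot x xi + th).
  by apply: slowD; [exact: slow_dot|exact: slow_cst].
rewrite (comp_derive i (slow_diffble sd) (is_derive_cos (dot x xi + th))).2.
rewrite addrA cosDpihalf mulrC; congr (_ * _).
by apply: pderiv_line => t; rewrite !(dotC _ xi) dotDr dotZr dot_delta; ring.
Qed.

(** Integration by parts: the derivative of the product of f with the wave has integral 0. *)
Lemma cosft_pderiv th i f xi : real_schwartz f ->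
  cosft th (pderiv i f) xi = - (xi ord0 i * cosft (th + pi / 2) f xi).
Proof.
move=> Sf.
have Sw : real_schwartz (fun x => f x * cos (dot x xi + th)).
  rewrite (_ : (fun x => _) = (fun x => cos (dot x xi + th) * f x)).
    by apply: schwartz_slowM => //; exact: slow_wave.
  by apply/funext => x; rewrite mulrC.
have := rint_pderiv i Sw.
rewrite pderivM; [|exact: schwartz_diffble|exact/slow_diffble/slow_wave].
have f1 := schwartz_L1 Sf.
have Ef x : f x * pderiv i (fun x => cos (dot x xi + th)) x =
    xi ord0 i * (f x * cos (dot x xi + (th + pi / 2))).
  by rewrite pderiv_wave mulrCA.
rewrite rintD; last 2 first.
- by apply: L1_wave; exact: schwartz_L1 (schwartz_pderiv i Sf).
- apply: L1_ext (L1Z (xi ord0 i) (L1_wave xi (th + pi / 2) f1)) => x.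
  by rewrite Ef.
rewrite (rint_ext leb Ef) rintZ; last exact: L1_wave.
by move=> /eqP; rewrite addr_eq0 => /eqP.
Qed.

(** Each power of xi_i is traded for a derivative of f, so the induction has to vary both f and the
    phase. *)
Lemma cosft_coordX k (i : 'I_n) : forall f th, real_schwartz f ->
  exists M, forall xi : Rn, `|xi ord0 i| ^+ k * `|cosft th f xi| <= M.
Proof.
elim: k => [|k ih] f th Sf.
  exists (rint leb (fun x : LT => `|f x|)) => xi; rewrite expr0 mul1r.
  by apply: cosft_le; exact: schwartz_L1.
have [M hM] := ih _ (th - pi / 2) (schwartz_pderiv i Sf); exists M => xi.
apply: le_trans (hM xi); rewrite cosft_pderiv// subrK normrN normrM.
by rewrite exprSr mulrA.
Qed.

(** The maximum norm of xi is attained at one coordinate, so for |xi| > 1 the bounds with powers of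
    single coordinates suffice. *)
Lemma rapid_cosft th f : real_schwartz f -> rapid (cosft th f).
Proof.
move=> Sf k.
have /choice[M hM] : forall i : 'I_n, exists M, forall xi : Rn,
    `|xi ord0 i| ^+ k * `|cosft th f xi| <= M by move=> i; exact: cosft_coordX.
pose N := rint leb (fun x : LT => `|f x|).
have f1 := schwartz_L1 Sf.
exists (2 ^+ k * (N + \sum_i `|M i|)) => xi.
have S0 : 0 <= \sum_i `|M i| by apply: sumr_ge0 => i _.
have N0 : 0 <= N by apply: rint_ge0 => x.
have [xi1|xi1] := leP `|xi| 1.
  apply: ler_pM; rewrite ?exprn_ge0 ?addr_ge0//.
    by rewrite lerXn2r ?nnegrE ?addr_ge0//; lra.
  by apply: (le_trans (cosft_le th xi f1)); rewrite lerDl.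
apply: (@le_trans _ _ (2 ^+ k * (`|xi| ^+ k * `|cosft th f xi|))).
  rewrite mulrA ler_wpM2r// -exprMn lerXn2r ?nnegrE ?addr_ge0 ?mulr_ge0//.
  by lra.
rewrite ler_wpM2l ?exprn_ge0//.
have [[j i] xiE] := mx_norm_neq0 (lt0r_neq0 (lt_trans ltr01 xi1)).
have -> : `|xi| = `|xi ord0 i| by apply: (etrans xiE); rewrite /= ord1.
apply: le_trans (hM i xi) _; apply: le_trans (ler_norm _) _.
rewrite (bigD1 i)//= addrCA lerDl addr_ge0// sumr_ge0// => j' _.
Qed.

Lemma schwartz_cosft th f : real_schwartz f -> real_schwartz (cosft th f).
Proof.
move=> Sf.
apply: (@real_schwartz_coind _ _ [set g | exists th f,
    real_schwartz f /\ g = cosft th f]); last by exists th, f.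
move=> _ [{}th [{}f [{}Sf ->]]]; have [dF pF] := cosft_diff th Sf.
split=> //; first exact: rapid_cosft.
move=> i; exists (th + pi / 2), (fun x : Rn => x ord0 i * f x).
by split; [apply: schwartz_slowM => //; exact: slow_coord|exact: pF].
Qed.

Lemma rmeas_wave2 th :
  rmeas (fun p : LT * LT => cos (dot (p.1 : Rn) (p.2 : Rn) + th)).
Proof.
apply: rmeas_comp; first exact: continuous_cos.
by apply: rmeasD; [exact: rmeas_dot|exact: rmeas_cst].
Qed.

(** The multiplication formula, from Fubini and the symmetry of the kernel in x and xi. *)
Lemma cosft_mul th f g : L1 leb f -> L1 leb g ->
  rint leb (fun x : LT => f x * cosft th g x) =
  rint leb (fun x : LT => g x * cosft th f x).
Proof.
move=> f1 g1.
have := @rint_fubini _ _ LT LT R leb leb f g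
  (fun x y => cos (dot (x : Rn) (y : Rn) + th)) 1 f1 g1 (rmeas_wave2 th)
  (fun x y => cos_max _).
rewrite /cosft => <-; apply: rint_ext => x; congr (_ * _).
by apply: rint_ext => y; rewrite dotC.
Qed.

(** The translation is undone by substitution and the cosine of the difference expanded; the
    resulting sine is a cosine with the phase shifted by -pi/2. *)
Lemma cosft_translate th f (y : Rn) xi : L1 leb f ->
  cosft th (fun x => f (1 *: x + y)) xi =
  cos (dot y xi) * cosft th f xi + sin (dot y xi) * cosft (th - pi / 2) f xi.
Proof.
move=> f1; have n10 : (1 : R) != 0 by exact: oner_neq0.
have h1 := L1_wave xi th f1; have h2 := L1_wave xi (th - pi / 2) f1.
rewrite -!rintZ// -rintD; [|exact: L1Z|exact: L1Z].
pose F (x : Rn) := cos (dot y xi) * (f x * cos (dot x xi + th)) +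
  sin (dot y xi) * (f x * cos (dot x xi + (th - pi / 2))).
have F1 : L1 leb F by apply: L1D; exact: L1Z.
have := rint_affine y n10 F1; rewrite invr1 normr1 expr1n mul1r => <-.
apply: rint_ext => x; rewrite /F addrA cosBpihalf.
have -> : dot x xi + th = dot (1 *: x + y) xi + th - dot y xi.
  by rewrite !(dotC _ xi) dotDr dotZr; ring.
by rewrite cosB; ring.
Qed.

End cosft_schwartz.

Section positivity.
Context {R : realType} {n : nat}.
Local Notation Rn := 'rV[R]_n.
Local Notation LT := (lebesgueType R n).
Local Notation leb := (@leb R n).
Implicit Types f : Rn -> R.

Lemma lint_scale_indic (c : R) (A : set Rn) : 0 <= c -> measurable (A : set LT) ->
  lint leb (fun x : LT => c * \1_A (x : Rn)) = (c%:E * leb A)%E.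
Proof.
move=> c0 mA.
have mi : rmeas (\1_A : LT -> R) by exact: rmeas_indic.
rewrite lintZ//.
congr (_ * _)%E.
by rewrite /lint integral_indic ?setIT.
Qed.

Lemma lint_gt0 f : continuous f -> (forall x, 0 <= f x) -> 0 < f 0 ->
  (0 < lint leb f)%E.
Proof.
move=> cf f0 f00.
have : \forall x \near (0 : Rn), f 0 / 2 < f x.
  have := cf 0 => /cvgrPdist_lt/(_ (f 0 / 2)).
  have -> : 0 < f 0 / 2 by rewrite divr_gt0.
  move=> /(_ isT) H; near=> x.
  have /ltr_normlP[h1 h2] : `|f 0 - f x| < f 0 / 2 by near: x; exact: H.
  lra.
move=> /nbhs_ballP[e /= e0 he].
pose d := e / 2; have d0 : 0 < d by rewrite divr_gt0.
have hd (x : Rn) : cube d x -> f 0 / 2 <= f x.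
  rewrite cube_norm; last exact: ltW.
  move=> /= xd; apply/ltW/he.
  rewrite mx_norm_ball /ball_/= sub0r normrN; apply: le_lt_trans xd _.
  by rewrite /d ltr_pdivrMr// ltr_pMr// ltrDl.
apply: (@lt_le_trans _ _ (lint leb (fun x : LT => f 0 / 2 * \1_(cube d) (x : Rn)))).
  rewrite lint_scale_indic; [|by rewrite ltW// divr_gt0|exact: measurable_cube].
  rewrite leb_cube ?ltW// -EFinM lte_fin mulr_gt0 ?divr_gt0// exprn_gt0//.
  by rewrite mulrn_wgt0.
apply: lint_le.
- apply: rmeasM; first exact: rmeas_cst.
  by apply: rmeas_indic; exact: measurable_cube.
- exact: rmeas_continuous.
- by move=> x; rewrite mulr_ge0 ?divr_ge0// indicE.
- move=> x; rewrite indicE; case: (boolP (x \in cube d)) => [|_].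
    by rewrite inE mulr1 => /hd.
  by rewrite mulr0.
Unshelve. all: by end_near. Qed.

Lemma rint_gt0 f : continuous f -> L1 leb f -> (forall x, 0 <= f x) -> 0 < f 0 ->
  0 < rint leb f.
Proof. by move=> cf f1 f0 f00; rewrite -lte_fin -lintE//; exact: lint_gt0. Qed.

(** Here [rho] is the square of the radius of the support. *)
Definition bump (rho : R) (x : Rn) : R := flat_exp 0 (rho - \sum_i x ord0 i ^+ 2).

Lemma slow_bump_arg (rho : R) : slow (fun x : Rn => rho - \sum_i x ord0 i ^+ 2).
Proof.
have -> : (fun x : Rn => rho - \sum_i x ord0 i ^+ 2) =
    (fun x => rho + -1 * \sum_i x ord0 i * x ord0 i).
  by apply/funext => x; rewrite mulN1r; congr (_ - _); apply: eq_bigr => i _; rewrite expr2.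
apply: slowD; first exact: slow_cst.
apply: slowM; first exact: slow_cst.
by apply: slow_sum => i; apply: slowM; exact: slow_coord.
Qed.

Lemma schwartz_bump (rho : R) : real_schwartz (bump rho).
Proof.
apply: (@schwartz_flat _ _ _ _ (1 + rho)); first exact: slow_bump_arg.
move=> x; rewrite subr_gt0 -sqr_euclid_norm => xr.
apply: le_trans (rV_norm_le_euclid x) _.
move: (euclid_norm_ge0 x) xr; move: (euclid_norm x) => t; nra.
Qed.

Lemma bump_ge0 (rho : R) x : 0 <= bump rho x.
Proof. exact: flat_exp_ge0. Qed.

Lemma bump0_gt0 (rho : R) : 0 < rho -> 0 < bump rho 0.
Proof.
move=> r0; rewrite /bump big1 => [|i _]; last by rewrite mxE expr0n.
by rewrite subr0 /flat_exp r0 expr0 invr1 mul1r expR_gt0.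
Qed.

End positivity.

(** * Inversion and Plancherel for the cosine and sine transforms *)

Section real_inversion.
Context {R : realType} {n : nat}.
Local Notation Rn := 'rV[R]_n.
Local Notation LT := (lebesgueType R n).
Local Notation leb := (@leb R n).
Local Notation A := (@cosft R n 0).
Local Notation B := (@cosft R n (- (pi / 2))).
Implicit Types f g : Rn -> R.

(* The value (2 pi)^n is never needed, only positivity, which follows from
   Plancherel. *)
Definition fourier_cst : R := rint leb (A (bump 1)) / (bump 1 (0 : Rn)).
Local Notation c := fourier_cst.

Lemma schwartzM_L1 f g : real_schwartz f -> real_schwartz g ->
  L1 leb (fun x : LT => f x * g x).
Proof.
move=> Sf Sg; apply: rapid_L1.
  by apply: rmeasM; exact: schwartz_rmeas.
by apply: rapidM_pbound; [apply: rapid_pbound|]; exact: schwartz_rapid.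
Qed.

(** Inversion at 0. In the multiplication formula one function is the dilated bump G(e x). Rescaling
    moves the dilation to f, and e -> 0 gives G(0) times the integral of A f on one side and f(0)
    times the integral of A G on the other. The bump thus does the work of a Gaussian, and the
    constant is the quotient of the two values of G. *)
Lemma rint_cosft f : real_schwartz f -> rint leb (A f) = c * f 0.
Proof.
move=> Sf; pose G : Rn -> R := bump 1.
have SG : real_schwartz G by exact: schwartz_bump.
have G0 : 0 < G 0 by exact: bump0_gt0.
have f1 := schwartz_L1 Sf; have G1 := schwartz_L1 SG.
have SAf := schwartz_cosft 0 Sf; have SAG := schwartz_cosft 0 SG.
pose e k : R := k.+1%:R^-1.
have e0 k : e k != 0 by rewrite invr_eq0 pnatr_eq0.
have ecvg : e @ \oo --> 0 by exact: cvg_harmonic.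
have scvg (g : Rn -> R) x : continuous g -> (fun k => g (e k *: x + 0)) @ \oo --> g 0.
  move=> cg; have H : (fun k => e k *: x + 0) @ \oo --> (0 : Rn).
    have -> : (fun k => e k *: x + 0) = (fun k => e k *: x).
      by apply/funext => k; rewrite addr0.
    rewrite -[X in _ --> X](scale0r x); apply: cvgZ; first exact: ecvg.
    exact: cvg_cst.
  exact: (cvg_comp _ _ H (cg 0)).
have E k : rint leb (fun x : LT => A f x * G (e k *: (x : Rn) + 0)) =
    rint leb (fun x : LT => A G x * f (e k *: (x : Rn) + 0)).
  have Ge1 : L1 leb (fun x : LT => G (e k *: (x : Rn) + 0)) by exact: L1_affine.
  transitivity (rint leb (fun x : LT => f x * A (fun y => G (e k *: y + 0)) x)).
    rewrite cosft_mul//.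
    by apply: rint_ext => x; rewrite mulrC.
  have AG y : A (fun x => G (e k *: x + 0)) y = `|(e k)^-1| ^+ n * A G ((e k)^-1 *: y + 0).
    rewrite addr0 /cosft -(rint_affine 0 (e0 k)); last exact: L1_wave.
    apply: rint_ext => x /=; congr (_ * cos _).
    rewrite !addr0; apply/esym; apply: (etrans (dotZr _ _ _)).
    by rewrite (dotC _ y) dotZr mulrA mulVf// mul1r dotC.
  pose Phi (x : Rn) := A G x * f (e k *: x + 0).
  have Phi1 : L1 leb Phi.
    apply: schwartzM_L1 => //; exact: schwartz_affine.
  have := rint_affine 0 (_ : (e k)^-1 != 0) Phi1; rewrite invr_eq0 => /(_ (e0 k)).
  rewrite invrK => H.
  have -> : rint leb Phi = `|(e k)^-1| ^+ n * (`|e k| ^+ n * rint leb Phi).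
    by rewrite mulrA -exprMn -normrM mulVf// normr1 expr1n mul1r.
  rewrite -H -rintZ; last by apply: L1_affine => //; rewrite invr_eq0.
  apply: rint_ext => x; rewrite AG /Phi.
  by rewrite !addr0 scalerA mulfV// scale1r; ring.
have Gb x : `|G x| <= 1.
  rewrite ger0_norm ?bump_ge0//; apply: le_trans (flat_exp_le _ _) _.
  by rewrite expr0.
have [M M0 fM] := rapid_bounded (schwartz_rapid Sf).
have L1' : (fun k => rint leb (fun x : LT => A f x * G (e k *: (x : Rn) + 0))) @ \oo
    --> rint leb (fun x : LT => A f x * G 0).
  apply: (rint_dct (g := fun x : LT => `|A f x|)).
  - move=> k; apply: rmeasM; first exact: schwartz_rmeas.
    apply: rmeas_affine => //; exact: schwartz_rmeas.
  - move=> x; apply: cvgMl_tmp; apply: scvg; exact: schwartz_continuous.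
  - exact: L1_norm (schwartz_L1 SAf).
  - by move=> k x; rewrite normrM ler_piMr.
have L2' : (fun k => rint leb (fun x : LT => A G x * f (e k *: (x : Rn) + 0))) @ \oo
    --> rint leb (fun x : LT => A G x * f 0).
  apply: (rint_dct (g := fun x : LT => M * `|A G x|)).
  - move=> k; apply: rmeasM; first exact: schwartz_rmeas.
    apply: rmeas_affine => //; exact: schwartz_rmeas.
  - move=> x; apply: cvgMl_tmp; apply: scvg; exact: schwartz_continuous.
  - exact/L1Z/L1_norm/schwartz_L1.
  - by move=> k x; rewrite normrM mulrC ler_wpM2r.
have := L1'; rewrite (_ : (fun k => rint _ _) =
  (fun k => rint leb (fun x : LT => A G x * f (e k *: (x : Rn) + 0)))); last exact/funext.
move=> /(cvg_unique _ L2').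
rewrite (rint_ext leb (fun x => mulrC (A G x) (f 0))) rintZ; last exact: schwartz_L1.
rewrite (rint_ext leb (fun x => mulrC (A f x) (G 0))) rintZ; last exact: schwartz_L1.
move=> /(_ (@Rhausdorff R)) H; apply: (mulfI (lt0r_neq0 G0)).
rewrite -H /fourier_cst -/G; field; exact: lt0r_neq0.
Qed.

(** The formula at 0 applied to f(. + x): the addition theorem turns the translation into cos(x .
    xi) A f + sin(x . xi) B f. *)
Lemma cosft_inv f x : real_schwartz f -> A (A f) x + B (B f) x = c * f x.
Proof.
move=> Sf; have f1 := schwartz_L1 Sf.
have Sfx : real_schwartz (fun y => f (1 *: y + x)).
  by apply: schwartz_affine => //; exact: oner_neq0.
have := rint_cosft Sfx; rewrite scaler0 add0r => <-.
have A1 := schwartz_L1 (schwartz_cosft 0 Sf).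
have B1 := schwartz_L1 (schwartz_cosft (- (pi / 2)) Sf).
rewrite /cosft -rintD; [|exact: L1_wave|exact: L1_wave].
apply: rint_ext => xi; rewrite -!/(cosft _ _ _) cosft_translate// sub0r.
by rewrite -cosBpihalf !(dotC xi) addr0; congr (_ + _); rewrite mulrC.
Qed.

Lemma rint_odd (g : Rn -> R) : L1 leb g -> (forall x, g (- x) = - g x) ->
  rint leb g = 0.
Proof.
move=> g1 go; have N10 : (-1 : R) != 0 by rewrite oppr_eq0 oner_neq0.
have := rint_affine 0 N10 g1; rewrite invrN invr1 normrN normr1 expr1n mul1r.
rewrite (rint_ext leb (g := fun x : LT => - g x)); last first.
  by move=> x; rewrite addr0 scaleN1r go.
by rewrite rintN// => h; lra.
Qed.

(** The sine transform of f(. + x) is odd, so its integral is 0. Expanded by the addition theorem,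
    this integral is A (B f) - B (A f) at x. *)
Lemma cosft_comm f x : real_schwartz f -> A (B f) x = B (A f) x.
Proof.
move=> Sf; have f1 := schwartz_L1 Sf.
have Sfx : real_schwartz (fun y => f (1 *: y + x)).
  by apply: schwartz_affine => //; exact: oner_neq0.
have A1 := schwartz_L1 (schwartz_cosft 0 Sf).
have B1 := schwartz_L1 (schwartz_cosft (- (pi / 2)) Sf).
have : rint leb (B (fun y => f (1 *: y + x))) = 0.
  apply: rint_odd; first exact: schwartz_L1 (schwartz_cosft _ Sfx).
  move=> xi; rewrite /cosft -rintN; last exact/L1_wave/schwartz_L1.
  apply: rint_ext => y /=; rewrite -[RHS]mulrN; congr (_ * _).
  by rewrite dotNr -opprD cosN cosDpihalf cosBpihalf.
move=> H; apply/subr0_eq; rewrite -[RHS]H.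
rewrite /cosft -rintB; [|exact: L1_wave|exact: L1_wave].
apply: rint_ext => xi; rewrite -!/(cosft _ _ _) cosft_translate//.
rewrite addr0 !(dotC xi) -cosBpihalf mulrC; congr (_ + _).
rewrite mulrC -mulrN; congr (_ * _).
rewrite /cosft -rintN; last exact: L1_wave.
apply: rint_ext => y /=; rewrite addr0 -[LHS]mulrN; congr (_ * _).
have -> : - (pi / 2) - pi / 2 = - pi :> R by lra.
by rewrite -[RHS]cosN opprD opprK cosDpi cosN.
Qed.

(** The multiplication formula moves the transforms from f onto the transforms of g, where inversion
    applies. *)
Lemma cosft_plancherel f g : real_schwartz f -> real_schwartz g ->
  rint leb (fun x : LT => A f x * A g x + B f x * B g x) =
  c * rint leb (fun x : LT => f x * g x).
Proof.
move=> Sf Sg; have f1 := schwartz_L1 Sf; have g1 := schwartz_L1 Sg.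
have SA := schwartz_cosft 0 Sg; have SB := schwartz_cosft (- (pi / 2)) Sg.
rewrite rintD; [|by apply: schwartzM_L1 => //; exact: schwartz_cosft|
  by apply: schwartzM_L1 => //; exact: schwartz_cosft].
rewrite (rint_ext leb (fun x => mulrC (A f x) (A g x))).
rewrite (rint_ext leb (fun x => mulrC (B f x) (B g x))).
rewrite -(cosft_mul 0 f1 (schwartz_L1 SA)) -(cosft_mul _ f1 (schwartz_L1 SB)).
rewrite -rintD; [|by apply: schwartzM_L1 => //; exact: schwartz_cosft|
  by apply: schwartzM_L1 => //; exact: schwartz_cosft].
rewrite -rintZ; last exact: schwartzM_L1.
by apply: rint_ext => x; rewrite -mulrDr cosft_inv// mulrCA.
Qed.

(** These are the cross terms between real and imaginary parts in the squared modulus of a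
    transform; being equal, they cancel there. *)
Lemma cosft_cross f g : real_schwartz f -> real_schwartz g ->
  rint leb (fun x : LT => A f x * B g x) = rint leb (fun x : LT => B f x * A g x).
Proof.
move=> Sf Sg; have f1 := schwartz_L1 Sf; have g1 := schwartz_L1 Sg.
have SA := schwartz_cosft 0 Sg; have SB := schwartz_cosft (- (pi / 2)) Sg.
rewrite (rint_ext leb (fun x => mulrC (A f x) (B g x))).
rewrite (rint_ext leb (fun x => mulrC (B f x) (A g x))).
rewrite -(cosft_mul _ f1 (schwartz_L1 SB)) -(cosft_mul _ f1 (schwartz_L1 SA)).
by apply: rint_ext => x; rewrite cosft_comm.
Qed.

(** For f = g = [bump 1] the left side of Plancherel is positive, because A G at 0 is the integral
    of G. *)
Lemma fourier_cst_gt0 : 0 < c.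
Proof.
pose G : Rn -> R := bump 1.
have SG : real_schwartz G by exact: schwartz_bump.
have G0 : 0 < G 0 by exact: bump0_gt0.
have cG := schwartz_continuous SG.
have SA := schwartz_cosft 0 SG; have SB := schwartz_cosft (- (pi / 2)) SG.
have GG : 0 < rint leb (fun x : LT => G x * G x).
  apply: rint_gt0.
  - by apply/diffble_continuous/diffbleM; exact: schwartz_diffble.
  - exact: schwartzM_L1.
  - by move=> x; rewrite mulr_ge0 ?bump_ge0.
  - exact: mulr_gt0.
have AG0 : 0 < A G 0.
  rewrite /cosft (rint_ext leb (g := G)); last first.
    move=> x; rewrite dotC /dot big1 => [|i _]; last by rewrite mxE mul0r.
    by rewrite addr0 cos0 mulr1.
  by apply: rint_gt0 => //; [exact: schwartz_L1|move=> x; exact: bump_ge0].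
have : 0 < rint leb (fun x : LT => A G x * A G x + B G x * B G x).
  apply: rint_gt0.
  - by apply/diffble_continuous/diffbleD; apply: diffbleM; exact: schwartz_diffble.
  - by apply: L1D; exact: schwartzM_L1.
  - by move=> x; rewrite -!expr2 addr_ge0// sqr_ge0.
  - by rewrite -!expr2 ltr_pwDl ?sqr_ge0// exprn_gt0.
by rewrite cosft_plancherel// pmulr_lgt0.
Qed.

End real_inversion.

Section complex_modulus.
Context {R : realType}.
Implicit Types z w : R[i].
Local Notation Re := (@complex.Re R).
Local Notation Im := (@complex.Im R).

Lemma cReD z w : Re (z + w) = Re z + Re w. Proof. by case: z => ? ?; case: w. Qed.
Lemma cImD z w : Im (z + w) = Im z + Im w. Proof. by case: z => ? ?; case: w. Qed.
Lemma cReN z : Re (- z) = - Re z. Proof. by case: z. Qed.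
Lemma cImN z : Im (- z) = - Im z. Proof. by case: z. Qed.
Lemma cReB z w : Re (z - w) = Re z - Re w. Proof. by rewrite cReD cReN. Qed.
Lemma cImB z w : Im (z - w) = Im z - Im w. Proof. by rewrite cImD cImN. Qed.
Lemma cReM z w : Re (z * w) = Re z * Re w - Im z * Im w.
Proof. by case: z => ? ?; case: w. Qed.
Lemma cImM z w : Im (z * w) = Re z * Im w + Im z * Re w.
Proof. by case: z => ? ?; case: w. Qed.

Lemma complex_ext z w : Re z = Re w -> Im z = Im w -> z = w.
Proof. by case: z => a b; case: w => a' b' /= -> ->. Qed.

Local Notation normc := Normc.normc.

Definition sqn z : R := Re z ^+ 2 + Im z ^+ 2.

Lemma sqn_ge0 z : 0 <= sqn z. Proof. by rewrite addr_ge0// sqr_ge0. Qed.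

Lemma normcE z : normc z = Num.sqrt (sqn z). Proof. by case: z. Qed.

Lemma normc_ge0 z : 0 <= normc z. Proof. by rewrite normcE sqrtr_ge0. Qed.

Lemma normc_sqr z : normc z ^+ 2 = sqn z.
Proof. by rewrite normcE sqr_sqrtr// sqn_ge0. Qed.

Lemma normcD z w : normc (z + w) <= normc z + normc w.
Proof. by have := ler_normD z w; rewrite !normc_def -rmorphD lecR -!/(sqn _) -!normcE. Qed.

Lemma normcN z : normc (- z) = normc z.
Proof. by rewrite !normcE /sqn cReN cImN !sqrrN. Qed.

Lemma normcB z w : normc (z - w) <= normc z + normc w.
Proof. by rewrite -(normcN w) normcD. Qed.

Lemma normc_sub z w : normc (z - w) = normc (w - z).
Proof. by rewrite -normcN opprB. Qed.

Lemma normc_dist z w : normc z - normc w <= normc (z - w).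
Proof. by rewrite lerBlDr -{1}(subrK w z) normcD. Qed.

Lemma Re_le_normc z : `|Re z| <= normc z.
Proof. by rewrite normcE -sqrtr_sqr ler_wsqrtr// lerDl sqr_ge0. Qed.

Lemma Im_le_normc z : `|Im z| <= normc z.
Proof. by rewrite normcE -sqrtr_sqr ler_wsqrtr// lerDr sqr_ge0. Qed.

Lemma normc_le z : normc z <= `|Re z| + `|Im z|.
Proof.
rewrite normcE -[leRHS]ger0_norm ?addr_ge0// -sqrtr_sqr ler_wsqrtr//.
rewrite /sqn -(real_normK (num_real (Re z))) -(real_normK (num_real (Im z))).
have : 0 <= `|Re z| by []; have : 0 <= `|Im z| by [].
move: `|Re z| `|Im z| => a b; nra.
Qed.

Lemma sqnM z w : sqn (z * w) = sqn z * sqn w.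
Proof. by rewrite /sqn cReM cImM; ring. Qed.

Lemma sqnD_le z w : sqn (z + w) <= 2 * sqn z + 2 * sqn w.
Proof.
rewrite /sqn cReD cImD.
have := sqr_ge0 (Re z - Re w); have := sqr_ge0 (Im z - Im w); nra.
Qed.

Lemma sqnN z : sqn (- z) = sqn z.
Proof. by rewrite /sqn cReN cImN !sqrrN. Qed.

Lemma sqn_eq0 z : sqn z = 0 -> z = 0.
Proof.
move=> /eqP; rewrite paddr_eq0 ?sqr_ge0// !sqrf_eq0 => /andP[/eqP a /eqP b].
exact: complex_ext.
Qed.

Lemma sqn0 : sqn 0 = 0. Proof. by rewrite /sqn /= expr0n addr0. Qed.

End complex_modulus.

(** * The complex Fourier transform on Schwartz functions *)

Section complex_fourier.
Context {R : realType} {n : nat}.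
Local Notation Rn := 'rV[R]_n.
Local Notation LT := (lebesgueType R n).
Local Notation leb := (@leb R n).
Local Notation A := (@cosft R n 0).
Local Notation B := (@cosft R n (- (pi / 2))).
Local Notation c := (@fourier_cst R n).
Local Notation Re := (@complex.Re R).
Local Notation Im := (@complex.Im R).
Local Notation normc := Normc.normc.
Implicit Types (u v w : Rn -> R[i]).

(** The square of the L2 norm. Without the root the triangle inequality costs a factor 2 on each
    term, which is the source of constants such as 4, 16 and 64 further on. *)
Definition norm2 u : \bar R := lint leb (fun x : LT => sqn (u x)).

(** Equivalent to the L1 norm of the modulus up to a factor 2. *)
Definition norm1 u : R := rint leb (fun x : LT => `|Re (u x)| + `|Im (u x)|).

Definition cL1 u := L1 leb (fun x : LT => Re (u x)) /\ L1 leb (fun x : LT => Im (u x)).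

Lemma Re_fourier u xi : cL1 u -> Re (schwartz_fourier u xi) =
  A (fun x => Re (u x)) xi + B (fun x => Im (u x)) xi.
Proof.
move=> [u1 u2]; rewrite /= /cosft -rintD; [|exact: L1_wave|exact: L1_wave].
apply: rint_ext => x; rewrite cReM /= cosN sinN cosBpihalf addr0.
by rewrite mulrN opprK.
Qed.

Lemma Im_fourier u xi : cL1 u -> Im (schwartz_fourier u xi) =
  A (fun x => Im (u x)) xi - B (fun x => Re (u x)) xi.
Proof.
move=> [u1 u2]; rewrite /= /cosft -rintB; [|exact: L1_wave|exact: L1_wave].
apply: rint_ext => x; rewrite cImM /= cosN sinN cosBpihalf addr0.
by rewrite mulrN addrC.
Qed.

Lemma schwartz_cL1 u : schwartz u -> cL1 u.
Proof. by move=> [Sr Si]; split; exact: schwartz_L1. Qed.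

Lemma schwartz_sub u v : schwartz u -> schwartz v -> schwartz (u - v).
Proof.
move=> [ur ui] [vr vi]; split.
- rewrite (_ : (fun x => _) = (fun x => Re (u x) - Re (v x))); first exact: schwartzB.
  by apply/funext => x; rewrite -cReB.
- rewrite (_ : (fun x => _) = (fun x => Im (u x) - Im (v x))); first exact: schwartzB.
  by apply/funext => x; rewrite -cImB.
Qed.

Lemma Re_fourier_fun u : cL1 u -> (fun xi => Re (schwartz_fourier u xi)) =
  (fun xi => A (fun x => Re (u x)) xi + B (fun x => Im (u x)) xi).
Proof. by move=> u1; apply/funext => xi; exact: Re_fourier. Qed.

Lemma Im_fourier_fun u : cL1 u -> (fun xi => Im (schwartz_fourier u xi)) =
  (fun xi => A (fun x => Im (u x)) xi - B (fun x => Re (u x)) xi).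
Proof. by move=> u1; apply/funext => xi; exact: Im_fourier. Qed.

Lemma schwartz_fourier_schwartz u : schwartz u -> schwartz (schwartz_fourier u).
Proof.
move=> Su; have u1 := schwartz_cL1 Su; case: Su => Sr Si; split.
- by rewrite Re_fourier_fun//; apply: schwartzD; exact: schwartz_cosft.
- by rewrite Im_fourier_fun//; apply: schwartzB; exact: schwartz_cosft.
Qed.

Lemma schwartz_fourierB u v : cL1 u -> cL1 v ->
  schwartz_fourier (u - v) = schwartz_fourier u - schwartz_fourier v.
Proof.
move=> u1 v1.
have uv1 : cL1 (u - v).
  split.
    by apply: L1_ext (L1B u1.1 v1.1) => x; rewrite -cReB.
  by apply: L1_ext (L1B u1.2 v1.2) => x; rewrite -cImB.
have E th (p q : Rn -> R) xi : L1 leb p -> L1 leb q ->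
    cosft th (fun x => p x - q x) xi = cosft th p xi - cosft th q xi.
  move=> p1 q1; rewrite -[- cosft _ q xi]mulN1r -cosftZ// -cosftD//.
    by rewrite /cosft; apply: rint_ext => x; rewrite mulN1r.
  exact: L1Z.
have rE : (fun x => Re ((u - v) x)) = (fun x => Re (u x) - Re (v x)).
  by apply/funext => x; rewrite -cReB.
have iE : (fun x => Im ((u - v) x)) = (fun x => Im (u x) - Im (v x)).
  by apply/funext => x; rewrite -cImB.
case: u1 => ur ui; case: v1 => vr vi.
apply/funext => xi; apply: complex_ext.
- by rewrite Re_fourier// cReB !Re_fourier// rE iE !E//; ring.
- by rewrite Im_fourier// cImB !Im_fourier// rE iE !E//; ring.
Qed.

Lemma norm2_fourier u : schwartz u -> norm2 (schwartz_fourier u) = (c%:E * norm2 u)%E.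
Proof.
move=> Su; have u1 := schwartz_cL1 Su.
have SF := schwartz_fourier_schwartz Su.
have sq v : schwartz v -> L1 leb (fun x : LT => sqn (v x)).
  by move=> [vr vi]; apply: L1D; apply: schwartzM_L1.
case: (Su) => Sr Si.
rewrite /norm2 !lintE; [|exact: sq|exact: sq]; rewrite -EFinM; congr EFin.
pose ur (x : Rn) := Re (u x); pose ui (x : Rn) := Im (u x).
have SA th (f : Rn -> R) := @schwartz_cosft R n th f.
have M1 f g := @schwartzM_L1 R n f g.
transitivity (rint leb (fun x : LT => A ur x * A ur x + B ur x * B ur x) +
   rint leb (fun x : LT => A ui x * A ui x + B ui x * B ui x) +
   2 * (rint leb (fun x : LT => A ur x * B ui x) - rint leb (fun x : LT => B ur x * A ui x))).
  rewrite -rintB; [|by apply: M1; exact: SA|by apply: M1; exact: SA].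
  rewrite -rintZ; last by apply: L1B; apply: M1; exact: SA.
  rewrite -rintD; [|by apply: L1D; apply: M1; exact: SA|by apply: L1D; apply: M1; exact: SA].
  rewrite -rintD; last 2 first.
  - by apply: L1D; apply: L1D; apply: M1; exact: SA.
  - by apply: L1Z; apply: L1B; apply: M1; exact: SA.
  apply: rint_ext => x; rewrite /sqn Re_fourier// Im_fourier//= -/ur -/ui; ring.
rewrite cosft_cross// subrr mulr0 addr0 !cosft_plancherel// -mulrDr -rintD; [|exact: M1|exact: M1].
by congr (_ * _); apply: rint_ext.
Qed.

(** An explicit inverse, to be identified with the preimage that [schwartz_ifourier] obtains by
    choice. *)
Definition fourier_inverse v (x : Rn) : R[i] :=
  Complex (c^-1 * Re (schwartz_fourier v (- x))) (c^-1 * Im (schwartz_fourier v (- x))).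

Lemma schwartz_opp (f : Rn -> R) : real_schwartz f -> real_schwartz (fun x => f (- x)).
Proof.
move=> Sf; have N10 : (-1 : R) != 0 by rewrite oppr_eq0 oner_neq0.
have := schwartz_affine 0 N10 Sf.
rewrite (_ : (fun x => _) = (fun x => f (- x)))//.
by apply/funext => x; rewrite addr0 scaleN1r.
Qed.

Lemma fourier_inverse_schwartz v : schwartz v -> schwartz (fourier_inverse v).
Proof.
move=> Sv; have [Fr Fi] := schwartz_fourier_schwartz Sv; split.
- by rewrite /fourier_inverse /=; apply: schwartzZ; exact: schwartz_opp Fr.
- by rewrite /fourier_inverse /=; apply: schwartzZ; exact: schwartz_opp Fi.
Qed.

Lemma cosft_even (f : Rn -> R) x : A f (- x) = A f x.
Proof.
apply: rint_ext => y; congr (_ * _).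
by rewrite !addr0 dotNr cosN.
Qed.

Lemma cosft_odd (f : Rn -> R) x : L1 leb f -> B f (- x) = - B f x.
Proof.
move=> f1; rewrite /cosft -rintN; last exact: L1_wave.
apply: rint_ext => y /=; rewrite -[RHS]mulrN; congr (_ * _).
by rewrite dotNr -opprD cosN cosDpihalf cosBpihalf.
Qed.

(** In each part the terms A A + B B give c times that part, and the mixed terms cancel because A
    and B commute. *)
Lemma schwartz_fourier_inverseK v : schwartz v -> schwartz_fourier (fourier_inverse v) = v.
Proof.
move=> Sv; have v1 := schwartz_cL1 Sv; case: (Sv) => Sr Si.
have c0 : c != 0 by rewrite gt_eqF// fourier_cst_gt0.
have i1 := schwartz_cL1 (fourier_inverse_schwartz Sv).
pose vr (x : Rn) := Re (v x); pose vi (x : Rn) := Im (v x).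
have SAr := schwartz_L1 (schwartz_cosft 0 Sr).
have SBr := schwartz_L1 (schwartz_cosft (- (pi / 2)) Sr).
have SAi := schwartz_L1 (schwartz_cosft 0 Si).
have SBi := schwartz_L1 (schwartz_cosft (- (pi / 2)) Si).
have rE : (fun x => Re (fourier_inverse v x)) =
    (fun x => c^-1 * (A vr x + -1 * B vi x)).
  apply/funext => x; rewrite -[LHS]/(c^-1 * Re (schwartz_fourier v (- x))).
  rewrite Re_fourier// cosft_even cosft_odd ?mulN1r//; exact: schwartz_L1.
have iE : (fun x => Im (fourier_inverse v x)) =
    (fun x => c^-1 * (A vi x + B vr x)).
  apply/funext => x; rewrite -[LHS]/(c^-1 * Im (schwartz_fourier v (- x))).
  rewrite Im_fourier// cosft_even cosft_odd ?opprK//; exact: schwartz_L1.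
have E1 th xi : cosft th (fun x => c^-1 * (A vr x + -1 * B vi x)) xi =
    c^-1 * (cosft th (A vr) xi - cosft th (B vi) xi).
  by rewrite cosftZ; [rewrite cosftD//; [rewrite cosftZ// mulN1r|exact: L1Z]|
    apply: L1D => //; exact: L1Z].
have E2 th xi : cosft th (fun x => c^-1 * (A vi x + B vr x)) xi =
    c^-1 * (cosft th (A vi) xi + cosft th (B vr) xi).
  by rewrite cosftZ; [rewrite cosftD|apply: L1D].
have alg1 (x y z w : R) : y = z -> x - y + (z + w) = x + w by move=> ->; ring.
have alg2 (x y z w : R) : y = z -> x + y - (z - w) = x + w by move=> ->; ring.
apply/funext => xi; apply: complex_ext.
- rewrite Re_fourier// rE iE E1 E2.
  rewrite -mulrDr; apply: (canLR (mulKf c0)); apply: etrans (cosft_inv xi Sr).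
  exact: alg1 (cosft_comm xi Si).
- rewrite Im_fourier// rE iE E1 E2.
  rewrite -mulrBr; apply: (canLR (mulKf c0)); apply: etrans (cosft_inv xi Si).
  exact: alg2 (cosft_comm xi Sr).
Qed.

(** A left inverse from the right inverse: the difference w of the two sides has transform 0. Hence
    [fourier_inverse w], a reflected multiple of that transform, is 0 as well, and w is the
    transform of it. *)
Lemma schwartz_fourierK u : schwartz u -> fourier_inverse (schwartz_fourier u) = u.
Proof.
move=> Su; have SI := fourier_inverse_schwartz (schwartz_fourier_schwartz Su).
have c0 : c != 0 by rewrite gt_eqF// fourier_cst_gt0.
pose w := fourier_inverse (schwartz_fourier u) - u.
have Sw : schwartz w by exact: schwartz_sub.
have Fw : schwartz_fourier w = 0.
  rewrite schwartz_fourierB; [|exact: schwartz_cL1|exact: schwartz_cL1].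
  by rewrite schwartz_fourier_inverseK ?subrr//; exact: schwartz_fourier_schwartz.
apply/subr0_eq; rewrite -/w -(schwartz_fourier_inverseK Sw).
have -> : fourier_inverse w = 0.
  apply/funext => x; rewrite /fourier_inverse Fw.
  by apply: complex_ext; rewrite /= mulr0.
apply/funext => x; apply: complex_ext.
- rewrite Re_fourier; last by split; exact: integrable0.
  by rewrite /cosft !(rint_ext leb (g := fun=> 0)) => [|y|y];
    rewrite ?mul0r// /rint /Rintegral integral0 addr0.
- rewrite Im_fourier; last by split; exact: integrable0.
  by rewrite /cosft !(rint_ext leb (g := fun=> 0)) => [|y|y];
    rewrite ?mul0r// /rint /Rintegral integral0 subr0.
Qed.

(** The chosen preimage is unique because the transform is injective on Schwartz functions. *)
Lemma schwartz_ifourierE v : schwartz v -> schwartz_ifourier v = fourier_inverse v.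
Proof.
move=> Sv; rewrite /schwartz_ifourier.
case: xgetP => [w _ [Sw Fw]|/(_ (fourier_inverse v))[]].
  by rewrite -Fw schwartz_fourierK.
by split; [exact: fourier_inverse_schwartz|exact: schwartz_fourier_inverseK].
Qed.

Lemma schwartz_ifourier_schwartz v : schwartz v -> schwartz (schwartz_ifourier v).
Proof. by move=> Sv; rewrite schwartz_ifourierE//; exact: fourier_inverse_schwartz. Qed.

Lemma schwartz_ifourierB u v : schwartz u -> schwartz v ->
  schwartz_ifourier (u - v) = schwartz_ifourier u - schwartz_ifourier v.
Proof.
move=> Su Sv; rewrite !schwartz_ifourierE//; last exact: schwartz_sub.
have [I1 I2] := (fourier_inverse_schwartz Su, fourier_inverse_schwartz Sv).
rewrite -[RHS]schwartz_fourierK; last exact: schwartz_sub.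
rewrite schwartz_fourierB; [|exact: schwartz_cL1|exact: schwartz_cL1].
by rewrite !schwartz_fourier_inverseK.
Qed.

Lemma norm2_ifourier v : schwartz v -> norm2 (schwartz_ifourier v) = (c^-1%:E * norm2 v)%E.
Proof.
move=> Sv; rewrite schwartz_ifourierE//.
have c0 : c != 0 by rewrite gt_eqF// fourier_cst_gt0.
have := norm2_fourier (fourier_inverse_schwartz Sv).
rewrite schwartz_fourier_inverseK// => ->.
by rewrite muleA -EFinM mulVf// mul1e.
Qed.

Lemma fourier_le u xi : cL1 u -> normc (schwartz_fourier u xi) <= 2 * norm1 u.
Proof.
move=> u1; apply: le_trans (normc_le _) _.
rewrite Re_fourier// Im_fourier//; case: u1 => ur ui.
rewrite /norm1 rintD; [|exact: L1_norm|exact: L1_norm].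
set a := rint _ _; set b := rint _ _.
have h1 := cosft_le 0 xi ur; have h2 := cosft_le (- (pi / 2)) xi ur.
have h3 := cosft_le 0 xi ui; have h4 := cosft_le (- (pi / 2)) xi ui.
have := ler_normD (A (fun x => Re (u x)) xi) (B (fun x => Im (u x)) xi).
have := ler_normB (A (fun x => Im (u x)) xi) (B (fun x => Re (u x)) xi).
move: h1 h2 h3 h4; rewrite -/a -/b; lra.
Qed.

Lemma ifourier_le v x : schwartz v ->
  normc (schwartz_ifourier v x) <= 2 * c^-1 * norm1 v.
Proof.
move=> Sv; rewrite schwartz_ifourierE//.
have h := fourier_le (- x) (schwartz_cL1 Sv).
have c0 := @fourier_cst_gt0 R n.
have -> : normc (fourier_inverse v x) = c^-1 * normc (schwartz_fourier v (- x)).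
  rewrite !normcE -[fourier_inverse v x]/(Complex (c^-1 * Re (schwartz_fourier v (- x)))
    (c^-1 * Im (schwartz_fourier v (- x)))).
  move: (schwartz_fourier v (- x)) => z.
  have -> : sqn (Complex (c^-1 * Re z) (c^-1 * Im z)) = c^-1 ^+ 2 * sqn z.
    by rewrite /sqn /= !exprMn mulrDr.
  by rewrite sqrtrM ?sqr_ge0// sqrtr_sqr ger0_norm// invr_ge0 ltW.
by rewrite mulrAC mulrC ler_pM2r ?invr_gt0.
Qed.

End complex_fourier.

Arguments norm2 {R n} u%_ring_scope.

(** * Density of the Schwartz functions *)

Lemma ecvg0_le {R : realType} (u : nat -> \bar R) : u @ \oo --> 0%E ->
  forall e : R, 0 < e -> \forall k \near \oo, (u k <= e%:E)%E.
Proof.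
move=> uc e e0; have /uc : nbhs (0%E : \bar R) [set x | (x < e%:E)%E].
  apply: open_nbhs_nbhs; split; first exact: open_ereal_lt_ereal.
  by rewrite /= lte_fin.
by move=> [N _ hN]; exists N => // k /hN /ltW.
Qed.

Lemma ecvg0P {R : realType} (u : nat -> \bar R) : (forall k, 0 <= u k)%E ->
  (forall e : R, 0 < e -> \forall k \near \oo, (u k <= e%:E)%E) -> u @ \oo --> 0%E.
Proof.
move=> u0 hu.
have fu (e : R) k : (u k <= e%:E)%E -> u k \is a fin_num.
  by move=> uk; rewrite ge0_fin_numE//; exact: le_lt_trans uk (ltry _).
apply/fine_cvgP; split.
  by near=> k; apply: (fu 1); near: k; exact: hu.
apply/cvgrPdist_le => e e0; near=> k.
have uk : (u k <= e%:E)%E by near: k; exact: hu.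
rewrite sub0r normrN ger0_norm ?fine_ge0//.
by rewrite -lee_fin fineK//; exact: fu uk.
Unshelve. all: by end_near. Qed.

Lemma flat_exp0_le1 {R : realType} (t : R) : flat_exp 0 t <= 1.
Proof. by apply: le_trans (flat_exp_le _ _) _; rewrite expr0. Qed.

Lemma flat_exp_cvg {R : realType} (u : nat -> R) :
  (forall c : R, \forall k \near \oo, c < u k) ->
  (fun k => flat_exp 0 (u k)) @ \oo --> (1 : R).
Proof.
move=> hu; apply/cvgrPdist_lt => e e0; near=> k.
have uk : e^-1 < u k by near: k; exact: hu.
have u0 : 0 < u k by apply: lt_trans uk; rewrite invr_gt0.
rewrite ger0_norm ?subr_ge0 ?flat_exp0_le1//.
rewrite /flat_exp u0 expr0 invr1 mul1r.
apply: (@le_lt_trans _ _ ((u k)^-1)).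
  have := expR_ge1Dx (- (u k)^-1); lra.
by rewrite invf_plt ?posrE.
Unshelve. all: by end_near. Qed.

Section density.
Context {R : realType} {n : nat}.
Local Notation Rn := 'rV[R]_n.
Local Notation LT := (lebesgueType R n).
Local Notation leb := (@leb R n).
Local Notation T := (measurableTypeR R).
Implicit Types (f g h : Rn -> R).

(** Both norms at once: L1 controls the inverse transform pointwise, L2 controls the extended
    operators. *)
Definition near12 f g (e : R) := (lint leb (fun x : LT => `|f x - g x|)%R <= e%:E)%E /\
  (lint leb (fun x : LT => (f x - g x) ^+ 2)%R <= e%:E)%E.

Lemma near12_trans f g h e : rmeas (f : LT -> R) -> rmeas (g : LT -> R) ->
  rmeas (h : LT -> R) -> near12 f g e -> near12 g h e -> near12 f h (4 * e).
Proof.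
move=> mf mg mh [fg1 fg2] [gh1 gh2].
have mfg := rmeasB mf mg; have mgh := rmeasB mg mh; have mfh := rmeasB mf mh.
have e0 : 0 <= e by rewrite -lee_fin; apply: le_trans fg1; apply: lint_ge0.
split.
- apply: (@le_trans _ _ (lint leb (fun x : LT => `|f x - g x| + `|g x - h x|))).
    apply: lint_le.
    + exact: rmeas_norm.
    + by apply: rmeasD; exact: rmeas_norm.
    + by [].
    + by move=> x; apply: le_trans (ler_normD _ _); rewrite subrKA.
  rewrite lintD; [|exact: rmeas_norm|exact: rmeas_norm|by []|by []].
  apply: le_trans (leeD fg1 gh1) _; rewrite -EFinD lee_fin; lra.
- apply: (@le_trans _ _ (lint leb (fun x : LT => 2 * (f x - g x) ^+ 2 +
      2 * (g x - h x) ^+ 2))).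
    apply: lint_le.
    + exact: rmeasX.
    + by apply: rmeasD; apply: rmeasM (rmeas_cst _) _; exact: rmeasX.
    + by move=> x; exact: sqr_ge0.
    + move=> x; have := sqr_ge0 ((f x - g x) - (g x - h x)); nra.
  have m1 : rmeas (fun x : LT => (f x - g x) ^+ 2) by exact: rmeasX.
  have m2 : rmeas (fun x : LT => (g x - h x) ^+ 2) by exact: rmeasX.
  rewrite lintD; [|exact: rmeasM (rmeas_cst _) _|exact: rmeasM (rmeas_cst _) _|
    by move=> x; rewrite mulr_ge0// sqr_ge0|by move=> x; rewrite mulr_ge0// sqr_ge0].
  rewrite !lintZ//; try by move=> x; exact: sqr_ge0.
  apply: (@le_trans _ _ (2%:E * e%:E + 2%:E * e%:E)%E).
    by apply: leeD; rewrite lee_pmul2l.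
  by rewrite -!EFinM -EFinD lee_fin; lra.
Qed.

Definition approximable f := rmeas (f : LT -> R) /\
  forall e, 0 < e -> exists2 g, real_schwartz g & near12 f g e.

Lemma near12_refl f e : 0 <= e -> near12 f f e.
Proof.
move=> e0; split.
- rewrite (_ : lint _ _ = 0%E) ?lee_fin//.
  by apply: integral0_eq => x _; rewrite subrr normr0.
- rewrite (_ : lint _ _ = 0%E) ?lee_fin//.
  by apply: integral0_eq => x _; rewrite subrr expr0n.
Qed.

Lemma approximable_schwartz f : real_schwartz f -> approximable f.
Proof.
move=> Sf; split; first exact: schwartz_rmeas.
by move=> e e0; exists f => //; apply: near12_refl; exact: ltW.
Qed.

Lemma approximable_lim f : rmeas (f : LT -> R) ->
  (forall e, 0 < e -> exists2 g, approximable g & near12 f g e) -> approximable f.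
Proof.
move=> mf H; split => // e e0; have e4 : 0 < e / 4 by rewrite divr_gt0.
have [g [mg /(_ _ e4)[h Sh gh]] fg] := H _ e4; exists h => //.
have -> : e = 4 * (e / 4) by field.
exact: near12_trans mf mg (schwartz_rmeas Sh) fg gh.
Qed.

Lemma lint_sqrD g h : rmeas (g : LT -> R) -> rmeas (h : LT -> R) ->
  (lint leb (fun x : LT => (g x + h x) ^+ 2)%R <=
   2%:E * lint leb (fun x : LT => g x ^+ 2)%R + 2%:E * lint leb (fun x : LT => h x ^+ 2)%R)%E.
Proof.
move=> mg mh.
have m1 := rmeasX 2 mg; have m2 := rmeasX 2 mh.
have p (k : LT -> R) x : 0 <= 2 * k x ^+ 2 by rewrite mulr_ge0// sqr_ge0.
rewrite -!lintZ//; try by move=> x; exact: sqr_ge0.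
rewrite -lintD//; try exact: rmeasM (rmeas_cst _) _.
apply: lint_le.
- by apply: rmeasX; exact: rmeasD.
- by apply: rmeasD; apply: rmeasM (rmeas_cst _) _.
- by move=> x; exact: sqr_ge0.
- move=> x; have := sqr_ge0 (g x - h x); nra.
Qed.

Lemma approximable_L1 f : approximable f ->
  L1 leb f /\ L1 leb (fun x : LT => f x ^+ 2).
Proof.
move=> [mf /(_ 1 ltr01)[g Sg [fg1 fg2]]].
have mg := schwartz_rmeas Sg; have mfg := rmeasB mf mg.
have fgE : f = (fun x => (f x - g x) + g x) by apply/funext => x; rewrite subrK.
split.
  rewrite fgE; apply: L1D (schwartz_L1 Sg); apply/L1P; split => //.
  exact: le_lt_trans fg1 (ltry _).
apply/L1P; split; first exact: rmeasX.
rewrite (_ : (fun x => _) = (fun x : LT => ((f x - g x) + g x) ^+ 2)); last first.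
  by apply/funext => x; rewrite subrK ger0_norm// sqr_ge0.
apply: le_lt_trans (lint_sqrD mfg mg) _; apply: lte_add_pinfty.
  by rewrite lte_mul_pinfty//; exact: le_lt_trans fg2 (ltry _).
rewrite lte_mul_pinfty//.
rewrite lintE ?ltry//; apply: L1_ext (schwartzM_L1 Sg Sg) => x.
by rewrite expr2.
Qed.

(** Dominated convergence in L1 and in L2 together, with a dominating function that lies in both. *)
Lemma approximable_dct (h : nat -> Rn -> R) f (F : Rn -> R) :
  (forall k, approximable (h k)) -> (forall x, h ^~ x @ \oo --> f x) ->
  (forall k x, `|h k x| <= F x) -> L1 leb F -> L1 leb (fun x : LT => F x ^+ 2) ->
  approximable f.
Proof.
move=> hV hf hF F1 F2.
have mh k : rmeas (h k : LT -> R) by exact: (hV k).1.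
have mf : rmeas (f : LT -> R) by exact: rmeas_cvg mh hf.
have fF x : `|f x| <= F x.
  have cn : (fun k => `|h k x|) @ \oo --> `|f x| by apply: cvg_norm; exact: hf.
  apply: (@closed_cvg _ _ \oo _ (fun k => `|h k x|) [set y | y <= F x] _ _ _ cn).
    exact: closed_le.
  by apply: nearW => k; exact: hF.
have d0 x : (fun k => `|f x - h k x|) @ \oo --> (0 : R).
  rewrite -(normr0 R) -(subrr (f x)); apply: cvg_norm.
  by apply: cvgB; [exact: cvg_cst|exact: hf].
have dF k x : `|f x - h k x| <= 2 * F x.
  apply: le_trans (ler_normB _ _) _; have := fF x; have := hF k x; lra.
apply: approximable_lim => // e e0.
have c1 : (fun k => lint leb (fun x : LT => `|f x - h k x|)) @ \oo --> 0%E.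
  apply: (lint_dct0 (g := fun x : LT => 2 * F x)) => //.
  - by move=> k; apply: rmeas_norm; exact: rmeasB.
  - exact: L1Z.
  - by move=> k x; rewrite normr_ge0 dF.
have c2 : (fun k => lint leb (fun x : LT => (f x - h k x) ^+ 2)) @ \oo --> 0%E.
  apply: (lint_dct0 (g := fun x : LT => 4 * F x ^+ 2)) => //.
  - by move=> k; apply: rmeasX; exact: rmeasB.
  - move=> x; rewrite (_ : (fun k => _) = (fun k => `|f x - h k x| * `|f x - h k x|)).
      by rewrite -(mulr0 0); apply: cvgM; exact: d0.
    by apply/funext => k; rewrite -normrM -expr2 ger0_norm// sqr_ge0.
  - exact: L1Z.
  - move=> k x; rewrite sqr_ge0/= -(real_normK (num_real (f x - _))).
    have -> : 4 * F x ^+ 2 = (2 * F x) ^+ 2 by ring.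
    by rewrite lerXn2r ?nnegrE// (le_trans _ (dF k x)).
near \oo => k; exists (h k) => //; split.
- by near: k; exact: ecvg0_le c1 _ e0.
- by near: k; exact: ecvg0_le c2 _ e0.
Unshelve. all: by end_near. Qed.

End density.

Import HBNNSimple.

(** * Approximation of indicators and of general integrable functions *)

Section density_sets.
Context {R : realType} {n : nat}.
Local Notation Rn := 'rV[R]_n.
Local Notation LT := (lebesgueType R n).
Local Notation leb := (@leb R n).
Local Notation T := (measurableTypeR R).
Implicit Types (f g h : Rn -> R) (B : set Rn).

Lemma near12_addr f g h e : near12 f g e -> near12 (fun x => f x + h x) (fun x => g x + h x) e.
Proof.
move=> [h1 h2]; have E x : f x + h x - (g x + h x) = f x - g x by ring.
split.
- rewrite (_ : (fun x => _) = (fun x : LT => `|f x - g x|))//.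
  by apply/funext => x; rewrite E.
- rewrite (_ : (fun x => _) = (fun x : LT => (f x - g x) ^+ 2))//.
  by apply/funext => x; rewrite E.
Qed.

Lemma approximableD f g : approximable f -> approximable g ->
  approximable (fun x => f x + g x).
Proof.
move=> [mf Hf] [mg Hg]; split; first exact: rmeasD.
move=> e e0; have e4 : 0 < e / 4 by rewrite divr_gt0.
have [f' Sf ff'] := Hf _ e4; have [g' Sg gg'] := Hg _ e4.
have mf' := schwartz_rmeas Sf; have mg' := schwartz_rmeas Sg.
exists (fun x => f' x + g' x); first exact: schwartzD.
have -> : e = 4 * (e / 4) by field.
apply: (@near12_trans _ _ _ (fun x => f' x + g x)).
- exact: rmeasD.
- exact: rmeasD.
- exact: rmeasD.
- exact: near12_addr.
- have := near12_addr f' gg'.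
  by under eq_fun do rewrite addrC; under [X in near12 _ X _]eq_fun do rewrite addrC.
Qed.

Lemma approximable_mul s f : slow s -> (forall x, `|s x| <= 1) -> approximable f ->
  approximable (fun x => s x * f x).
Proof.
move=> ss s1 [mf Hf].
have ms : rmeas (s : LT -> R) by exact/rmeas_continuous/diffble_continuous/slow_diffble.
split; first exact: rmeasM.
move=> e e0; have [g Sg [fg1 fg2]] := Hf e e0; have mg := schwartz_rmeas Sg.
exists (fun x => s x * g x); first exact: schwartz_slowM.
have le1 x : `|s x * f x - s x * g x| <= `|f x - g x|.
  by rewrite -mulrBr normrM ler_piMl.
split.
- apply: le_trans fg1; apply: lint_le => //.
  + by apply: rmeas_norm; apply: rmeasB; exact: rmeasM.
  + by apply: rmeas_norm; exact: rmeasB.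
- apply: le_trans fg2; apply: lint_le.
  + by apply: rmeasX; apply: rmeasB; exact: rmeasM.
  + by apply: rmeasX; exact: rmeasB.
  + by move=> x; exact: sqr_ge0.
  + move=> x; rewrite -[leLHS]real_normK ?num_real// -[leRHS]real_normK ?num_real//.
    by rewrite lerXn2r ?nnegrE.
Qed.

Lemma approximableZ (c : R) f : approximable f -> approximable (fun x => c * f x).
Proof.
move=> [mf Hf]; split; first exact: rmeasM (rmeas_cst c) mf.
move=> e e0; pose d := 1 + `|c| + c ^+ 2.
have d0 : 0 < d by rewrite /d -addrA ltr_pwDl// addr_ge0// sqr_ge0.
have [g Sg [fg1 fg2]] := Hf (e / d) (divr_gt0 e0 d0); have mg := schwartz_rmeas Sg.
have mfg := rmeasB mf mg.
exists (fun x => c * g x); first exact: schwartzZ.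
split.
- rewrite (_ : (fun x => _) = (fun x : LT => `|c| * `|f x - g x|)); last first.
    by apply/funext => x; rewrite -mulrBr normrM.
  rewrite lintZ//; last exact: rmeas_norm.
  apply: (@le_trans _ _ (`|c|%:E * (e / d)%:E)%E); first by apply: lee_wpmul2l; rewrite ?lee_fin.
  rewrite -EFinM lee_fin mulrA ler_pdivrMr// mulrC ler_pM2l//.
  by rewrite /d; have := sqr_ge0 c; lra.
- rewrite (_ : (fun x => _) = (fun x : LT => c ^+ 2 * (f x - g x) ^+ 2)); last first.
    by apply/funext => x; rewrite -mulrBr exprMn.
  have p x : 0 <= (f x - g x) ^+ 2 by exact: sqr_ge0.
  rewrite lintZ ?sqr_ge0//; last exact: rmeasX.
  apply: (@le_trans _ _ ((c ^+ 2)%:E * (e / d)%:E)%E).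
    by apply: lee_wpmul2l => //; rewrite lee_fin sqr_ge0.
  rewrite -EFinM lee_fin mulrA ler_pdivrMr// mulrC ler_pM2l//.
  by rewrite /d; have : 0 <= `|c| by []; lra.
Qed.

Lemma approximableB f g : approximable f -> approximable g ->
  approximable (fun x => f x - g x).
Proof.
move=> Hf /(approximableZ (-1)) Hg.
have := approximableD Hf Hg; rewrite (_ : (fun x => _) = (fun x => f x - g x))//.
by apply/funext => x; rewrite mulN1r.
Qed.

(* Half-spaces are cut sets, as limits of flat_exp 0 (k (x_i - a)); complements
   and countable unions then give all Borel sets. *)
Definition cut_set B := forall f, approximable f -> approximable (fun x => \1_B x * f x).

(** Multipliers of modulus at most 1 that converge pointwise to the indicator; |f| is the dominating
    function. *)
Lemma approximable_cut_lim (s : nat -> Rn -> R) B f :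
  (forall k, approximable (fun x => s k x * f x)) ->
  (forall k x, `|s k x| <= 1) -> (forall x, s ^~ x @ \oo --> (\1_B x : R)) ->
  L1 leb f -> L1 leb (fun x : LT => f x ^+ 2) ->
  approximable (fun x => \1_B x * f x).
Proof.
move=> Hs s1 sB f1 f2.
apply: (@approximable_dct _ _ (fun k x => s k x * f x) _ (fun x => `|f x|)) => //.
- by move=> x; apply: cvgM; [exact: sB|exact: cvg_cst].
- by move=> k x; rewrite normrM ler_piMl.
- exact: L1_norm.
- by apply: L1_ext f2 => x; rewrite real_normK// num_real.
Qed.

Lemma cut_setC B : cut_set B -> cut_set (~` B).
Proof.
move=> HB f Hf; rewrite (_ : (fun x => _) = (fun x => f x - \1_B x * f x)).
  by apply: approximableB => //; exact: HB.
apply/funext => x; rewrite !indicE in_setC.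
by case: (x \in B); rewrite ?mul0r ?mul1r ?subrr ?subr0.
Qed.

Lemma cut_set0 : cut_set set0.
Proof.
move=> f Hf; rewrite (_ : (fun x => _) = fun=> 0).
  exact/approximable_schwartz/schwartz0.
by apply/funext => x; rewrite indic0 mul0r.
Qed.

Lemma cut_setU B C : cut_set B -> cut_set C -> cut_set (B `|` C).
Proof.
move=> HB HC; rewrite -(setCK (B `|` C)) setCU; apply: cut_setC => f Hf.
rewrite (_ : (fun x => _) = (fun x => \1_(~` B) x * (\1_(~` C) x * f x))).
  by apply: cut_setC => //; apply: cut_setC.
by apply/funext => x; rewrite indicI /= mulrA.
Qed.

Lemma cut_set_bigcup (F : nat -> set Rn) : (forall k, cut_set (F k)) ->
  cut_set (\bigcup_k F k).
Proof.
move=> HF f Hf; have [f1 f2] := approximable_L1 Hf.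
pose U k := \big[setU/set0]_(i < k) F i.
have HU k : cut_set (U k).
  rewrite /U; elim: k => [|k ih]; first by rewrite big_ord0; exact: cut_set0.
  by rewrite big_ord_recr/=; exact: cut_setU.
apply: (@approximable_cut_lim (fun k => \1_(U k))) => //.
- by move=> k; exact: HU.
- by move=> k x; rewrite indicE; case: (_ \in _); rewrite /= ?normr1 ?normr0.
move=> x; rewrite indicE; case: (boolP (x \in _)) => [|xF].
  rewrite inE => -[j _ Fj]; apply: cvg_near_cst; exists j.+1 => //= k jk.
  rewrite indicE mem_set// /U -bigcup_mkord; exists j => //.
apply: cvg_near_cst; apply: nearW => k.
rewrite indicE memNset// /U -bigcup_mkord => -[j _ Fj].
by move/negP : xF; apply; rewrite inE; exists j.
Qed.

Lemma cut_set_halfspace (i : 'I_n) (a : R) : cut_set [set x | a < x ord0 i].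
Proof.
move=> f Hf; have [f1 f2] := approximable_L1 Hf.
apply: (@approximable_cut_lim (fun k x => flat_exp 0 (k%:R * (x ord0 i - a)))) => //.
- move=> k; apply: approximable_mul => //.
    apply: slow_flat; apply: slowM; first exact: slow_cst.
    by apply: slowD; [exact: slow_coord|exact: slow_cst].
  by move=> x; rewrite ger0_norm ?flat_exp_ge0// flat_exp0_le1.
- by move=> k x; rewrite ger0_norm ?flat_exp_ge0// flat_exp0_le1.
move=> x; rewrite indicE; case: (boolP (x \in _)).
  rewrite inE/= -subr_gt0 => t0; apply: flat_exp_cvg => c; near=> k.
  rewrite -ltr_pdivrMr//; near: k; exact: nbhs_infty_gtr.
rewrite notin_setE /= => /negP; rewrite -leNgt -subr_le0 => t0.
apply: cvg_near_cst; apply: nearW => k.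
by rewrite /flat_exp ifF//; apply/negbTE; rewrite -leNgt mulr_ge0_le0.
Unshelve. all: by end_near. Qed.

Lemma cut_set_coord (i : 'I_n) (A : set T) : measurable A ->
  cut_set [set x | A (x ord0 i)].
Proof.
pose K : set (set T) := [set A | cut_set [set x | A (x ord0 i)]].
suff : @measurable _ T `<=` K by apply.
rewrite [X in X `<=` _]RGenOInfty.measurableE; apply: smallest_sub.
  split; first exact: cut_set0.
  - by move=> D KD; rewrite setTD; exact: cut_setC.
  - move=> F KF; have h : cut_set (\bigcup_k [set x : Rn | F k (x ord0 i)]) by exact: cut_set_bigcup.
    suff E : \bigcup_k [set x : Rn | F k (x ord0 i)] =
      [set x : Rn | (\bigcup_k F k) (x ord0 i)] by rewrite E in h.
    by apply/seteqP; split=> x [k _ Fk]; exists k.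
move=> _ [a ->].
have h : cut_set [set x : Rn | a < x ord0 i] by exact: cut_set_halfspace.
suff E : [set x : Rn | a < x ord0 i] = [set x : Rn | `]a, +oo[%classic (x ord0 i)].
  by rewrite E in h.
by apply/seteqP; split=> x /=; rewrite in_itv/= andbT.
Qed.

(** The sets with this property form a sigma-algebra, and it contains the generators, the preimages
    of Borel sets under the coordinates. *)
Lemma cut_set_tuple (B : set (n.-tuple T)) : measurable B ->
  cut_set (@tuple_of_row R n @^-1` B).
Proof.
pose K : set (set (n.-tuple T)) := [set B | cut_set (@tuple_of_row R n @^-1` B)].
suff : @measurable _ (n.-tuple T) `<=` K by apply.
apply: smallest_sub.
  split; first exact: cut_set0.
  - by move=> A KA; rewrite setTD; exact: cut_setC.
  - by move=> F KF; exact: (cut_set_bigcup KF).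
rewrite -bigcup_seq => _ [i _ [A mA <-]]; rewrite /K/= setTI.
have h : cut_set [set x : Rn | A (x ord0 i)] by exact: cut_set_coord.
suff E : [set x : Rn | A (x ord0 i)] =
  @tuple_of_row R n @^-1` ((@tnth n T ^~ i) @^-1` A) by rewrite E in h.
by apply/seteqP; split=> x; rewrite /preimage/= tnth_mktuple.
Qed.

(** The constant 1 is not a Schwartz function, so the set cuts smooth functions [s k] of bounded
    support that tend to 1 with values in [0, 1]. *)
Lemma approximable_indic_tuple (B : set (n.-tuple T)) : measurable B ->
  (leb (@tuple_of_row R n @^-1` B) < +oo)%E ->
  approximable (\1_(@tuple_of_row R n @^-1` B) : Rn -> R).
Proof.
move=> mB Boo; set C := _ @^-1` B in Boo *.
have mC : measurable (C : set LT).
  apply: measurable_row; rewrite (_ : _ @^-1` _ = B)//.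
  by apply/seteqP; split=> t; rewrite /C /preimage/= row_of_tupleK.
have C1 : L1 leb (\1_C : LT -> R).
  apply/L1P; split; first exact: rmeas_indic.
  rewrite (_ : (fun x => _) = (fun x : LT => 1 * \1_C (x : Rn))).
    by rewrite lint_scale_indic// mul1e.
  by apply/funext => x; rewrite mul1r ger0_norm// indicE.
have C2 x : (\1_C x : R) ^+ 2 = \1_C x.
  by rewrite indicE; case: (_ \in _); rewrite ?expr1n ?expr0n.
pose s k (x : Rn) := flat_exp 0 (k%:R * (k%:R - \sum_i x ord0 i ^+ 2)).
have s1 k x : `|s k x| <= 1 by rewrite ger0_norm ?flat_exp_ge0// flat_exp0_le1.
apply: (@approximable_dct _ _ (fun k x => \1_C x * s k x) _ (\1_C)).
- move=> k; apply: cut_set_tuple => //; apply: approximable_schwartz.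
  apply: (@schwartz_flat _ _ _ _ (1 + k%:R)).
    by apply: slowM; [exact: slow_cst|exact: slow_bump_arg].
  move=> x; rewrite -sqr_euclid_norm => h.
  apply: le_trans (rV_norm_le_euclid x) _.
  have c0 : 0 <= k%:R :> R by [].
  move: (euclid_norm_ge0 x) h c0; move: (euclid_norm x) (k%:R : R) => t c t0 h c0.
  have : 0 < c - t ^+ 2.
    by rewrite ltNge; apply/negP => d0; have := mulr_ge0_le0 c0 d0; rewrite leNgt h.
  nra.
- move=> x; rewrite -[X in _ --> X]mulr1; apply: cvgM; first exact: cvg_cst.
  apply: flat_exp_cvg => c; near=> k.
  set q := \sum_i _.
  have k1 : q + 1 < k%:R by near: k; exact: nbhs_infty_gtr.
  have k2 : `|c| + 1 < k%:R by near: k; exact: nbhs_infty_gtr.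
  have := ler_norm c; have : 0 <= `|c| by []; nra.
- move=> k x; rewrite normrM ger0_norm ?indicE//; exact: ler_piMr.
- exact: C1.
- by apply: L1_ext C1 => x; rewrite C2.
Unshelve. all: by end_near. Qed.

(** B is the union of a nearly optimal cover in the definition of the outer measure. *)
Lemma leb_outer_approx (A : set Rn) (e : R) : 0 < e -> (leb A < +oo)%E ->
  exists B : set (n.-tuple T), [/\ measurable B, A `<=` @tuple_of_row R n @^-1` B &
    (leb (@tuple_of_row R n @^-1` B) <= leb A + e%:E)%E].
Proof.
move=> e0 Aoo.
have Afin : leb A \is a fin_num by rewrite ge0_fin_numE.
have [_ [F [mF AF] <-] Fe] := lb_ereal_inf_adherent e0 Afin.
exists (\bigcup_k F k); split.
- by apply: bigcupT_measurable.
- move=> x Ax; apply: AF.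
  by rewrite /preimage/= tuple_of_rowK.
have E : @row_of_tuple R n @^-1` (@tuple_of_row R n @^-1` (\bigcup_k F k)) = \bigcup_k F k.
  by apply/seteqP; split=> t; rewrite /preimage/= row_of_tupleK.
rewrite leb_row E; last by apply: bigcupT_measurable.
apply: le_trans (ltW Fe); apply: measure_sigma_subadditive => //.
by apply: bigcupT_measurable.
Qed.

(** A Borel superset exceeds A by small measure, and for indicators the L1 distance equals the
    squared L2 distance. *)
Lemma approximable_indic (A : set Rn) : measurable (A : set LT) -> (leb A < +oo)%E ->
  approximable (\1_A : Rn -> R).
Proof.
move=> mA Aoo; apply: approximable_lim; first exact: rmeas_indic.
move=> e e0; have [B [mB AB Be]] := leb_outer_approx e0 Aoo.
set C := _ @^-1` B in AB Be.
have Coo : (leb C < +oo)%E by apply: le_lt_trans Be _; rewrite lte_add_pinfty ?ltry.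
exists (\1_C); first exact: approximable_indic_tuple.
have mC : measurable (C : set LT).
  apply: measurable_row; rewrite (_ : _ @^-1` _ = B)//.
  by apply/seteqP; split=> t; rewrite /C /preimage/= row_of_tupleK.
have D x : `|\1_A x - \1_C x| = 1 * \1_(C `\` A) x :> R.
  rewrite !indicE mul1r; case: (boolP (x \in A)) => xA.
    rewrite (mem_set (AB _ (set_mem xA))) subrr normr0 memNset//.
    by move=> [_]; apply; exact: set_mem.
  rewrite sub0r normrN; case: (boolP (x \in C)) => xC.
    rewrite mem_set ?normr1//; split; first exact: set_mem.
    by move/negP : xA => h ?; apply: h; exact: mem_set.
  by rewrite normr0 memNset// => -[/mem_set]; rewrite (negbTE xC).
have mCA : measurable (C `\` A : set LT) by exact: measurableD.
have le : (lint leb (fun x : LT => 1 * \1_(C `\` A) (x : Rn))%R <= e%:E)%E.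
  rewrite lint_scale_indic// mul1e.
  have Afin : leb A \is a fin_num by rewrite ge0_fin_numE.
  have CE : leb C = (leb (C `\` A) + leb A)%E.
    rewrite -[in LHS](setDUK AB) setUC measureU//.
    by rewrite setDE -setIA (setIC (~` A)) setICr setI0.
  by move: Be; rewrite CE addeC leeD2lE.
split.
- by rewrite (_ : (fun x => _) = (fun x : LT => 1 * \1_(C `\` A) (x : Rn)))//; exact/funext.
- rewrite (_ : (fun x => _) = (fun x : LT => 1 * \1_(C `\` A) (x : Rn)))//.
  apply/funext => x; rewrite -[LHS]real_normK ?num_real// D mul1r.
  by rewrite indicE; case: (_ \in _); rewrite ?expr1n ?expr0n.
Qed.

Lemma approximable_sum (I : Type) (s : seq I) (F : I -> Rn -> R) :
  (forall i, approximable (F i)) -> approximable (fun x => \sum_(i <- s) F i x).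
Proof.
move=> HF; elim: s => [|i s ih].
  rewrite (_ : (fun x => _) = fun=> 0); first exact/approximable_schwartz/schwartz0.
  by apply/funext => x; rewrite big_nil.
rewrite (_ : (fun x => _) = (fun x => F i x + \sum_(j <- s) F j x)).
  exact: approximableD.
by apply/funext => x; rewrite big_cons.
Qed.

Lemma approximable_ge0 f : (forall x, 0 <= f x) -> L1 leb f ->
  L1 leb (fun x : LT => f x ^+ 2) -> approximable f.
Proof.
move=> f0 f1 f2; have mf := L1_rmeas f1.
have mF := rmeas_EFin mf.
pose sf := nnsfun_approx measurableT mF.
pose s k (x : Rn) : R := (sf k) x.
have sc x : (fun k => s k x) @ \oo --> f x.
  have f0' (y : LT) : setT y -> (0 <= (EFin \o f) y)%E by move=> _; rewrite lee_fin.
  have := cvg_nnsfun_approx measurableT mF f0' (I : setT (x : LT)).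
  by move=> /fine_cvgP[_].
have s_le k x : s k x <= f x.
  rewrite -(cvg_lim _ (sc x))//; apply: nondecreasing_cvgn_le.
    by move=> i j ij; have /lefP := nd_nnsfun_approx measurableT mF ij; apply.
  by apply/cvg_ex; exists (f x); exact: sc.
have s0 k x : 0 <= s k x by exact: fun_ge0.
have ms k : rmeas (s k : LT -> R) by exact: measurable_funP.
apply: (@approximable_dct _ _ s _ f) => //; last first.
  by move=> k x; rewrite ger0_norm.
move=> k.
have E := funext (fun x => fimfunEord (sf k) x).
rewrite -[s k]/(fun x : LT => sf k x) E.
apply: approximable_sum => i; move: (nth _ _ _) => r.
have [->|r0] := eqVneq r 0.
  rewrite (_ : (fun x => _) = fun=> 0); first exact/approximable_schwartz/schwartz0.
  by apply/funext => x; rewrite mul0r.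
set C := _ @^-1` _.
have mC : measurable (C : set LT).
  by rewrite -[C]setTI; exact: (ms k).
apply: approximableZ; apply: approximable_indic => //.
(* The level set at a value r != 0 has finite measure, since |r| times its indicator is at most
   f. *)
have : (lint leb (fun x : LT => `|r| * \1_C (x : Rn))%R < +oo)%E.
  apply: (@le_lt_trans _ _ (lint leb f)); last by rewrite lintE ?ltry.
  apply: lint_le => //.
  - by apply: rmeasM; [exact: rmeas_cst|exact: rmeas_indic].
  - move=> x; rewrite indicE; case: (boolP (x \in C)) => [|_]; last by rewrite mulr0.
    by rewrite inE /C /preimage/= mulr1 => <-; rewrite ger0_norm//; exact: s_le.
rewrite lint_scale_indic//.
case: (leb C) => [t _|h|//]; first by rewrite ltry.
by move: h; rewrite gt0_muley// lte_fin normr_gt0.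
Qed.

Lemma approximable_L12 f : L1 leb f -> L1 leb (fun x : LT => f x ^+ 2) -> approximable f.
Proof.
move=> f1 f2; have mf := L1_rmeas f1.
pose fp x := 2^-1 * (`|f x| + f x); pose fn x := 2^-1 * (`|f x| - f x).
have fpE x : fp x ^+ 2 <= f x ^+ 2.
  rewrite -(real_normK (num_real (f x))) /fp.
  by have := ler_norm (f x); have := ler_norm (- f x);
    rewrite ?normrN; move: `|f x| (f x) => a b; nra.
have fnE x : fn x ^+ 2 <= f x ^+ 2.
  rewrite -(real_normK (num_real (f x))) /fn.
  by have := ler_norm (f x); have := ler_norm (- f x);
    rewrite ?normrN; move: `|f x| (f x) => a b; nra.
have p1 : L1 leb fp by apply: L1Z; apply: L1D => //; exact: L1_norm.
have n1 : L1 leb fn by apply: L1Z; apply: L1B => //; exact: L1_norm.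
have p0 x : 0 <= fp x.
  by have := ler_norm (- f x); rewrite normrN /fp; lra.
have n0 x : 0 <= fn x by have := ler_norm (f x); rewrite /fn; lra.
rewrite (_ : f = (fun x => fp x - fn x)); last first.
  by apply/funext => x; rewrite /fp /fn; field.
apply: approximableB; apply: approximable_ge0 => //.
- apply: (L1_dom _ _ f2); first by apply: rmeasX; exact: L1_rmeas p1.
  by move=> x; rewrite ger0_norm ?sqr_ge0.
- apply: (L1_dom _ _ f2); first by apply: rmeasX; exact: L1_rmeas n1.
  by move=> x; rewrite ger0_norm ?sqr_ge0.
Qed.

End density_sets.

Section complex_density.
Context {R : realType} {n : nat}.
Local Notation Rn := 'rV[R]_n.
Local Notation LT := (lebesgueType R n).
Local Notation leb := (@leb R n).
Local Notation Re := (@complex.Re R).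
Local Notation Im := (@complex.Im R).
Implicit Types (u v w : Rn -> R[i]).

Definition L2 u := cmeasurable u /\ (norm2 u < +oo)%E.

Lemma rmeas_sqn u : cmeasurable u -> rmeas (fun x : LT => sqn (u x)).
Proof. by move=> [ur ui]; apply: rmeasD; exact: rmeasX. Qed.

Lemma cmeasurableB u v : cmeasurable u -> cmeasurable v -> cmeasurable (u - v).
Proof.
move=> [ur ui] [vr vi]; split.
- by apply: rmeas_ext (rmeasB ur vr) => x; rewrite -cReB.
- by apply: rmeas_ext (rmeasB ui vi) => x; rewrite -cImB.
Qed.

Lemma cmeasurableD u v : cmeasurable u -> cmeasurable v -> cmeasurable (u + v).
Proof.
move=> [ur ui] [vr vi]; split.
- by apply: rmeas_ext (rmeasD ur vr) => x; rewrite -cReD.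
- by apply: rmeas_ext (rmeasD ui vi) => x; rewrite -cImD.
Qed.

Lemma schwartz_cmeasurable u : schwartz u -> cmeasurable u.
Proof. by move=> [ur ui]; split; exact: schwartz_rmeas. Qed.

Lemma schwartz_dense12 u e : 0 < e -> cL1 u -> L2 u ->
  exists v, [/\ schwartz v, (norm2 (u - v) <= e%:E)%E & norm1 (u - v) <= e].
Proof.
move=> e0 [ur1 ui1] [[mr mi] u2].
have s2 (k : Rn -> R) : rmeas (k : LT -> R) -> (forall x, k x ^+ 2 <= sqn (u x)) ->
    L1 leb (fun x : LT => k x ^+ 2).
  move=> mk ku; apply/L1P; split; first exact: rmeasX.
  apply: le_lt_trans u2; apply: lint_le => //.
  - by apply: rmeas_norm; exact: rmeasX.
  - exact: rmeas_sqn.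
  - by move=> x; rewrite ger0_norm ?sqr_ge0.
have e20 : 0 < e / 2 by rewrite divr_gt0.
have [] := approximable_L12 ur1 (s2 _ mr _); first by move=> x; rewrite lerDl sqr_ge0.
move=> _ /(_ _ e20)[vr Sr [r1 r2]].
have [] := approximable_L12 ui1 (s2 _ mi _); first by move=> x; rewrite lerDr sqr_ge0.
move=> _ /(_ _ e20)[vi Si [i1 i2]].
exists (fun x => Complex (vr x) (vi x)).
have mr' := rmeasB mr (schwartz_rmeas Sr); have mi' := rmeasB mi (schwartz_rmeas Si).
have rE x : Re ((u - (fun x => Complex (vr x) (vi x))) x) = Re (u x) - vr x by rewrite cReB.
have iE x : Im ((u - (fun x => Complex (vr x) (vi x))) x) = Im (u x) - vi x by rewrite cImB.
split; first by split.
- rewrite /norm2 (_ : (fun x => _) = (fun x : LT => (Re (u x) - vr x) ^+ 2 +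
      (Im (u x) - vi x) ^+ 2)); last by apply/funext => x; rewrite /sqn rE iE.
  rewrite lintD; [|exact: rmeasX|exact: rmeasX|by move=> x; exact: sqr_ge0|
    by move=> x; exact: sqr_ge0].
  by apply: le_trans (leeD r2 i2) _; rewrite -EFinD lee_fin -splitr.
- rewrite -lee_fin /norm1 -lintE; last first.
    apply: L1D; apply: L1_norm.
      by apply: L1_ext (L1B ur1 (schwartz_L1 Sr)) => x; rewrite rE.
    by apply: L1_ext (L1B ui1 (schwartz_L1 Si)) => x; rewrite iE.
  rewrite (_ : (fun x => _) = (fun x : LT => `|Re (u x) - vr x| +
      `|Im (u x) - vi x|)); last by apply/funext => x; rewrite rE iE.
  rewrite lintD; [|exact: rmeas_norm|exact: rmeas_norm|by []|by []].
  by apply: le_trans (leeD r1 i1) _; rewrite -EFinD lee_fin -splitr.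
Qed.

Lemma norm2_ge0 u : (0 <= norm2 u)%E.
Proof. by apply: lint_ge0 => x; exact: sqn_ge0. Qed.

Lemma norm2D_le u v : cmeasurable u -> cmeasurable v ->
  (norm2 (u + v) <= 2%:E * norm2 u + 2%:E * norm2 v)%E.
Proof.
move=> mu mv; have m1 := rmeas_sqn mu; have m2 := rmeas_sqn mv.
rewrite /norm2 -!lintZ//; try by move=> x; exact: sqn_ge0.
have p w x : 0 <= 2 * sqn (w x) :> R by rewrite mulr_ge0// sqn_ge0.
rewrite -lintD//; try by apply: rmeasM => //; exact: rmeas_cst.
apply: lint_le.
- exact: rmeas_sqn (cmeasurableD mu mv).
- by apply: rmeasD; apply: rmeasM => //; exact: rmeas_cst.
- by move=> x; exact: sqn_ge0.
- by move=> x; exact: sqnD_le.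
Qed.

Lemma norm2N u : norm2 (- u) = norm2 u.
Proof. by congr lint; apply/funext => x; rewrite -[RHS]sqnN. Qed.

Lemma norm2_sub u v : norm2 (u - v) = norm2 (v - u).
Proof. by rewrite -norm2N opprB. Qed.

Lemma cmeasurableN u : cmeasurable u -> cmeasurable (- u).
Proof.
move=> [ur ui]; split.
- by apply: rmeas_ext (rmeasN ur) => x; rewrite -cReN.
- by apply: rmeas_ext (rmeasN ui) => x; rewrite -cImN.
Qed.

Lemma norm2B_le u v w : cmeasurable u -> cmeasurable v -> cmeasurable w ->
  (norm2 (u - w) <= 2%:E * norm2 (u - v) + 2%:E * norm2 (v - w))%E.
Proof.
move=> mu mv mw; have -> : u - w = (u - v) + (v - w) by rewrite subrKA.
by apply: norm2D_le; exact: cmeasurableB.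
Qed.

Lemma L2B u v : L2 u -> L2 v -> L2 (u - v).
Proof.
move=> [mu u2] [mv v2]; split; first exact: cmeasurableB.
apply: le_lt_trans (norm2D_le mu (cmeasurableN mv)) _.
by rewrite norm2N lte_add_pinfty// lte_mul_pinfty.
Qed.

Lemma schwartz_L2 u : schwartz u -> L2 u.
Proof.
move=> Su; split; first exact: schwartz_cmeasurable.
by rewrite /norm2 lintE ?ltry//; case: Su => Sr Si; apply: L1D; exact: schwartzM_L1.
Qed.

(** Cutting to a cube makes L2 functions, and likewise bounded ones, integrable. *)
Definition truncate k u : Rn -> R[i] := fun x =>
  Complex (\1_(cube k%:R) x * Re (u x)) (\1_(cube k%:R) x * Im (u x)).

Lemma truncateE k u x : truncate k u x = if x \in cube k%:R then u x else 0.
Proof.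
rewrite /truncate indicE; case: (x \in _); apply: complex_ext => //=;
  by rewrite ?mul1r ?mul0r.
Qed.

Lemma truncate_L2 k u : L2 u -> L2 (truncate k u) /\ cL1 (truncate k u).
Proof.
move=> [[mr mi] u2].
have mc : measurable (cube k%:R : set LT) by exact: measurable_cube.
have mi1 : rmeas (\1_(cube k%:R) : LT -> R) by exact: rmeas_indic.
have mt : cmeasurable (truncate k u) by split; exact: rmeasM.
have c1 : L1 leb (\1_(cube k%:R) : LT -> R).
  apply/L1P; split => //.
  rewrite (_ : (fun x => _) = (fun x : LT => 1 * \1_(cube k%:R) (x : Rn))).
    by rewrite lint_scale_indic// leb_cube// -EFinM ltry.
  by apply/funext => x; rewrite mul1r ger0_norm// indicE.
have s1 : L1 leb (fun x : LT => sqn (u x)).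
  apply/L1P; split; first exact: rmeas_sqn.
  by rewrite (_ : (fun x => _) = (fun x : LT => sqn (u x)))//;
    apply/funext => x; rewrite ger0_norm// sqn_ge0.
have b (t s : R) (x : Rn) : t ^+ 2 <= s -> `|\1_(cube k%:R) x * t| <= \1_(cube k%:R) x + s.
  move=> ts; rewrite normrM indicE; case: (_ \in _) => /=.
    rewrite normr1 mul1r; move: ts; rewrite -(real_normK (num_real t)).
    have : 0 <= `|t| by []; move: `|t| => r; nra.
  by rewrite normr0 mul0r add0r; apply: le_trans ts; exact: sqr_ge0.
split; last first.
  split; apply: (L1_dom _ _ (L1D c1 s1)).
  - exact: rmeasM.
  - by move=> x; apply: b; rewrite lerDl sqr_ge0.
  - exact: rmeasM.
  - by move=> x; apply: b; rewrite lerDr sqr_ge0.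
split=> //; apply: le_lt_trans u2; apply: lint_le.
- exact: rmeas_sqn.
- exact: rmeas_sqn.
- by move=> x; exact: sqn_ge0.
- by move=> x; rewrite truncateE; case: ifP => // _; rewrite sqn0 sqn_ge0.
Qed.

Lemma truncate_cvg u : L2 u -> (fun k => norm2 (u - truncate k u)) @ \oo --> 0%E.
Proof.
move=> [mu u2].
have s1 : L1 leb (fun x : LT => sqn (u x)).
  apply/L1P; split; first exact: rmeas_sqn.
  by rewrite (_ : (fun x => _) = (fun x : LT => sqn (u x)))//;
    apply/funext => x; rewrite ger0_norm// sqn_ge0.
apply: (lint_dct0 (g := fun x : LT => sqn (u x))) => //.
- move=> k; exact: (rmeas_sqn (cmeasurableB mu (truncate_L2 k (conj mu u2)).1.1)).
- move=> x; apply: cvg_near_cst; near=> k.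
  rewrite -[(u - truncate k u) x]/(u x - truncate k u x) truncateE mem_set ?subrr ?sqn0//.
  rewrite cube_norm//=; near: k; exact: nbhs_infty_ger.
- move=> k x; rewrite sqn_ge0/= -[(u - truncate k u) x]/(u x - truncate k u x) truncateE.
  by case: ifP => _; rewrite ?subrr ?sqn0 ?sqn_ge0// subr0.
Unshelve. all: by end_near. Qed.

Lemma schwartz_dense2 u e : 0 < e -> L2 u ->
  exists2 v, schwartz v & (norm2 (u - v) <= e%:E)%E.
Proof.
move=> e0 u2; have e4 : 0 < e / 4 by rewrite divr_gt0.
have [N _ /(_ N)] := ecvg0_le (truncate_cvg u2) e4; rewrite /= leqnn => /(_ isT) uN.
have [t2 t1] := truncate_L2 N u2.
have [v [Sv v2 _]] := schwartz_dense12 e4 t1 t2; exists v => //.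
apply: le_trans (norm2B_le u2.1 t2.1 (schwartz_cmeasurable Sv)) _.
apply: (@le_trans _ _ (2%:E * (e / 4)%:E + 2%:E * (e / 4)%:E)%E).
  by apply: leeD; rewrite lee_pmul2l.
by rewrite -!EFinM -EFinD lee_fin; lra.
Qed.

End complex_density.

(** * The Fourier transform on L2 *)

Section real_cauchy.
Context {R : realType}.

Lemma cvg_geometric_steps (a : nat -> R) (C : R) :
  (forall k, `|a k.+1 - a k| <= C * 2^-1 ^+ k) -> cvgn a.
Proof.
move=> ha.
have -> : a = (fun=> a 0%N) + series (telescope a).
  by apply/funext => k; exact: eq_sum_telescope.
apply: is_cvgD; first exact: is_cvg_cst.
apply: normed_cvg.
apply: (@series_le_cvg _ _ (geometric C 2^-1)) => //.
- by move=> k; exact: normr_ge0.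
- by move=> k; exact: le_trans (normr_ge0 _) (ha k).
- apply: is_cvg_geometric_series.
  by rewrite ger0_norm// invf_lt1// ltr1n.
Qed.

End real_cauchy.

(** * Completeness of L2 *)

Section L2_complete.
Context {R : realType} {n : nat}.
Local Notation Rn := 'rV[R]_n.
Local Notation LT := (lebesgueType R n).
Local Notation leb := (@leb R n).
Local Notation Re := (@complex.Re R).
Local Notation Im := (@complex.Im R).

(** Riesz-Fischer. The rate 8^-k leaves room for the weight 4^k: the sum of 4^k |u_(k+1) - u_k|^2 is
    integrable, hence finite almost everywhere, and at such points the steps are at most C 2^-k. *)
Lemma L2_complete (u : nat -> Rn -> R[i]) : (forall k, L2 (u k)) ->
  (forall k, norm2 (u k.+1 - u k) <= (8^-1 ^+ k)%:E)%E ->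
  exists2 w, L2 w & (fun k => norm2 (u k - w)) @ \oo --> 0%E.
Proof.
move=> u2 ud.
have mu k : cmeasurable (u k) := (u2 k).1.
have md k := rmeas_sqn (cmeasurableB (mu k.+1) (mu k)).
pose D k (x : LT) : \bar R := (4 ^+ k * sqn ((u k.+1 - u k) x))%:E.
have D0 k x : (0 <= D k x)%E by rewrite lee_fin mulr_ge0 ?exprn_ge0 ?sqn_ge0.
have mD k : measurable_fun setT (D k).
  by apply: rmeas_EFin; apply: rmeasM (rmeas_cst _) (md k).
pose S (x : LT) := (\sum_(0 <= k <oo) D k x)%E.
have S0 x : (0 <= S x)%E by exact: nneseries_ge0.
have mS : measurable_fun setT S.
  exact: (@ge0_emeasurable_sum _ LT R setT D xpredT (fun k x _ _ => D0 k x) (fun k _ => mD k)).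
have iD k : (\int[leb]_x D k x <= (2^-1 ^+ k)%:E)%E.
  have -> : (\int[leb]_x D k x = (4 ^+ k)%:E * norm2 (u k.+1 - u k))%E.
    exact: (lintZ leb (md k) (fun x => sqn_ge0 _) (exprn_ge0 k (ler0n _ 4))).
  have -> : (2^-1 ^+ k)%:E = ((4 ^+ k)%:E * (8^-1 ^+ k)%:E)%E :> \bar R.
    by rewrite -EFinM -exprMn; congr ((_ ^+ _)%:E); lra.
  by apply: lee_wpmul2l (ud k); rewrite lee_fin exprn_ge0.
have iS : (\int[leb]_x S x < +oo)%E.
  rewrite /S (@integral_nneseries _ LT R leb setT measurableT D mD (fun k x _ => D0 k x)).
  apply: (@le_lt_trans _ _ (\sum_(0 <= k <oo) (2^-1 ^+ k)%:E)%E).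
    apply: lee_nneseries => [k _ _|k _]; last exact: iD.
    by apply: integral_ge0 => x _; exact: D0.
  have := @cvg_geometric_series R 1 (2^-1).
  rewrite ger0_norm// invf_lt1// ltr1n => /(_ isT) h.
  rewrite (_ : limn _ = (1 / (1 - 2^-1))%:E) ?ltry//.
  apply/cvg_lim => //.
  rewrite (_ : (fun m => _) = EFin \o series (geometric 1 (2^-1))).
    by apply: cvg_EFin => //; exact: nearW.
  apply/funext => m; rewrite /= /series/= sumEFin; congr EFin.
  by apply: eq_bigr => k _; rewrite /geometric/= mul1r.
pose N := [set x : LT | S x = +oo%E].
have mN : measurable N.
  by rewrite -[N]setTI; exact: (mS measurableT _ (emeasurable_set1 +oo%E)).
have aeN : \forall x \ae leb, ~ N x.
  have iS' : leb.-integrable setT S.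
    apply/integrableP; split => //.
    by under eq_integral do rewrite gee0_abs//.
  by apply: filterS (integrable_ae measurableT iS') => x /(_ I); rewrite /N/= => /[swap] ->.
have step (x : LT) : ~ N x -> exists C, forall k,
    sqn (u k.+1 x - u k x) <= C ^+ 2 * (2^-1 ^+ k) ^+ 2 /\ 0 <= C.
  move=> Nx; have Sfin : S x \is a fin_num.
    by rewrite ge0_fin_numE// ltey; apply/eqP.
  exists (Num.sqrt (fine (S x))) => k; split; last exact: sqrtr_ge0.
  rewrite sqr_sqrtr ?fine_ge0// -exprM mulnC exprM.
  have -> : (2^-1 ^+ 2 : R) = 4^-1 by lra.
  rewrite exprVn ler_pdivlMr ?exprn_gt0// mulrC -lee_fin fineK//.
  apply: le_trans (nneseries_lim_ge k.+1 (fun i _ _ => D0 i x)).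
  rewrite big_nat_recr//= -[leLHS]add0e leeD//.
  by apply: sume_ge0 => i.
(* Multiplication by this indicator makes the sequences converge everywhere, so that the limit is
   measurable. *)
pose m (x : Rn) : R := \1_(~` N) (x : LT).
pose re k (x : Rn) := m x * Re (u k x).
pose im k (x : Rn) := m x * Im (u k x).
have mm : rmeas (m : LT -> R) by apply: rmeas_indic; exact: measurableC.
have le_step (a b C : R) : 0 <= C -> a ^+ 2 <= C ^+ 2 * b ^+ 2 -> 0 <= b -> `|a| <= C * b.
  move=> C0 h b0; rewrite -(ler_pXn2r (ltn0Sn 1)) ?nnegrE ?mulr_ge0//.
  by rewrite exprMn real_normK ?num_real.
have cre x : cvgn (re ^~ x).
  have [Nx|Nx] := pselect (N x).
    rewrite (_ : re ^~ x = fun=> 0); first exact: is_cvg_cst.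
    by apply/funext => k; rewrite /re /m indicE memNset ?mul0r//= => /(_ Nx).
  have [C hC] := step _ Nx; apply: (@cvg_geometric_steps _ _ C) => k.
  have [h C0] := hC k; rewrite /re /m indicE mem_set//= !mul1r -cReB.
  apply: (le_step _ _ _ C0); last by rewrite exprn_ge0.
  by apply: le_trans h; rewrite lerDl sqr_ge0.
have cim x : cvgn (im ^~ x).
  have [Nx|Nx] := pselect (N x).
    rewrite (_ : im ^~ x = fun=> 0); first exact: is_cvg_cst.
    by apply/funext => k; rewrite /im /m indicE memNset ?mul0r//= => /(_ Nx).
  have [C hC] := step _ Nx; apply: (@cvg_geometric_steps _ _ C) => k.
  have [h C0] := hC k; rewrite /im /m indicE mem_set//= !mul1r -cImB.
  apply: (le_step _ _ _ C0); last by rewrite exprn_ge0.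
  by apply: le_trans h; rewrite lerDr sqr_ge0.
pose w (x : Rn) := Complex (limn (re ^~ x)) (limn (im ^~ x)).
have mw : cmeasurable w.
  split.
  - apply: (@rmeas_cvg _ LT R re) => [k|x]; last exact: cre.
    exact: rmeasM mm (mu k).1.
  - apply: (@rmeas_cvg _ LT R im) => [k|x]; last exact: cim.
    exact: rmeasM mm (mu k).2.
(* The constant 4 survives the factors 2 of the triangle inequality because 2 + 2 * 4 / 8 <= 4. *)
have tail j l : (norm2 (u j - u (j + l)%N) <= (4 * 8^-1 ^+ j)%:E)%E.
  elim: l j => [|l ih] j.
    rewrite addn0 subrr (_ : norm2 _ = 0%E) ?lee_fin ?mulr_ge0 ?exprn_ge0//.
    by apply: integral0_eq => x _; rewrite sqn0.
  apply: le_trans (norm2B_le (mu j) (mu j.+1) (mu _)) _.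
  have h1 := ud j; rewrite norm2_sub in h1.
  have h2 := ih j.+1; rewrite addSn -addnS in h2.
  apply: (@le_trans _ _ (2%:E * (8^-1 ^+ j)%:E + 2%:E * (4 * 8^-1 ^+ j.+1)%:E)%E).
    by apply: leeD; apply: lee_wpmul2l.
  rewrite -!EFinM -EFinD lee_fin exprS.
  have : 0 <= (8^-1 : R) ^+ j by rewrite exprn_ge0.
  lra.
have shift j (f : nat -> R) (l : R) : f @ \oo --> l -> (fun k => f (j + k)%N) @ \oo --> l.
  move=> fl; rewrite (_ : (fun k => _) = (fun k => f (k + j)%N)); first by rewrite cvg_shiftn.
  by apply/funext => k; rewrite addnC.
(* Fatou along the tail carries the bound over to the limit. *)
have lim_le j : (norm2 (u j - w) <= (4 * 8^-1 ^+ j)%:E)%E.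
  apply: (@lint_fatou _ LT R leb (fun k x => sqn ((u j - u (j + k)%N) x))).
  - by move=> k; exact: rmeas_sqn (cmeasurableB (mu j) (mu _)).
  - by move=> k x; exact: sqn_ge0.
  - exact: rmeas_sqn (cmeasurableB (mu j) mw).
  - by move=> x; exact: sqn_ge0.
  - apply: filterS aeN => x Nx.
    have mx1 : m x = 1 by rewrite /m indicE mem_set.
    have c1 : (fun k => Re (u (j + k)%N x)) @ \oo --> Re (w x).
      rewrite (_ : (fun k => _) = (fun k => re (j + k)%N x)).
        exact: (shift j (re ^~ x) _ (cre x)).
      by apply/funext => k; rewrite /re mx1 mul1r.
    have c2 : (fun k => Im (u (j + k)%N x)) @ \oo --> Im (w x).
      rewrite (_ : (fun k => _) = (fun k => im (j + k)%N x)).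
        exact: (shift j (im ^~ x) _ (cim x)).
      by apply/funext => k; rewrite /im mx1 mul1r.
    rewrite /sqn; under eq_fun do rewrite cReB cImB.
    rewrite -[(u j - w) x]/(u j x - w x) cReB cImB.
    apply: cvgD; apply: (@cvg_comp _ _ _ _ (fun t : R => t ^+ 2)).
    + by apply: cvgB; [exact: cvg_cst|exact: c1].
    + exact: exprn_continuous.
    + by apply: cvgB; [exact: cvg_cst|exact: c2].
    + exact: exprn_continuous.
  - by apply: nearW => k; exact: tail.
exists w.
  have d0 : L2 (u 0%N - w).
    by split; [exact: cmeasurableB|exact: le_lt_trans (lim_le 0%N) (ltry _)].
  have -> : w = u 0%N - (u 0%N - w) by rewrite opprB addrCA subrr addr0.
  exact: L2B.
apply: ecvg0P => [k|e e0]; first exact: norm2_ge0.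
have g0 : (fun k => 4 * 8^-1 ^+ k) @ \oo --> (0 : R).
  rewrite -(mulr0 4); apply: cvgM; first exact: cvg_cst.
  by apply: cvg_expr; rewrite ger0_norm// invf_lt1// ltr1n.
near=> k; apply: le_trans (lim_le k) _; rewrite lee_fin; apply: ltW.
near: k.
by apply: (cvgr_lt _ g0).
Unshelve. all: by end_near. Qed.

End L2_complete.


Section cLnorm2.
Context {R : realType} {n : nat}.
Local Notation Rn := 'rV[R]_n.
Local Notation LT := (lebesgueType R n).
Implicit Types u : Rn -> R[i].

Lemma cLnorm2_ge0 u : (0 <= cLnorm 2%:E u)%E. Proof. exact: Lnorm_ge0. Qed.

Lemma norm2E u : norm2 u = (cLnorm 2%:E u `^ 2)%E.
Proof.
rewrite /cLnorm poweR_Lnorm//; apply: eq_integral => x _.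
rewrite /cabs /= ger0_norm ?normc_ge0// powR_mulrn ?normc_ge0//.
by rewrite normc_sqr.
Qed.

Lemma norm2_le u (e : R) : 0 <= e -> (norm2 u <= (e ^+ 2)%:E)%E = (cLnorm 2%:E u <= e%:E)%E.
Proof.
move=> e0; rewrite norm2E; have := cLnorm2_ge0 u.
case: (cLnorm _ u) => [t| |]//.
  rewrite lee_fin => t0; rewrite poweR_EFin powR_mulrn// !lee_fin.
  by rewrite ler_pXn2r// nnegrE.
by move=> _; rewrite poweRyr ?pnatr_eq0// !leNgt !ltry.
Qed.

Lemma L2P u : cLp 2%:E u <-> L2 u.
Proof.
split=> -[mu h]; split => //; move: h; rewrite norm2E; have := cLnorm2_ge0 u;
  case: (cLnorm _ u) => [t| |]//.
- by move=> _ _; rewrite poweR_EFin ltry.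
- by move=> _ _; rewrite ltry.
- by rewrite poweRyr ?pnatr_eq0.
Qed.

Lemma cLnorm2_cvg (u : nat -> Rn -> R[i]) :
  (fun k => cLnorm 2%:E (u k)) @ \oo --> 0%E <->
  (fun k => norm2 (u k)) @ \oo --> 0%E.
Proof.
split=> h; apply: ecvg0P => [k|e e0].
- exact: norm2_ge0.
- have s0 : 0 < Num.sqrt e by rewrite sqrtr_gt0.
  apply: filterS (ecvg0_le h s0) => k.
  by rewrite -norm2_le ?sqrtr_ge0// sqr_sqrtr// ltW.
- exact: cLnorm2_ge0.
- apply: filterS (ecvg0_le h (exprn_gt0 2 e0)) => k.
  by rewrite norm2_le// ltW.
Qed.

End cLnorm2.

(** * Extension to L2 of maps that scale the L2 norm on Schwartz functions *)

Section schwartz_extension.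
Context {R : realType} {n : nat}.
Local Notation Rn := 'rV[R]_n.
Local Notation LT := (lebesgueType R n).
Variables (T : (Rn -> R[i]) -> (Rn -> R[i])) (c : R).
Hypothesis c0 : 0 < c.
Hypothesis TS : forall u, schwartz u -> schwartz (T u).
Hypothesis TB : forall u v, schwartz u -> schwartz v -> T (u - v) = T u - T v.
Hypothesis Tn : forall u, schwartz u -> norm2 (T u) = (c%:E * norm2 u)%E.
Implicit Types (u v w : Rn -> R[i]).

Local Notation E := (continuous_extension (cLnorm 2%:E) (cLnorm 2%:E)
  (@schwartz R n) (cLp 2%:E) T).

Let is_ext u w := cLp 2%:E w /\ exists u_ : nat -> Rn -> R[i],
  [/\ forall k, schwartz (u_ k),
      (fun k => cLnorm 2%:E (u_ k - u)) @ \oo --> 0%E &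
      (fun k => cLnorm 2%:E (T (u_ k) - w)) @ \oo --> 0%E].

(** The set from which the extension chooses is nonempty: Schwartz approximations of u have images
    with geometrically small steps, and L2 is complete. *)
Lemma schwartz_extensionP u : L2 u -> is_ext u (E u).
Proof.
move=> u2.
suff [w ew] : exists w, is_ext u w.
  rewrite /continuous_extension; case: xgetP => [y _ //|/(_ w)].
  by [].
(* The triangle inequality bounds the steps of the images by c (2 d_(k+1) + 2 d_k) = (9/4) c d_k <=
   8^-k. *)
pose d k : R := 8^-1 ^+ k / (4 * (c + 1)).
have cc : 0 < 4 * (c + 1) by rewrite mulr_gt0// addr_gt0.
have d0 k : 0 < d k by rewrite divr_gt0// exprn_gt0.
have /choice[v hv] k : exists v, schwartz v /\ (norm2 (u - v) <= (d k)%:E)%E.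
  by have [v Sv vu] := schwartz_dense2 (d0 k) u2; exists v.
have Sv k : schwartz (v k) := (hv k).1.
have mv k := schwartz_cmeasurable (Sv k).
have h k : (norm2 (T (v k.+1) - T (v k)) <= (8^-1 ^+ k)%:E)%E.
  rewrite -TB// Tn; last exact: schwartz_sub.
  apply: (@le_trans _ _ (c%:E * (2%:E * (d k.+1)%:E + 2%:E * (d k)%:E))%E).
    apply: lee_wpmul2l; first by rewrite lee_fin ltW.
    apply: le_trans (norm2B_le (mv k.+1) u2.1 (mv k)) _.
    apply: leeD; apply: lee_wpmul2l => //; last exact: (hv k).2.
    by rewrite norm2_sub; exact: (hv k.+1).2.
  rewrite -[leLHS]/((c * (2 * d k.+1 + 2 * d k))%:E) lee_fin /d exprS.
  have : 0 <= (8^-1 : R) ^+ k by rewrite exprn_ge0.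
  move: (8^-1 ^+ k) => t t0.
  rewrite (_ : c * _ = t * ((c * (9 / 4)) / (4 * (c + 1)))).
    rewrite ler_piMr// ler_pdivrMr//; lra.
  by field; rewrite gt_eqF// addr_gt0.
have [w w2 wc] := L2_complete (fun k => schwartz_L2 (TS (Sv k))) h.
exists w; split; first exact/L2P.
exists v; split => //; last exact/cLnorm2_cvg.
apply/cLnorm2_cvg/ecvg0P => [k|e e0]; first exact: norm2_ge0.
have g0 : d @ \oo --> (0 : R).
  rewrite -(mul0r (4 * (c + 1))^-1); apply: cvgM; last exact: cvg_cst.
  by apply: cvg_expr; rewrite ger0_norm// invf_lt1// ltr1n.
near=> k; rewrite norm2_sub; apply: le_trans (hv k).2 _; rewrite lee_fin; apply: ltW.
by near: k; apply: (cvgr_lt _ g0).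
Unshelve. all: by end_near. Qed.

Lemma schwartz_extension_L2 u : L2 u -> L2 (E u).
Proof. by move=> /schwartz_extensionP[/L2P]. Qed.

(** Two triangle inequalities through an approximating sequence of u produce 4 c instead of c. The
    next two lemmas rest on this estimate, as no linearity of the extension is known yet. *)
Lemma schwartz_extension_near u v : L2 u -> schwartz v ->
  (norm2 (T v - E u) <= (4 * c)%:E * norm2 (v - u))%E.
Proof.
move=> u2 Sv; have [_ [u_ [Su /cLnorm2_cvg uu /cLnorm2_cvg Tu]]] := schwartz_extensionP u2.
have E2 := schwartz_extension_L2 u2.
have mv := schwartz_cmeasurable Sv.
have vu2 := L2B (schwartz_L2 Sv) u2.
have fin : norm2 (v - u) \is a fin_num by rewrite ge0_fin_numE ?norm2_ge0// vu2.2.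
apply/lee_addgt0Pr => e e0.
pose d := e / (4 * c + 2).
have cc : 0 < 4 * c + 2 by rewrite addr_gt0// mulr_gt0.
have d0 : 0 < d by rewrite divr_gt0.
have [k [ku kT]] : exists k, (norm2 (u_ k - u) <= d%:E)%E /\ (norm2 (T (u_ k) - E u) <= d%:E)%E.
  near \oo => k; exists k; split; near: k; exact: ecvg0_le.
have mk := schwartz_cmeasurable (Su k).
apply: le_trans (norm2B_le (schwartz_cmeasurable (TS Sv))
  (schwartz_cmeasurable (TS (Su k))) E2.1) _.
rewrite -TB// Tn; last exact: schwartz_sub.
have c4 : (0 <= (2 * c)%:E :> \bar R)%E by rewrite lee_fin mulr_ge0// ltW.
apply: (@le_trans _ _ ((2 * c)%:E * (2%:E * norm2 (v - u) + 2%:E * d%:E) + 2%:E * d%:E)%E).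
  apply: leeD; last exact: lee_wpmul2l.
  rewrite muleA -EFinM; apply: lee_wpmul2l => //.
  apply: le_trans (norm2B_le mv u2.1 mk) _; apply: leeD => //.
  by apply: lee_wpmul2l => //; rewrite norm2_sub.
rewrite -(fineK fin); set f := fine _.
rewrite -[leLHS]/((2 * c * (2 * f + 2 * d) + 2 * d)%:E).
rewrite -[leRHS]/((4 * c * f + e)%:E) lee_fin.
rewrite (_ : 2 * c * _ + _ = 4 * c * f + d * (4 * c + 2)); last by ring.
by rewrite /d divfK// gt_eqF.
Unshelve. all: by end_near. Qed.

Lemma schwartz_extension_schwartz u : schwartz u -> norm2 (E u - T u) = 0%E.
Proof.
move=> Su; have := schwartz_extension_near (schwartz_L2 Su) Su.
rewrite subrr (_ : norm2 0 = 0%E) ?mule0.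
  by rewrite norm2_sub => h; apply/eqP; rewrite eq_le h norm2_ge0.
by apply: integral0_eq => x _; rewrite sqn0.
Qed.

(** Additivity holds up to a null function, because the values at u, v and u - v are chosen
    separately. All three are compared with Schwartz approximations, on which T is additive. *)
Lemma schwartz_extensionB u v : L2 u -> L2 v -> norm2 (E (u - v) - (E u - E v)) = 0%E.
Proof.
move=> u2 v2; have uv2 := L2B u2 v2; apply/eqP; rewrite eq_le norm2_ge0 andbT.
apply/lee_addgt0Pr => e e0; rewrite add0e.
(* The two parts of the final estimate are 16 c d each, and the triangle inequality doubles both. *)
pose d := e / (64 * c).
have cc : 0 < 64 * c by rewrite mulr_gt0.
have d0 : 0 < d by rewrite divr_gt0.
have [p Sp] := schwartz_dense2 d0 u2; rewrite norm2_sub => pu.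
have [q Sq] := schwartz_dense2 d0 v2; rewrite norm2_sub => qv.
have Spq := schwartz_sub Sp Sq.
have Eu := schwartz_extension_L2 u2; have Ev := schwartz_extension_L2 v2.
have Euv := schwartz_extension_L2 uv2.
have c4 : (0 <= (4 * c)%:E :> \bar R)%E by rewrite lee_fin mulr_ge0// ltW.
have mp := schwartz_cmeasurable Sp; have mq := schwartz_cmeasurable Sq.
have B (x y : \bar R) : (x <= d%:E -> y <= d%:E -> 2%:E * x + 2%:E * y <= (4 * d)%:E)%E.
  move=> xd yd; apply: (@le_trans _ _ (2%:E * d%:E + 2%:E * d%:E)%E).
    by apply: leeD; apply: lee_wpmul2l.
  by rewrite -[leLHS]/((2 * d + 2 * d)%:E) lee_fin; lra.
have pq : (norm2 ((p - q) - (u - v)) <= (4 * d)%:E)%E.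
  have -> : (p - q) - (u - v) = (p - u) + - (q - v).
    by rewrite !opprB addrACA [RHS]addrACA; congr (_ + _); rewrite addrC.
  apply: le_trans (norm2D_le (cmeasurableB mp u2.1)
    (cmeasurableN (cmeasurableB mq v2.1))) _.
  by rewrite norm2N; exact: B.
have h1 : (norm2 (E (u - v) - T (p - q)%R) <= (16 * c * d)%:E)%E.
  rewrite norm2_sub; apply: le_trans (schwartz_extension_near uv2 Spq) _.
  rewrite (_ : (16 * c * d)%:E = (4 * c)%:E * (4 * d)%:E)%E; last first.
    by rewrite -EFinM; congr EFin; ring.
  exact: lee_wpmul2l.
have h2 : (norm2 (T (p - q)%R - (E u - E v)) <= (16 * c * d)%:E)%E.
  rewrite TB// (_ : _ - _ = (T p - E u) + - (T q - E v)); last first.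
    by rewrite !opprB addrACA [RHS]addrACA; congr (_ + _); rewrite addrC.
  apply: le_trans (norm2D_le (cmeasurableB (schwartz_cmeasurable (TS Sp)) Eu.1)
    (cmeasurableN (cmeasurableB (schwartz_cmeasurable (TS Sq)) Ev.1))) _.
  rewrite norm2N.
  apply: (@le_trans _ _ (2%:E * ((4 * c)%:E * d%:E) + 2%:E * ((4 * c)%:E * d%:E))%E).
    apply: leeD; apply: lee_wpmul2l => //.
      by apply: le_trans (schwartz_extension_near u2 Sp) _; exact: lee_wpmul2l.
    by apply: le_trans (schwartz_extension_near v2 Sq) _; exact: lee_wpmul2l.
  by rewrite -[leLHS]/((2 * (4 * c * d) + 2 * (4 * c * d))%:E) lee_fin; lra.
apply: le_trans (norm2B_le Euv.1 (schwartz_cmeasurable (TS Spq)) (cmeasurableB Eu.1 Ev.1)) _.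
apply: (@le_trans _ _ (2%:E * (16 * c * d)%:E + 2%:E * (16 * c * d)%:E)%E).
  by apply: leeD; apply: lee_wpmul2l.
rewrite -[leLHS]/((2 * (16 * c * d) + 2 * (16 * c * d))%:E) lee_fin.
rewrite (_ : _ + _ = d * (64 * c)); last by ring.
by rewrite /d divfK// gt_eqF.
Qed.

End schwartz_extension.

Section almost_everywhere.
Context d (T : measurableType d) (R : realType) (mu : {measure set T -> \bar R}).

Lemma aeS (P Q : T -> Prop) : (forall x, P x -> Q x) ->
  (\forall x \ae mu, P x) -> \forall x \ae mu, Q x.
Proof. by move=> PQ h; apply: filterS h. Qed.

Lemma aeS2 (P Q S : T -> Prop) : (forall x, P x -> Q x -> S x) ->
  (\forall x \ae mu, P x) -> (\forall x \ae mu, Q x) -> \forall x \ae mu, S x.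
Proof. by move=> PQ hP hQ; apply: filterS2 hP hQ. Qed.

End almost_everywhere.

Section fourier_L2.
Context {R : realType} {n : nat}.
Local Notation Rn := 'rV[R]_n.
Local Notation LT := (lebesgueType R n).
Local Notation leb := (@leb R n).
Local Notation c := (@fourier_cst R n).
Local Notation Re := (@complex.Re R).
Local Notation Im := (@complex.Im R).
Local Notation normc := Normc.normc.
Implicit Types (u v w f g a : Rn -> R[i]).

Lemma norm2_eq0P u : cmeasurable u -> norm2 u = 0%E <-> \forall x \ae leb, u x = 0.
Proof.
move=> mu; apply: (iff_trans (lint_eq0P leb (rmeas_sqn mu) (fun x => sqn_ge0 _))).
split=> h; apply: aeS h => x; first exact: sqn_eq0.
by move=> ->; rewrite sqn0.
Qed.

Lemma norm2B_eq0P u v : cmeasurable u -> cmeasurable v ->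
  norm2 (u - v) = 0%E <-> \forall x \ae leb, u x = v x.
Proof.
move=> mu mv; apply: (iff_trans (norm2_eq0P (cmeasurableB mu mv))).
split=> h; apply: aeS h => x h.
  by apply/eqP; rewrite -subr_eq0; apply/eqP.
by rewrite -[LHS]/(u x - v x) h subrr.
Qed.

Lemma norm2_ae u v : cmeasurable u -> cmeasurable v -> (\forall x \ae leb, u x = v x) ->
  norm2 u = norm2 v.
Proof.
move=> mu mv uv; apply: (lint_ae_eq (rmeas_sqn mu) (rmeas_sqn mv));
  [by move=> x; exact: sqn_ge0|by move=> x; exact: sqn_ge0|].
by apply: aeS uv => x ->.
Qed.

(* An equality of functions, not merely almost everywhere: the set from which
   continuous_extension chooses depends on u only through seminorms. *)
Lemma schwartz_extension_ae T u v : L2 u -> L2 v -> (\forall x \ae leb, u x = v x) ->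
  continuous_extension (@cLnorm R n 2%:E) (@cLnorm R n 2%:E) (@schwartz R n) (cLp 2%:E) T u =
  continuous_extension (@cLnorm R n 2%:E) (@cLnorm R n 2%:E) (@schwartz R n) (cLp 2%:E) T v.
Proof.
have H u' v' : L2 u' -> L2 v' -> (\forall x \ae leb, u' x = v' x) ->
    forall u_ : nat -> Rn -> R[i], (forall k, schwartz (u_ k)) ->
    (fun k => cLnorm 2%:E (u_ k - u')) @ \oo --> 0%E ->
    (fun k => cLnorm 2%:E (u_ k - v')) @ \oo --> 0%E.
  move=> u2 v2 uv u_ Su /cLnorm2_cvg h; apply/cLnorm2_cvg.
  rewrite (_ : (fun k => _) = (fun k => norm2 (u_ k - u'))) //; apply/funext => k.
  have mk := schwartz_cmeasurable (Su k).
  apply: (norm2_ae (cmeasurableB mk v2.1) (cmeasurableB mk u2.1)).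
  by apply: aeS uv => x e; rewrite -[LHS]/(u_ k x - v' x) -e.
move=> u2 v2 uv; have vu : \forall x \ae leb, v x = u x by exact: aeS uv.
rewrite /continuous_extension; congr (xget 0 _); apply/seteqP.
by split => w [Yw [u_ [Su cu cT]]]; split => //; exists u_; split => //;
  [exact: (H u v)|exact: (H v u)].
Qed.

Let c0 : 0 < c := @fourier_cst_gt0 R n.
Let c0' : 0 < c^-1. Proof. by rewrite invr_gt0. Qed.

Let FS : forall u, schwartz u -> schwartz (schwartz_fourier u) := @schwartz_fourier_schwartz R n.
Let FB u v (Su : schwartz u) (Sv : schwartz v) := schwartz_fourierB (schwartz_cL1 Su) (schwartz_cL1 Sv).

Lemma fourier_L2 u : L2 u -> L2 (fourier u).
Proof. exact: (schwartz_extension_L2 c0 FS FB (@norm2_fourier R n)). Qed.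

Lemma ifourier_L2 u : L2 u -> L2 (ifourier u).
Proof.
exact: (schwartz_extension_L2 c0' (@schwartz_ifourier_schwartz R n)
  (@schwartz_ifourierB R n) (@norm2_ifourier R n)).
Qed.

Lemma fourierB_ae u v : L2 u -> L2 v ->
  \forall x \ae leb, fourier (u - v) x = fourier u x - fourier v x.
Proof.
move=> u2 v2; have Fu := fourier_L2 u2; have Fv := fourier_L2 v2.
apply/(norm2B_eq0P (v := fourier u - fourier v) (fourier_L2 (L2B u2 v2)).1 (cmeasurableB Fu.1 Fv.1)).
exact: (schwartz_extensionB c0 FS FB (@norm2_fourier R n)).
Qed.

Lemma ifourierB_ae u v : L2 u -> L2 v ->
  \forall x \ae leb, ifourier (u - v) x = ifourier u x - ifourier v x.
Proof.
move=> u2 v2; have Fu := ifourier_L2 u2; have Fv := ifourier_L2 v2.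
apply/(norm2B_eq0P (v := ifourier u - ifourier v) (ifourier_L2 (L2B u2 v2)).1 (cmeasurableB Fu.1 Fv.1)).
exact: (schwartz_extensionB c0' (@schwartz_ifourier_schwartz R n)
  (@schwartz_ifourierB R n) (@norm2_ifourier R n)).
Qed.

Lemma fourier_schwartz_ae u : schwartz u ->
  \forall x \ae leb, fourier u x = schwartz_fourier u x.
Proof.
move=> Su; apply/(norm2B_eq0P (fourier_L2 (schwartz_L2 Su)).1 (schwartz_cmeasurable (FS Su))).
exact: (schwartz_extension_schwartz c0 FS FB (@norm2_fourier R n)).
Qed.

Lemma ifourier_schwartz_ae u : schwartz u ->
  \forall x \ae leb, ifourier u x = schwartz_ifourier u x.
Proof.
move=> Su; apply/(norm2B_eq0P (ifourier_L2 (schwartz_L2 Su)).1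
  (schwartz_cmeasurable (schwartz_ifourier_schwartz Su))).
exact: (schwartz_extension_schwartz c0' (@schwartz_ifourier_schwartz R n)
  (@schwartz_ifourierB R n) (@norm2_ifourier R n)).
Qed.

Lemma norm1B_ge u v : cL1 u -> cL1 v -> norm1 v <= norm1 u + norm1 (u - v).
Proof.
move=> [ur ui] [vr vi].
have N (h : LT -> R) : L1 leb h -> L1 leb (fun x : LT => `|h x|) by exact: L1_norm.
have dr : L1 leb (fun x : LT => Re ((u - v) x)).
  by apply: L1_ext (L1B ur vr) => x; rewrite -cReB.
have di : L1 leb (fun x : LT => Im ((u - v) x)).
  by apply: L1_ext (L1B ui vi) => x; rewrite -cImB.
rewrite /norm1 -rintD; [|exact: L1D (N _ ur) (N _ ui)|exact: L1D (N _ dr) (N _ di)].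
apply: rint_le; first exact: L1D (N _ vr) (N _ vi).
  exact: L1D (L1D (N _ ur) (N _ ui)) (L1D (N _ dr) (N _ di)).
move=> x; rewrite -[(u - v) x]/(u x - v x) cReB cImB.
have h1 := ler_normB (Re (u x)) (Re (u x) - Re (v x)).
have h2 := ler_normB (Im (u x)) (Im (u x) - Im (v x)).
rewrite !subKr in h1 h2.
move: h1 h2; lra.
Qed.

(* The pointwise bound passes from Schwartz functions close to g in L1 and L2:
   the part of |ifourier g| above the bound has small L2 norm. *)
Lemma ifourier_ae_le g : cL1 g -> L2 g ->
  \forall x \ae leb, normc (ifourier g x) <= 2 * c^-1 * norm1 g.
Proof.
move=> g1 g2; set B := 2 * c^-1 * norm1 g.
have G2 := ifourier_L2 g2.
suff H d : 0 < d -> \forall x \ae leb, normc (ifourier g x) <= B + d.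
  have : \forall x \ae leb, forall k, normc (ifourier g x) <= B + k.+1%:R^-1.
    by apply/ae_foralln => k; exact: H.
  apply: aeS => x h; apply/ler_addgt0Pr => e e0.
  have [k _ hk] : \forall k \near \oo, k.+1%:R^-1 < e by exact: near_infty_natSinv_lt (PosNum e0).
  by apply: le_trans (h k) _; rewrite lerD2l ltW// hk/=.
move=> d0.
(* The square of the positive part of sqrt t - (B + d), to be applied to the squared modulus. *)
pose h (t : R) := (2^-1 * (`|Num.sqrt t - (B + d)| + (Num.sqrt t - (B + d)))) ^+ 2.
have ch : continuous h.
  move=> t; apply: (@continuous_comp _ _ _ (fun t : R => 2^-1 * (`|Num.sqrt t - (B + d)| + (Num.sqrt t - (B + d)))) (fun t => t ^+ 2)); last exact: exprn_continuous.
  have cs : {for t, continuous (fun t : R => Num.sqrt t - (B + d))}.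
    by apply: cvgB; [exact: sqrt_continuous|exact: cvg_cst].
  apply: cvgM; first exact: cvg_cst.
  by apply: cvgD => //; exact: cvg_norm.
have h0 t : 0 <= h t by exact: sqr_ge0.
have mh : rmeas (fun x : LT => h (sqn (ifourier g x))) := rmeas_comp ch (rmeas_sqn G2.1).
have hz : lint leb (fun x : LT => h (sqn (ifourier g x))) = 0%E.
  apply/eqP; rewrite eq_le lint_ge0// andbT.
  apply/lee_addgt0Pr => e e0; rewrite add0e.
  (* One condition makes the L2 error of the inverse transforms at most e; the other keeps the
     inverse transform of the Schwartz approximation below B + d. *)
  have [e1 e10 [e1e e1d]] : exists2 e1, 0 < e1 & 4 * c^-1 * e1 <= e /\ 2 * c^-1 * e1 <= d.
    have p4 : 0 < 4 * c^-1 by rewrite mulr_gt0.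
    have p2 : 0 < 2 * c^-1 by rewrite mulr_gt0.
    exists (Num.min (e / (4 * c^-1)) (d / (2 * c^-1))).
      rewrite lt_min; apply/andP; split.
        by apply: divr_gt0 e0 p4.
      by apply: divr_gt0 d0 p2.
    by split; rewrite mulrC -ler_pdivlMr// ge_min lexx ?orbT.
  have [v [Sv v2 v1]] := schwartz_dense12 e10 g1 g2.
  have hv x : normc (schwartz_ifourier v x) <= B + d.
    apply: le_trans (ifourier_le x Sv) _; rewrite /B; apply: le_trans (lerD (lexx _) e1d).
    rewrite -mulrDr ler_pM2l ?mulr_gt0//.
    by apply: le_trans (norm1B_ge g1 (schwartz_cL1 Sv)) _; rewrite lerD2l.
  have m2 := cmeasurableB (schwartz_cmeasurable (schwartz_ifourier_schwartz Sv)) G2.1.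
  apply: (@le_trans _ _ (norm2 (schwartz_ifourier v - ifourier g))).
    apply: (lint_le leb mh (rmeas_sqn m2) (fun x => h0 _)) => x.
    rewrite /h -normcE -normc_sqr -[(schwartz_ifourier v - ifourier g) x]/(schwartz_ifourier v x - ifourier g x) normc_sub.
    set p := normc (ifourier g x).
    have q0 := normc_ge0 (ifourier g x - schwartz_ifourier v x).
    have [le|ge] := lerP (p - (B + d)) 0.
      by rewrite ler0_norm// addNr mulr0 expr0n sqr_ge0.
    rewrite gtr0_norm// (_ : 2^-1 * _ = p - (B + d)); last by field.
    rewrite ler_pXn2r ?nnegrE//; last exact: ltW.
    apply: le_trans _ (normc_dist _ _); have := hv x; rewrite -/p; lra.
  apply: le_trans (schwartz_extension_near c0' (@schwartz_ifourier_schwartz R n)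
    (@schwartz_ifourierB R n) (@norm2_ifourier R n) g2 Sv) _.
  rewrite norm2_sub; apply: (@le_trans _ _ ((4 * c^-1)%:E * e1%:E)%E).
    by apply: lee_wpmul2l => //; rewrite lee_fin mulr_ge0// ltW.
  by rewrite -EFinM lee_fin.
move/(lint_eq0P leb mh (fun x => h0 _)) : hz; apply: aeS => x.
rewrite /h -normcE => /eqP; rewrite sqrf_eq0 mulf_eq0 invr_eq0 pnatr_eq0 /= => /eqP.
have [le _|ge] := lerP (normc (ifourier g x) - (B + d)) 0; first by rewrite -subr_le0.
rewrite gtr0_norm//; lra.
Qed.

End fourier_L2.

(** * Multiplier operators with bounded symbols *)

Section bounded_multiplier.
Context {R : realType} {n : nat}.
Local Notation Rn := 'rV[R]_n.
Local Notation LT := (lebesgueType R n).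
Local Notation leb := (@leb R n).
Local Notation c := (@fourier_cst R n).
Local Notation Re := (@complex.Re R).
Local Notation Im := (@complex.Im R).
Local Notation normc := Normc.normc.
Local Notation cosA := (@cosft R n 0).
Local Notation cosB := (@cosft R n (- (pi / 2))).
Implicit Types (u v w f g a : Rn -> R[i]).

Lemma normcM (z w : R[i]) : normc (z * w) = normc z * normc w.
Proof.
apply/eqP; rewrite -(@eqrXn2 _ 2) ?mulr_ge0 ?normc_ge0//.
by rewrite exprMn !normc_sqr sqnM.
Qed.

Lemma rmeas_normc u : cmeasurable u -> rmeas (fun x : LT => normc (u x)).
Proof.
move=> mu; apply: rmeas_ext (rmeas_comp (@sqrt_continuous R) (rmeas_sqn mu)) => x.
by rewrite normcE.
Qed.

Lemma cmeasurableM a u : cmeasurable a -> cmeasurable u -> cmeasurable (fun x => a x * u x).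
Proof.
move=> [ar ai] [ur ui]; split.
- by apply: rmeas_ext (rmeasB (rmeasM ar ur) (rmeasM ai ui)) => x; rewrite cReM.
- by apply: rmeas_ext (rmeasD (rmeasM ar ui) (rmeasM ai ur)) => x; rewrite cImM.
Qed.

Lemma L2M a u (M : R) : cmeasurable a -> (forall x, normc (a x) <= M) -> L2 u ->
  L2 (fun x => a x * u x).
Proof.
move=> ma aM [mu u2]; have mau := cmeasurableM ma mu; split => //.
have M2 : 0 <= M ^+ 2 by exact: sqr_ge0.
apply: (@le_lt_trans _ _ ((M ^+ 2)%:E * norm2 u)%E).
  rewrite /norm2 -(lintZ leb (rmeas_sqn mu) (fun x => sqn_ge0 _) M2).
  apply: (lint_le leb (rmeas_sqn mau) (rmeasM (rmeas_cst _) (rmeas_sqn mu)) (fun x => sqn_ge0 _)) => x.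
  rewrite sqnM ler_wpM2r ?sqn_ge0// -normc_sqr ler_pXn2r ?nnegrE ?normc_ge0//.
  exact: le_trans (normc_ge0 _) (aM x).
by rewrite lte_mul_pinfty// ?lee_fin.
Qed.

(** On a space of positive measure the norm of order infinity is an essential supremum. It is not
    -oo, for otherwise the whole space would be null. *)
Lemma cLp_infty_bound a : (0 < leb setT)%E -> cLp +oo%E a ->
  exists2 M, 0 <= M & \forall x \ae leb, normc (a x) <= M.
Proof.
move=> lT [ma]; rewrite /cLnorm unlock lT => h.
set s := ess_sup _ _ in h.
have s0 := ess_sup_ge (leb : {measure set LT -> \bar R}) (abse \o cabs a).
have ns : s != -oo%E.
  apply/eqP => sN; have [A [mA A0 hA]] := s0.
  have AT : A = setT by apply/seteqP; split => // x _; apply: hA => /=; rewrite -/s sN leeNy_eq.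
  by move: lT; rewrite -AT A0 ltxx.
exists `|fine s| => //; apply: aeS s0 => x /=; rewrite -/s => hx.
have sf : s \is a fin_num by rewrite fin_numElt ltNye ns.
rewrite -(fineK sf) lee_fin ger0_norm ?normc_ge0// in hx.
exact: le_trans hx (ler_norm _).
Qed.

(** A representative bounded everywhere rather than almost everywhere, so that the bound can be used
    at a single frequency eta. *)
Definition clip (M : R) a : Rn -> R[i] := fun x => if normc (a x) <= M then a x else 0.

Lemma clip_le (M : R) a x : 0 <= M -> normc (clip M a x) <= M.
Proof.
by move=> M0; rewrite /clip; case: ifP => // _; rewrite normcE sqn0 sqrtr0.
Qed.

Lemma clip_ae (M : R) a : (\forall x \ae leb, normc (a x) <= M) ->
  \forall x \ae leb, a x = clip M a x.
Proof. by apply: aeS => x; rewrite /clip => ->. Qed.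

Lemma cmeasurable_clip (M : R) a : cmeasurable a -> cmeasurable (clip M a).
Proof.
move=> ma; have mn := rmeas_normc ma.
pose B := [set x : LT | normc (a x) <= M].
have mB : measurable B.
  have -> : B = (fun x : LT => normc (a x)) @^-1` `]-oo, M].
    by apply/seteqP; split => x; rewrite /B/= in_itv.
  by rewrite -[X in measurable X]setTI; exact: (mn measurableT _ (measurable_itv _)).
have mi := @rmeas_indic _ LT R B mB.
have iE x : (\1_B x : R) = if normc (a x) <= M then 1 else 0.
  by rewrite indicE; case: ifP => h; [rewrite mem_set|rewrite memNset// /B/= h].
split.
- have h : rmeas (fun x : LT => (\1_B x : R) * Re (a x)) := rmeasM mi ma.1.
  apply: rmeas_ext h => x; rewrite iE /clip.
  by case: ifP => _; rewrite ?mul1r ?mul0r.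
- have h : rmeas (fun x : LT => (\1_B x : R) * Im (a x)) := rmeasM mi ma.2.
  apply: rmeas_ext h => x; rewrite iE /clip.
  by case: ifP => _; rewrite ?mul1r ?mul0r.
Qed.

Lemma schwartz_scale (z : R[i]) u : schwartz u -> schwartz (fun x => z * u x).
Proof.
move=> [Sr Si]; split.
- rewrite (_ : (fun x => _) = (fun x => Re z * Re (u x) - Im z * Im (u x))).
    by apply: schwartzB; apply: schwartzZ.
  by apply/funext => x; rewrite cReM.
- rewrite (_ : (fun x => _) = (fun x => Re z * Im (u x) + Im z * Re (u x))).
    by apply: schwartzD; apply: schwartzZ.
  by apply/funext => x; rewrite cImM.
Qed.

Lemma schwartz_fourierZ (z : R[i]) u : schwartz u ->
  schwartz_fourier (fun x => z * u x) = fun xi => z * schwartz_fourier u xi.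
Proof.
move=> Su; have u1 := schwartz_cL1 Su; have zu1 := schwartz_cL1 (schwartz_scale z Su).
have [ur ui] := u1.
have rE : (fun x => Re (z * u x)) = (fun x => Re z * Re (u x) + - Im z * Im (u x)).
  by apply/funext => x; rewrite cReM mulNr.
have iE : (fun x => Im (z * u x)) = (fun x => Re z * Im (u x) + Im z * Re (u x)).
  by apply/funext => x; rewrite cImM.
have E th (s t : R) (f g : Rn -> R) xi : L1 leb f -> L1 leb g ->
    cosft th (fun x => s * f x + t * g x) xi = s * cosft th f xi + t * cosft th g xi.
  by move=> f1 g1; rewrite cosftD ?cosftZ//; exact: L1Z.
apply/funext => xi; apply: complex_ext.
- by rewrite Re_fourier// cReM Re_fourier// Im_fourier// rE iE !E//; ring.
- by rewrite Im_fourier// cImM Re_fourier// Im_fourier// rE iE !E//; ring.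
Qed.

Section bounded.
Variables (a : Rn -> R[i]) (M : R).
Hypothesis ma : cmeasurable a.
Hypothesis aM : forall x, normc (a x) <= M.

Let L2aF u : L2 u -> L2 (fun xi => a xi * fourier u xi).
Proof. by move=> u2; exact: (L2M ma aM (fourier_L2 u2)). Qed.

Lemma multiplier_op_L2 u : L2 u -> L2 (multiplier_op a u).
Proof. by move=> /L2aF /ifourier_L2. Qed.

Lemma multiplier_opB_ae u v : L2 u -> L2 v ->
  \forall x \ae leb, multiplier_op a (u - v) x = multiplier_op a u x - multiplier_op a v x.
Proof.
move=> u2 v2; have h := ifourierB_ae (L2aF u2) (L2aF v2).
rewrite /multiplier_op /ifourier (schwartz_extension_ae schwartz_ifourier (L2aF (L2B u2 v2))
  (L2B (L2aF u2) (L2aF v2))) //.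
apply: aeS (fourierB_ae u2 v2) => x ->.
by rewrite -[RHS]/(a x * fourier u x - a x * fourier v x) mulrBr.
Qed.

Lemma multiplier_op_ae u v : L2 u -> L2 v -> (\forall x \ae leb, u x = v x) ->
  multiplier_op a u = multiplier_op a v.
Proof.
by move=> u2 v2 uv; rewrite /multiplier_op /fourier (schwartz_extension_ae _ u2 v2 uv).
Qed.

(** Both values are chosen from the same set, hence are equal as functions. This lets a bounded
    representative replace the symbol without null sets to carry along. *)
Lemma multiplier_symbol_ae b u : cmeasurable b -> (\forall x \ae leb, b x = a x) -> L2 u ->
  multiplier_op b u = multiplier_op a u.
Proof.
move=> mb ab u2; have au := L2aF u2; have Fu := fourier_L2 u2.
have bu : \forall x \ae leb, b x * fourier u x = a x * fourier u x.
  by apply: aeS ab => x ->.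
have b2 : L2 (fun x => b x * fourier u x).
  have mbu := cmeasurableM mb Fu.1.
  by split => //; rewrite (norm2_ae mbu au.1 bu); exact: au.2.
exact: (schwartz_extension_ae _ b2 au bu).
Qed.

Let diff (z : R[i]) f xi := (a xi - z) * schwartz_fourier f xi.

Lemma multiplier_diff_cL1 z f : schwartz f -> cL1 (diff z f).
Proof.
move=> Sf; have SF := schwartz_fourier_schwartz Sf.
have [Fr Fi] := schwartz_cL1 SF.
have mz : cmeasurable (fun x : Rn => a x - z).
  have mzc : cmeasurable (fun _ : Rn => z) by split; exact: rmeas_cst.
  exact: (cmeasurableB ma mzc).
have md := cmeasurableM mz (schwartz_cmeasurable SF).
have g1 : L1 leb (fun x : LT => (M + normc z) *
    (`|Re (schwartz_fourier f x)| + `|Im (schwartz_fourier f x)|)).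
  by apply: L1Z; apply: L1D; exact: L1_norm.
have dle x : normc (diff z f x) <= (M + normc z) *
    (`|Re (schwartz_fourier f x)| + `|Im (schwartz_fourier f x)|).
  rewrite /diff normcM; apply: ler_pM; [exact: normc_ge0|exact: normc_ge0| |exact: normc_le].
  by apply: le_trans (normcB _ _) _; rewrite lerD2r.
split.
- by apply: L1_dom md.1 _ g1 => x; apply: le_trans (Re_le_normc _) (dle x).
- by apply: L1_dom md.2 _ g1 => x; apply: le_trans (Im_le_normc _) (dle x).
Qed.

(** F^-1 a F f - z f is F^-1 of (a - z) F f, and an inverse transform is bounded by the L1 norm of
    its argument. This is the form of estimate that a lattice norm can exploit. *)
Lemma multiplier_op_schwartz_le z f : schwartz f ->
  \forall x \ae leb, normc (multiplier_op a f x - z * f x) <=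
    2 * c^-1 * norm1 (fun xi => (a xi - z) * schwartz_fourier f xi).
Proof.
move=> Sf; have SF := schwartz_fourier_schwartz Sf; have f2 := schwartz_L2 Sf.
have aF2 : L2 (fun xi => a xi * schwartz_fourier f xi) := L2M ma aM (schwartz_L2 SF).
have Szf := schwartz_scale z Sf.
have SzF := schwartz_fourier_schwartz Szf.
have zF := schwartz_fourierZ z Sf.
have mE : multiplier_op a f = ifourier (fun xi => a xi * schwartz_fourier f xi).
  apply: (schwartz_extension_ae _ (L2aF f2) aF2).
  by apply: aeS (fourier_schwartz_ae Sf) => x ->.
have dE : diff z f = (fun xi => a xi * schwartz_fourier f xi) - schwartz_fourier (fun x => z * f x).
  by rewrite zF; apply/funext => xi; rewrite /diff mulrBl.
have d2 : L2 (diff z f) by rewrite dE; exact: L2B aF2 (schwartz_L2 SzF).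
have h1 := ifourier_ae_le (multiplier_diff_cL1 z Sf) d2.
have h2 := ifourierB_ae aF2 (schwartz_L2 SzF).
have h3 := ifourier_schwartz_ae SzF.
rewrite schwartz_ifourierE// schwartz_fourierK// in h3.
rewrite -dE -mE in h2.
have h4 : \forall x \ae leb, ifourier (diff z f) x = multiplier_op a f x - z * f x.
  by apply: aeS2 h2 h3 => x -> ->.
by apply: aeS2 h4 h1 => x <-.
Qed.

End bounded.

End bounded_multiplier.

(** * Wave packets *)

Section fubini_measurability.
Context {d1 d2} {T1 : measurableType d1} {T2 : measurableType d2} {R : realType}.
Context (m1 : {sigma_finite_measure set T1 -> \bar R}).

Lemma rmeas_rint (F : T1 * T2 -> R) : rmeas F -> (forall p, 0 <= F p) ->
  rmeas (fun y => rint m1 (fun x => F (x, y))).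
Proof.
move=> mF F0.
have F0' p : (0 <= (F p)%:E)%E by rewrite lee_fin.
have h := @measurable_fun_fubini_tonelli_G _ _ _ _ _ m1 _ (rmeas_EFin mF) F0'.
exact: (measurableT_comp (fine_measurable measurableT) h).
Qed.

End fubini_measurability.

Section points_of_small_value.
Context d {T : measurableType d} {R : realType} (mu : {measure set T -> \bar R}).

(** Otherwise the sum of the [V i] exceeds s at each point of E, and integration over E contradicts
    m e < s mu(E). *)
Lemma exists_small_point (E : set T) m (V : 'I_m -> T -> R) (e s : R) :
  measurable E -> (mu E < +oo)%E -> (forall i x, 0 <= V i x) ->
  (forall i, L1 mu (fun x => \1_E x * V i x)) ->
  (forall i, rint mu (fun x => \1_E x * V i x) <= e) ->
  m%:R * e < s * fine (mu E) ->
  exists2 x, E x & forall i, V i x <= s.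
Proof.
move=> mE Eoo V0 V1 Ve mes; apply: contrapT => H.
have {}H x : E x -> s < \sum_i V i x.
  move=> Ex; rewrite ltNge; apply/negP => h; apply: H; exists x => // i.
  by apply: le_trans h; rewrite (bigD1 i)//= lerDl sumr_ge0.
have Ef : mu E \is a fin_num by rewrite ge0_fin_numE.
have i1 : L1 mu (\1_E : T -> R).
  apply/L1P; split; first exact: rmeas_indic.
  rewrite (_ : lint _ _ = mu E)//.
  rewrite /lint (eq_integral (fun x => (\1_E x)%:E))//; first by rewrite integral_indic// setIT.
  by move=> x _; rewrite ger0_norm.
have iE : rint mu (\1_E : T -> R) = fine (mu E).
  by rewrite /rint /Rintegral integral_indic// setIT.
have : rint mu (fun x => s * \1_E x) <= rint mu (fun x => \sum_i (\1_E x * V i x)).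
  apply: rint_le; [exact: L1Z i1|exact: L1_sum|] => x.
  rewrite -mulr_sumr indicE; have [Ex|nEx] := boolP (x \in E).
    by rewrite mulr1 mul1r ltW// H// -in_setE.
  by rewrite mulr0 mul0r.
rewrite rintZ// iE rint_sum// leNgt => /negP; apply; apply: le_lt_trans mes.
apply: (@le_trans _ _ (\sum_(i < m) e)); first exact: ler_sum.
by rewrite sumr_const card_ord mulr_natl.
Qed.

End points_of_small_value.

Section test_functions.
Context {R : realType} {n : nat}.
Local Notation Rn := 'rV[R]_n.
Local Notation LT := (lebesgueType R n).
Local Notation leb := (@leb R n).
Local Notation Re := (@complex.Re R).
Local Notation Im := (@complex.Im R).
Local Notation normc := Normc.normc.
Local Notation A := (@cosft R n 0).
Local Notation B := (@cosft R n (- (pi / 2))).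

Lemma schwartz_lip (f : Rn -> R) : real_schwartz f -> exists2 L, 0 <= L &
  forall x y, `|f x - f y| <= L * `|x - y|.
Proof.
move=> Sf; have df := schwartz_diffble Sf.
have /choice[C hC] i : exists C, 0 <= C /\ forall x, `|pderiv i f x| <= C.
  have [C C0 hC] := rapid_bounded (schwartz_rapid (schwartz_pderiv i Sf)).
  by exists C.
exists (\sum_i C i); first by apply: sumr_ge0 => i _; exact: (hC i).1.
have key z h : `|'D_h f z| <= (\sum_i C i) * `|h|.
  rewrite deriveE// {1}(row_sum_delta h) linear_sum mulr_suml.
  apply: le_trans (ler_norm_sum _ _ _) _; apply: ler_sum => i _.
  rewrite linearZ /= normrM mulrC ler_pM//; last exact: rV_norm_coord.
  by have := (hC i).2 z; rewrite /pderiv deriveE.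
move=> x y.
have := @mean_value_le R (fun s : R => f (y + s *: (x - y))) _ ((\sum_i C i) * `|x - y|) 0 1
  (fun t => is_derive_line (x - y) y t df).
rewrite scale0r addr0 scale1r (addrC y) subrK subr0 normr1 mulr1; apply => t _.
exact: key.
Qed.

Lemma exists_cutoff (t e : R) : 1 < t -> 0 < e -> exists f : Rn -> R,
  [/\ real_schwartz f, forall x, 0 <= f x <= 1,
      forall x, euclid_norm x <= 1 -> 1 - e <= f x &
      forall x, t <= euclid_norm x -> f x = 0].
Proof.
move=> t1 e0; have t0 : 0 < t by exact: lt_trans t1.
have d0 : 0 < t ^+ 2 - 1 by rewrite subr_gt0 exprn_egt1.
(* On the unit ball the argument P is then at least 1/e, and exp(-1/P) >= 1 - 1/P >= 1 - e. *)
pose k := (e * (t ^+ 2 - 1))^-1.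
have k0 : 0 < k by rewrite invr_gt0 mulr_gt0.
pose P (x : Rn) := k * (t ^+ 2 - \sum_i x ord0 i ^+ 2).
exists (fun x => flat_exp 0 (P x)); split.
- apply: (@schwartz_flat _ _ _ _ t); first by apply: slowM (slow_cst _) (slow_bump_arg _).
  move=> x; rewrite /P pmulr_rgt0// subr_gt0 -sqr_euclid_norm => xt.
  apply: le_trans (rV_norm_le_euclid x) _; apply: ltW; move: xt.
  by rewrite ltr_pXn2r ?nnegrE ?euclid_norm_ge0// ltW.
- by move=> x; rewrite flat_exp_ge0 -[leRHS](expr0 (0 : R)) flat_exp_le.
- move=> x x1; have kd : e^-1 <= P x.
    rewrite /P /k invfM -mulrA ler_peMr ?invr_ge0 ?(ltW e0)//.
    rewrite ler_pdivlMl// mulr1 lerD2l lerN2 -sqr_euclid_norm.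
    by rewrite -[leRHS](expr1n _ 2) ler_pXn2r ?nnegrE ?euclid_norm_ge0.
  have P0 : 0 < P x by apply: lt_le_trans kd; rewrite invr_gt0.
  rewrite /flat_exp P0 expr0 invr1 mul1r; apply: le_trans (expR_ge1Dx _).
  by rewrite lerD2l lerN2 -[leRHS]invrK lef_pV2 ?posrE ?invr_gt0.
- move=> x tx; rewrite /flat_exp ifF//; apply/negbTE; rewrite -leNgt.
  rewrite /P pmulr_rle0// subr_le0 -sqr_euclid_norm.
  by rewrite ler_pXn2r ?nnegrE ?euclid_norm_ge0// ltW.
Qed.

Lemma cosft_affine th (s : R) (y xi : Rn) (f : Rn -> R) : s != 0 -> L1 leb f ->
  cosft th (fun x => f (s *: x + y)) xi =
  `|s^-1| ^+ n * cosft (th - dot y (s^-1 *: xi)) f (s^-1 *: xi).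
Proof.
move=> s0 f1; rewrite /cosft -(rint_affine y s0 (L1_wave _ _ f1)).
apply: rint_ext => x /=; congr (_ * cos _).
set z := s^-1 *: xi.
have -> : dot (s *: x + y) z = dot x xi + dot y z.
  rewrite [LHS]dotC dotDr (dotC z y) dotZr (dotC z x) /z.
  by rewrite [dot x _](dotZr s^-1 x xi) mulrA mulfV// mul1r.
by ring.
Qed.

(** Translation of a packet shows up as a phase of the transform. Bounding all phases at once makes
    the estimates independent of the centres of the balls. *)
Lemma cosft_phase_le th (f : Rn -> R) xi : L1 leb f ->
  `|cosft th f xi| <= `|A f xi| + `|B f xi|.
Proof.
move=> f1; have h1 := L1_wave xi 0 f1; have h2 := L1_wave xi (- (pi / 2)) f1.
have -> : cosft th f xi = cos th * A f xi - sin th * B f xi.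
  rewrite /cosft -!rintZ// -rintB; [|exact: L1Z|exact: L1Z].
  apply: rint_ext => x /=; rewrite cosBpihalf addr0 cosD; ring.
apply: le_trans (ler_normB _ _) _; rewrite !normrM.
by apply: lerD; rewrite ler_piMl ?cos_max ?sin_max.
Qed.

Definition kernel (f : Rn -> R) (xi : Rn) : R := `|A f xi| + `|B f xi|.

Lemma kernel_ge0 f xi : 0 <= kernel f xi. Proof. by rewrite addr_ge0. Qed.

Lemma rapid_norm (f : Rn -> R) : rapid f -> rapid (fun x => `|f x|).
Proof. by move=> rf k; have [M hM] := rf k; exists M => x; rewrite normr_id. Qed.

Lemma kernel_rapid f : real_schwartz f -> rapid (kernel f).
Proof.
move=> Sf; have h th : rapid (cosft th f) by exact: rapid_cosft.
exact: (@rapidD _ _ (fun x => `|A f x|) (fun x => `|B f x|) (@rapid_norm _ (h _)) (@rapid_norm _ (h _))).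
Qed.

Lemma kernel_continuous f : real_schwartz f -> continuous (kernel f).
Proof.
move=> Sf x; have h th : {for x, continuous (cosft th f)}.
  exact: (@schwartz_continuous _ _ _ (schwartz_cosft th Sf)).
exact: (cvgD (cvg_norm (h _)) (cvg_norm (h _))).
Qed.

(** This is exp(i eta . x) f(s x + y), the sine being a shifted cosine. The centre is -y/s, so the
    ball of radius R_j about y_j corresponds to s = 1/R_j and y = -y_j/R_j. *)
Definition wave_packet (f : Rn -> R) (s : R) (y eta : Rn) : Rn -> R[i] := fun x =>
  Complex (cos (dot x eta + 0) * f (s *: x + y))
    (cos (dot x eta + - (pi / 2)) * f (s *: x + y)).

Lemma schwartz_wave_packet f s y eta : s != 0 -> real_schwartz f ->
  schwartz (wave_packet f s y eta).
Proof.
by move=> s0 Sf; have Sa := schwartz_affine y s0 Sf; split;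
  apply: schwartz_slowM Sa; exact: slow_wave.
Qed.

Lemma normc_wave_packet f s y eta x : normc (wave_packet f s y eta x) = `|f (s *: x + y)|.
Proof.
rewrite normcE /sqn /= cosBpihalf addr0 !exprMn -mulrDl.
by rewrite [X in X * _](_ : _ = 1) ?mul1r ?sqrtr_sqr// cos2Dsin2.
Qed.

(** Modulation shifts the frequency by eta and dilation concentrates it at scale 1/r. The factor 2
    comes from bounding real and imaginary parts separately. *)
Lemma fourier_wave_packet_le f (r : R) y eta xi : 0 < r -> real_schwartz f ->
  normc (schwartz_fourier (wave_packet f r^-1 y eta) xi) <=
  2 * r ^+ n * kernel f (r *: xi - r *: eta).
Proof.
move=> r0 Sf; have s0 : r^-1 != 0 by rewrite invr_eq0 gt_eqF.
pose g x := f (r^-1 *: x + y).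
have g1 : L1 leb g := schwartz_L1 (schwartz_affine y s0 Sf).
have hR : Re (schwartz_fourier (wave_packet f r^-1 y eta) xi) = A g (xi - eta).
  apply: rint_ext => x; rewrite cReM /= cosBpihalf !addr0 dotDr dotNr cosN sinN cosB -/(g x); ring.
have hI : Im (schwartz_fourier (wave_packet f r^-1 y eta) xi) = - B g (xi - eta).
  rewrite /cosft -rintN; last exact: L1_wave.
  apply: rint_ext => x; rewrite cImM /= !cosBpihalf !addr0 dotDr dotNr cosN sinN sinB -/(g x); ring.
have E th : `|cosft th g (xi - eta)| <= r ^+ n * kernel f (r *: xi - r *: eta).
  rewrite cosft_affine//; last exact: schwartz_L1.
  rewrite invrK normrM ger0_norm ?exprn_ge0// (ger0_norm (ltW r0)) -scalerBr.
  by rewrite ler_wpM2l ?exprn_ge0 ?(ltW r0)//; apply: cosft_phase_le; exact: schwartz_L1.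
apply: le_trans (normc_le _) _; rewrite hR hI normrN -mulrA mulr_natl mulr2n.
by apply: lerD; exact: E.
Qed.

End test_functions.

(** * Smoothing by dilated kernels, averaged over frequencies *)

Section oscillation.
Context {R : realType} {n : nat}.
Local Notation Rn := 'rV[R]_n.
Local Notation LT := (lebesgueType R n).
Local Notation leb := (@leb R n).
Local Notation Re := (@complex.Re R).
Local Notation Im := (@complex.Im R).
Local Notation normc := Normc.normc.
Implicit Types (u v w f g : Rn -> R[i]).

Variable K : Rn -> R.
Hypothesis K0 : forall x, 0 <= K x.
Hypothesis cK : continuous K.
Hypothesis rK : rapid K.

Definition dilated_kernel (r : R) (xi eta : Rn) : R := r ^+ n * K (r *: xi - r *: eta).

Let K1 : L1 leb K.
Proof. exact: rapid_L1 (rmeas_continuous cK) rK. Qed.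

Lemma dilated_kernel_ge0 r xi eta : 0 < r -> 0 <= dilated_kernel r xi eta.
Proof. by move=> r0; apply: mulr_ge0 (K0 _); apply: exprn_ge0; exact: ltW. Qed.

Lemma L1_dilated (h : Rn -> R) (r : R) (eta : Rn) : 0 < r -> L1 leb h ->
  L1 leb (fun xi : LT => r ^+ n * h (r *: (xi : Rn) - r *: eta)).
Proof.
by move=> r0 h1; apply: L1Z; apply: L1_affine => //; rewrite gt_eqF.
Qed.

Lemma rint_dilated (h : Rn -> R) (r : R) (eta : Rn) : 0 < r -> L1 leb h ->
  rint leb (fun xi : LT => r ^+ n * h (r *: (xi : Rn) - r *: eta)) = rint leb h.
Proof.
move=> r0 h1; have rn0 : r != 0 by rewrite gt_eqF.
rewrite rintZ; last exact: L1_affine.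
rewrite rint_affine// ger0_norm ?invr_ge0 ?(ltW r0)// mulrA exprVn mulfV ?mul1r//.
by rewrite expf_neq0.
Qed.

(** The integral in the frequency eta, where the kernel appears reflected; this is the order of
    integration used after Fubini. *)
Lemma L1_dilated_kernel (r : R) (xi : Rn) : 0 < r ->
  L1 leb (fun eta : LT => dilated_kernel r xi eta) /\
  rint leb (fun eta : LT => dilated_kernel r xi eta) = rint leb K.
Proof.
move=> r0; have rn0 : - r != 0 by rewrite oppr_eq0 gt_eqF.
have E (eta : LT) : dilated_kernel r xi eta = r ^+ n * K ((- r) *: (eta : Rn) + r *: xi).
  by rewrite /dilated_kernel addrC scaleNr.
have h1 := L1_affine (r *: xi) rn0 K1.
split; first by apply: L1_ext (L1Z (r ^+ n) h1) => eta; rewrite E.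
rewrite (rint_ext leb E) rintZ// rint_affine// invrN normrN ger0_norm ?invr_ge0 ?(ltW r0)//.
by rewrite mulrA exprVn mulfV ?mul1r// expf_neq0// gt_eqF.
Qed.

Lemma dilated_kernel_bounded r : 0 < r -> exists2 M, 0 <= M &
  forall xi eta, `|dilated_kernel r xi eta| <= M.
Proof.
move=> r0; have [M M0 hM] := rapid_bounded rK; exists (r ^+ n * M).
  by rewrite mulr_ge0// exprn_ge0// ltW.
move=> xi eta; rewrite /dilated_kernel normrM ger0_norm; last by apply: exprn_ge0; exact: ltW.
by apply: ler_wpM2l (hM _); apply: exprn_ge0; exact: ltW.
Qed.

Lemma rmeas_dilated_kernel r : rmeas (fun p : LT * LT => dilated_kernel r p.1 p.2).
Proof.
apply: rmeasM (rmeas_cst _) _.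
apply: rmeas_ext (rmeas_continuous_lin r (- r) 0 cK) => p.
by rewrite addr0 scaleNr.
Qed.

Section smoothing.
Variables (w : Rn -> R) (E : set Rn) (r : R).
Hypothesis w1 : L1 leb w.
Hypothesis w0 : forall x, 0 <= w x.
Hypothesis E1 : L1 leb (\1_E : Rn -> R).
Hypothesis r0 : 0 < r.

Definition smoothing (eta : Rn) : R := rint leb (fun xi : LT => w xi * dilated_kernel r xi eta).

Lemma smoothing_ge0 eta : 0 <= smoothing eta.
Proof. by apply: rint_ge0 => xi; rewrite mulr_ge0 ?dilated_kernel_ge0. Qed.

Lemma L1_smoothing_integrand eta : L1 leb (fun xi : LT => w xi * dilated_kernel r xi eta).
Proof.
have [M M0 hM] := dilated_kernel_bounded r0.
have mk : rmeas (fun xi : LT => dilated_kernel r xi eta).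
  exact: (L1_rmeas (L1_dilated eta r0 K1)).
apply: (L1_dom (rmeasM (L1_rmeas w1) mk) _ (L1Z M w1)) => xi.
by rewrite normrM (ger0_norm (w0 _)) mulrC ler_wpM2r.
Qed.

Lemma L1_smoothing : L1 leb (fun eta : LT => \1_E (eta : Rn) * smoothing eta).
Proof.
have [M M0 hM] := dilated_kernel_bounded r0.
have mw : rmeas (fun p : LT * LT => w p.1 * dilated_kernel r p.1 p.2).
  apply: rmeasM (rmeas_dilated_kernel r).
  exact: (measurableT_comp (L1_rmeas w1) measurable_fst).
have ms := rmeas_rint leb mw (fun p => mulr_ge0 (w0 _) (dilated_kernel_ge0 _ _ r0)).
apply: (L1_dom (rmeasM (L1_rmeas E1) ms) _ (L1Z (M * rint leb w) E1)) => eta.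
rewrite normrM ger0_norm; last by rewrite indicE.
rewrite mulrC ler_wpM2r//.
rewrite ger0_norm; last exact: smoothing_ge0.
rewrite -rintZ//; apply: rint_le => [||xi]; [exact: L1_smoothing_integrand|exact: L1Z|].
by rewrite mulrC ler_wpM2r//; apply: le_trans (hM xi eta); exact: ler_norm.
Qed.

(** By Fubini the kernel is integrated in eta first, over E, which gives at most the integral of K.
    The bound is uniform in r and takes the place of a maximal inequality. *)
Lemma rint_smoothing_le : rint leb (fun eta : LT => \1_E (eta : Rn) * smoothing eta) <=
  rint leb K * rint leb w.
Proof.
have [M M0 hM] := dilated_kernel_bounded r0.
have := @rint_fubini _ _ LT LT R leb leb w (\1_E) (dilated_kernel r) M w1 E1
  (rmeas_dilated_kernel r) hM.
rewrite /smoothing => <-; rewrite -rintZ//.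
have k0 xi : 0 <= rint leb (fun y : LT => \1_E (y : Rn) * dilated_kernel r xi y).
  by apply: rint_ge0 => y; rewrite mulr_ge0 ?dilated_kernel_ge0// indicE.
have kle xi : rint leb (fun y : LT => \1_E (y : Rn) * dilated_kernel r xi y) <= rint leb K.
  have [k1 <-] := L1_dilated_kernel xi r0.
  have le y : `|\1_E (y : Rn) * dilated_kernel r xi y| <= dilated_kernel r xi y.
    rewrite ger0_norm; last by rewrite mulr_ge0 ?dilated_kernel_ge0// indicE.
    rewrite ler_piMl ?dilated_kernel_ge0// indicE; by case: (_ \in _).
  have e1 : L1 leb (fun y : LT => \1_E (y : Rn) * dilated_kernel r xi y).
    exact: (L1_dom (rmeasM (L1_rmeas E1) (L1_rmeas k1)) le k1).
  by apply: rint_le => // y; apply: le_trans (ler_norm _) (le y).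
have mk : rmeas (fun xi : LT => rint leb (fun y : LT => \1_E (y : Rn) * dilated_kernel r xi y)).
  have mF : rmeas (fun p : LT * LT => \1_E (p.1 : Rn) * dilated_kernel r p.2 p.1).
    apply: rmeasM; first exact: (measurableT_comp (L1_rmeas E1) measurable_fst).
    apply: rmeasM (rmeas_cst _) _.
    apply: rmeas_ext (rmeas_continuous_lin (- r) r 0 cK) => p.
    by rewrite addr0 scaleNr addrC.
  apply: (rmeas_rint leb mF) => p.
  by rewrite mulr_ge0 ?dilated_kernel_ge0// indicE.
have le xi : `|w xi * rint leb (fun y : LT => \1_E (y : Rn) * dilated_kernel r xi y)| <=
    rint leb K * w xi.
  by rewrite ger0_norm ?mulr_ge0// mulrC ler_wpM2r.
apply: rint_le; [exact: (L1_dom (rmeasM (L1_rmeas w1) mk) le (L1Z _ w1))|exact: L1Z|].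
by move=> xi; apply: le_trans (ler_norm _) (le xi).
Qed.

End smoothing.
End oscillation.

Section common_frequency.
Context {R : realType} {n : nat}.
Local Notation Rn := 'rV[R]_n.
Local Notation LT := (lebesgueType R n).
Local Notation leb := (@leb R n).
Local Notation Re := (@complex.Re R).
Local Notation Im := (@complex.Im R).
Local Notation normc := Normc.normc.

Variable K : Rn -> R.
Hypothesis K0 : forall x, 0 <= K x.
Hypothesis cK : continuous K.
Hypothesis rK : rapid K.
Variables (a : Rn -> R[i]) (M : R).
Hypothesis M0 : 0 <= M.
Hypothesis ma : cmeasurable a.
Hypothesis aM : forall x, normc (a x) <= M.

(* With K = kernel f this controls the L1 norm of a - a eta times the Fourier
   transform of the wave packet of shape f, width r and frequency eta. *)
Definition oscillation (r : R) (eta : Rn) : R :=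
  rint leb (fun xi : LT => normc (a xi - a eta) * dilated_kernel K r xi eta).

Let K1 : L1 leb K := rapid_L1 (rmeas_continuous cK) rK.

Lemma L1_oscillation r eta : 0 < r ->
  L1 leb (fun xi : LT => normc (a xi - a eta) * dilated_kernel K r xi eta).
Proof.
move=> r0; have k1 := L1_dilated eta r0 K1.
have mz : cmeasurable (fun _ : Rn => a eta) by split; exact: rmeas_cst.
have md := rmeas_normc (cmeasurableB ma mz).
apply: (L1_dom (rmeasM md (L1_rmeas k1)) _ (L1Z (2 * M) k1)) => xi.
rewrite ger0_norm; last by rewrite mulr_ge0 ?normc_ge0 ?dilated_kernel_ge0.
apply: ler_wpM2r; first exact: dilated_kernel_ge0.
apply: le_trans (normcB _ _) _; have := aM xi; have := aM eta; lra.
Qed.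

Lemma truncate_bounded k : cL1 (truncate k a) /\ L2 (truncate k a).
Proof.
have mc : measurable (cube k%:R : set LT) by exact: measurable_cube.
have fc : (leb (cube k%:R) < +oo)%E by rewrite leb_cube// ltry.
have [i1 _] := approximable_L1 (approximable_indic mc fc).
have mi := L1_rmeas i1.
have mt : cmeasurable (truncate k a) by split; [exact: rmeasM mi ma.1|exact: rmeasM mi ma.2].
have tE x : normc (truncate k a x) <= M * \1_(cube k%:R) x.
  rewrite truncateE indicE; case: (x \in _); rewrite ?mulr1 ?mulr0//.
  by rewrite normcE sqn0 sqrtr0.
have i0 x : 0 <= (\1_(cube k%:R) x : R) by rewrite indicE.
split; split.
- exact: (L1_dom mt.1 (fun x => le_trans (Re_le_normc _) (tE x)) (L1Z M i1)).
- exact: (L1_dom mt.2 (fun x => le_trans (Im_le_normc _) (tE x)) (L1Z M i1)).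
- exact: mt.
have M2 : 0 <= M ^+ 2 by exact: sqr_ge0.
apply: (@le_lt_trans _ _ (lint leb (fun x : LT => M ^+ 2 * \1_(cube k%:R) (x : Rn)))).
  apply: (lint_le leb (rmeas_sqn mt) (rmeasM (rmeas_cst _) mi) (fun x => sqn_ge0 _)) => x.
  rewrite -normc_sqr; apply: (@le_trans _ _ ((M * \1_(cube k%:R) x) ^+ 2)).
    by rewrite ler_pXn2r ?nnegrE ?normc_ge0 ?mulr_ge0.
  rewrite exprMn ler_wpM2l// indicE; case: (_ \in _); by rewrite ?expr1n ?expr0n.
by rewrite lintE ?ltry//; exact: L1Z.
Qed.

(* b approximates a in L1 near eta; it is Lipschitz, whence the term C / r. *)
Lemma oscillation_le (b : Rn -> R[i]) k : schwartz b -> exists2 C, 0 <= C &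
  forall (r : R) (eta : Rn), 0 < r -> cube k%:R eta ->
  oscillation r eta <=
    smoothing K (fun x => normc (truncate k.+1 a x - b x)) r eta +
    rint leb K * normc (truncate k.+1 a eta - b eta) + C / r.
Proof.
move=> Sb; have [Lr Lr0 hLr] := schwartz_lip Sb.1; have [Li Li0 hLi] := schwartz_lip Sb.2.
(* A Lipschitz constant of b, plus M to absorb |a(xi)| at points far from eta. *)
pose L := Lr + Li + M.
have L0 : 0 <= L by rewrite !addr_ge0.
have [t1 _] := truncate_bounded k.+1.
have n1 : L1 leb (fun x : LT => `|x : Rn| * K x).
  have pn : pbound (fun x : Rn => `|x|).
    exists 1%N, 1 => x; rewrite normr_id mul1r expr1; lra.
  have rn := rapidM_pbound pn rK.
  have cn : continuous (fun x : Rn => `|x| * K x).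
    by move=> x; apply: (@continuousM R Rn (fun x => `|x|) K x); [exact: norm_continuous|exact: cK].
  exact: rapid_L1 (rmeas_continuous cn) rn.
pose I := rint leb (fun x : LT => `|x : Rn| * K x).
have I0 : 0 <= I by apply: rint_ge0 => x; rewrite mulr_ge0.
exists (L * I); first by rewrite mulr_ge0.
move=> r eta r0 eta_k.
set w := fun x => normc (truncate k.+1 a x - b x).
have w0 x : 0 <= w x by exact: normc_ge0.
have w1 : L1 leb w.
  have [ur ui] := t1; have [br bi] := schwartz_cL1 Sb.
  have mb := schwartz_cmeasurable Sb.
  have mt : cmeasurable (truncate k.+1 a) := conj (L1_rmeas ur) (L1_rmeas ui).
  have d1 := L1D (L1_norm (L1B ur br)) (L1_norm (L1B ui bi)).
  apply: (L1_dom (rmeas_normc (cmeasurableB mt mb)) _ d1) => x.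
  by rewrite ger0_norm ?normc_ge0// -cReB -cImB; exact: normc_le.
have k1 := L1_dilated eta r0 K1.
have s1 := L1_smoothing_integrand cK rK w1 w0 r0 eta.
have nr1 := L1_dilated eta r0 n1.
have ptw xi : normc (a xi - a eta) <= w xi + w eta + L * `|xi - eta|.
  have bl : normc (b xi - b eta) <= (Lr + Li) * `|xi - eta|.
    apply: le_trans (normc_le _) _; rewrite cReB cImB mulrDl.
    by apply: lerD; [exact: hLr|exact: hLi].
  have etaE : truncate k.+1 a eta = a eta.
    rewrite truncateE mem_set// => i; apply: le_trans (eta_k i) _.
    by rewrite ler_nat.
  have wE : w eta = normc (b eta - a eta) by rewrite /w etaE normc_sub.
  have [xi_k|xi_k] := boolP (xi \in cube k.+1%:R).
    have -> : a xi - a eta = (truncate k.+1 a xi - b xi) + ((b xi - b eta) + (b eta - a eta)).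
      by rewrite truncateE xi_k; ring.
    apply: le_trans (normcD _ _) _; rewrite -/(w xi).
    have h := normcD (b xi - b eta) (b eta - a eta).
    have h' : 0 <= M * `|xi - eta| by rewrite mulr_ge0.
    rewrite -wE in h; rewrite /L [(_ + M) * _]mulrDl; lra.
  (* The truncation is at k + 1 while eta lies in the cube of half-side k. A point outside the
     larger cube is therefore at distance at least 1, where M <= M |xi - eta|. *)
  have far : 1 <= `|xi - eta|.
    rewrite leNgt; apply/negP => near; move/negP: xi_k; apply.
    rewrite mem_set// => i.
    have -> : xi ord0 i = eta ord0 i + (xi - eta) ord0 i by rewrite !mxE; ring.
    apply: le_trans (ler_normD _ _) _; rewrite -natr1; apply: lerD; first exact: eta_k.
    by apply: le_trans (rV_norm_coord _ _) _; exact: ltW.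
  have -> : a xi - a eta = a xi + ((truncate k.+1 a xi - b xi) + ((b xi - b eta) + (b eta - a eta))).
    by rewrite truncateE (negbTE xi_k); ring.
  apply: le_trans (normcD _ _) _; rewrite -/(w xi).
  have h1 := normcD (truncate k.+1 a xi - b xi) ((b xi - b eta) + (b eta - a eta)).
  have h2 := normcD (b xi - b eta) (b eta - a eta).
  have h3 : M <= M * `|xi - eta| by rewrite ler_peMr.
  have h4 := aM xi.
  rewrite -wE in h2; rewrite -/(w xi) in h1; rewrite /L [(_ + M) * _]mulrDl; lra.
pose F (xi : LT) := w xi * dilated_kernel K r xi eta + w eta * dilated_kernel K r xi eta
  + L / r * (r ^+ n * (`|r *: (xi : Rn) - r *: eta| * K (r *: (xi : Rn) - r *: eta))).
have F1 : L1 leb F by apply: L1D (L1Z _ nr1); apply: L1D s1 (L1Z _ k1).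
have leF xi : normc (a xi - a eta) * dilated_kernel K r xi eta <= F xi.
  have k0 := dilated_kernel_ge0 K0 xi eta r0; clearbody L.
  apply: le_trans (ler_wpM2r k0 (ptw xi)) _.
  rewrite /F mulrDl [(_ + _) * _]mulrDl lerD2l -scalerBr normrZ (ger0_norm (ltW r0)) scalerBr.
  rewrite /dilated_kernel [X in _ <= X](_ : _ =
    L * `|xi - eta| * (r ^+ n * K (r *: xi - r *: eta)))//.
  by field; rewrite gt_eqF.
rewrite /oscillation; apply: le_trans (rint_le (L1_oscillation eta r0) F1 leF) _.
rewrite /F rintD; [|exact: L1D s1 (L1Z _ k1)|exact: L1Z nr1].
rewrite rintD; [|exact: s1|exact: L1Z k1].
have -> : rint leb (fun xi : LT => w eta * dilated_kernel K r xi eta) = w eta * rint leb K.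
  by rewrite (rintZ (w eta) k1) -[in RHS](rint_dilated eta r0 K1).
have -> : rint leb (fun xi : LT => L / r * (r ^+ n *
    (`|r *: (xi : Rn) - r *: eta| * K (r *: (xi : Rn) - r *: eta)))) = L / r * I.
  by rewrite (rintZ (L / r) nr1) /I -[in RHS](rint_dilated eta r0 n1).
by rewrite [rint leb K * _]mulrC [L * I / r]mulrAC.
Qed.

(** The term C / r is small from some index N on. The other two terms of the oscillation bound have
    small integrals over E for each of the m radii, so a single eta in E serves all of them. *)
Lemma common_frequency (E : set Rn) k (r_ : nat -> R) m (s : R) :
  measurable (E : set LT) -> E `<=` cube k%:R -> (0 < leb E)%E ->
  (forall j, 0 < r_ j) -> r_ @ \oo --> +oo -> 0 < s ->
  exists eta N, E eta /\ forall i, (i < m)%N -> oscillation (r_ (N + i)%N) eta <= s.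
Proof.
move=> mE Ek E0 r0 roo s0.
have Eoo : (leb E < +oo)%E.
  have mc : measurable (cube k%:R : set LT) by exact: measurable_cube.
  have le : (leb E <= leb (cube k%:R))%E by exact: (le_measure leb (mem_set mE) (mem_set mc) Ek).
  by apply: le_lt_trans le _; rewrite leb_cube// ltry.
have [E1 _] := approximable_L1 (approximable_indic mE Eoo).
pose mu := fine (leb E).
have mu0 : 0 < mu by apply: fine_gt0; rewrite E0.
pose kappa := rint leb K.
have kappa0 : 0 <= kappa by exact: rint_ge0.
have m0 : 0 <= m%:R :> R by [].
pose d := 4 * (m%:R + 1) * (kappa + 1).
have d0 : 0 < d by rewrite !mulr_gt0// ltr_wpDl.
(* Chosen so that m functions with integrals at most 2 kappa e over E are all at most s / 2 at a
   common point; the other s / 2 is reserved for C / r. *)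
pose e := s * mu / d.
have e0 : 0 < e by rewrite divr_gt0// mulr_gt0.
have [t1 t2] := truncate_bounded k.+1.
have [b [Sb _ tb]] := schwartz_dense12 e0 t1 t2.
have [C C0 hC] := oscillation_le k Sb.
pose w x := normc (truncate k.+1 a x - b x).
have w0 x : 0 <= w x by exact: normc_ge0.
have [ur ui] := t1; have [br bi] := schwartz_cL1 Sb.
have d1 := L1D (L1_norm (L1B ur br)) (L1_norm (L1B ui bi)).
have wle x : w x <= `|Re (truncate k.+1 a x) - Re (b x)| + `|Im (truncate k.+1 a x) - Im (b x)|.
  by rewrite -cReB -cImB; exact: normc_le.
have w1 : L1 leb w.
  have mb := schwartz_cmeasurable Sb.
  have mt : cmeasurable (truncate k.+1 a) := conj (L1_rmeas ur) (L1_rmeas ui).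
  apply: (L1_dom (rmeas_normc (cmeasurableB mt mb)) _ d1) => x.
  by rewrite ger0_norm ?normc_ge0//; exact: wle.
have we : rint leb w <= e.
  apply: le_trans (rint_le w1 d1 wle) _; apply: le_trans tb.
  rewrite /norm1 le_eqVlt; apply/orP; left; apply/eqP.
  by apply: rint_ext => x; rewrite -cReB -cImB.
have [N hN] : exists N, forall j, (N <= j)%N -> C / r_ j <= s / 2.
  have [N _ h] : \forall j \near \oo, C / (s / 2) <= r_ j by exact: (cvgryPge _).1 roo _.
  exists N => j /h /= hj; rewrite ler_pdivrMr// mulrC -ler_pdivrMr//.
  by rewrite divr_gt0.
pose V (i : 'I_m) eta := smoothing K w (r_ (N + i)%N) eta + kappa * w eta.
have V0 i x : 0 <= V i x.
  by rewrite /V addr_ge0 ?mulr_ge0//; exact: smoothing_ge0.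
have Ew1 : L1 leb (fun x : LT => \1_E (x : Rn) * w x).
  apply: (L1_dom (rmeasM (L1_rmeas E1) (L1_rmeas w1)) _ w1) => x.
  rewrite ger0_norm; last by rewrite mulr_ge0// indicE.
  by rewrite ler_piMl// indicE; case: (_ \in _).
have Ewle : rint leb (fun x : LT => \1_E (x : Rn) * w x) <= rint leb w.
  by apply: rint_le => // x; rewrite ler_piMl// indicE; case: (_ \in _).
have VE i : (fun x : LT => \1_E (x : Rn) * V i x) =
    (fun x : LT => \1_E (x : Rn) * smoothing K w (r_ (N + i)%N) x + kappa * (\1_E (x : Rn) * w x)).
  by apply/funext => x; rewrite /V mulrDr; congr (_ + _); rewrite mulrCA.
have Es1 i := L1_smoothing K0 cK rK w1 w0 E1 (r0 (N + i)%N).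
have V1 i : L1 leb (fun x : LT => \1_E (x : Rn) * V i x).
  by rewrite VE; exact: L1D (Es1 i) (L1Z _ Ew1).
have Vle i : rint leb (fun x : LT => \1_E (x : Rn) * V i x) <= 2 * kappa * e.
  rewrite VE rintD; [|exact: Es1|exact: L1Z Ew1].
  rewrite rintZ//; have h := rint_smoothing_le K0 cK rK w1 w0 E1 (r0 (N + i)%N).
  have h1 : kappa * rint leb w <= kappa * e by rewrite ler_wpM2l.
  have h2 : kappa * rint leb (fun x : LT => \1_E (x : Rn) * w x) <= kappa * rint leb w.
    by rewrite ler_wpM2l.
  move: h h1 h2; rewrite -/kappa; lra.
have small : m%:R * (2 * kappa * e) < s / 2 * mu.
  have sm0 : 0 < s * mu by rewrite mulr_gt0.
  have : m%:R * (2 * kappa) < d / 2 by rewrite /d; nra.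
  have de : d * e = s * mu by rewrite /e mulrC divfK ?gt_eqF.
  rewrite -(ltr_pM2r e0) => h; rewrite (mulrA m%:R).
  by apply: lt_le_trans h _; rewrite [d / 2 * e]mulrAC de mulrAC.
have [eta Eeta hV] := @exists_small_point _ LT R leb E m V _ _ mE Eoo V0 V1 Vle small.
exists eta, N; split => // i im.
have h1 := hC (r_ (N + i)%N) eta (r0 _) (Ek _ Eeta).
have h2 := hV (Ordinal im); rewrite /V/= -/kappa in h2.
have h3 := hN (N + i)%N (leq_addr _ _).
apply: le_trans h1 _; rewrite -/kappa -/w -/(w eta); lra.
Qed.

End common_frequency.

Section wave_packet_multiplier.
Context {R : realType} {n : nat}.
Local Notation Rn := 'rV[R]_n.
Local Notation LT := (lebesgueType R n).
Local Notation leb := (@leb R n).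
Local Notation c := (@fourier_cst R n).
Local Notation Re := (@complex.Re R).
Local Notation Im := (@complex.Im R).
Local Notation normc := Normc.normc.
Variables (a : Rn -> R[i]) (M : R).
Hypothesis ma : cmeasurable a.
Hypothesis aM : forall x, normc (a x) <= M.

(** The constant 8 / c collects 2 / c from the bound on the inverse transform, 2 from |Re| + |Im|
    and 2 from the transform of the packet. The factor s is the normalisation of the packet. *)
Lemma wave_packet_multiplier (f : Rn -> R) (s r : R) y eta : 0 <= s -> 0 < r -> real_schwartz f ->
  \forall x \ae leb,
    normc (multiplier_op a (fun x => Complex s 0 * wave_packet f r^-1 y eta x) x -
           a eta * (Complex s 0 * wave_packet f r^-1 y eta x)) <=
    s * (8 * c^-1 * oscillation (kernel f) a r eta).
Proof.
move=> s0 r0 Sf; have rn0 : r^-1 != 0 by rewrite invr_eq0 gt_eqF.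
set z := Complex s 0; set u := wave_packet f r^-1 y eta.
have Su : schwartz u := schwartz_wave_packet y eta rn0 Sf.
have Szu := schwartz_scale z Su.
have zs : normc z = s by rewrite normcE /sqn/= expr0n addr0 sqrtr_sqr ger0_norm.
have c0 := @fourier_cst_gt0 R n.
have o1 := L1_oscillation (@kernel_ge0 _ _ f) (kernel_continuous Sf) (kernel_rapid Sf) ma aM eta r0.
apply: aeS (multiplier_op_schwartz_le ma aM (a eta) Szu) => x h; apply: le_trans h _.
have [g1 g2] := multiplier_diff_cL1 ma aM (a eta) Szu.
have -> : s * (8 * c^-1 * oscillation (kernel f) a r eta) =
    2 * c^-1 * ((4 * s) * oscillation (kernel f) a r eta) by ring.
apply: ler_wpM2l; first by rewrite mulr_ge0// invr_ge0 ltW.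
rewrite /oscillation -rintZ// /norm1.
apply: rint_le => [||xi]; [exact: L1D (L1_norm g1) (L1_norm g2)|exact: L1Z o1|].
set w := (a xi - a eta) * _.
apply: (@le_trans _ _ (2 * normc w)).
  by rewrite mulr_natl mulr2n; apply: lerD; [exact: Re_le_normc|exact: Im_le_normc].
rewrite /w schwartz_fourierZ// !normcM zs.
have h := fourier_wave_packet_le y eta xi r0 Sf.
have n0 := normc_ge0 (a xi - a eta).
have -> : 4 * s * (normc (a xi - a eta) * dilated_kernel (kernel f) r xi eta) =
    2 * (normc (a xi - a eta) * (s * (2 * r ^+ n * kernel f (r *: xi - r *: eta)))).
  by rewrite /dilated_kernel; ring.
by rewrite ler_wpM2l// ler_wpM2l// ler_wpM2l.
Qed.

End wave_packet_multiplier.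

Section euclid_balls.
Context {R : realType} {n : nat}.
Local Notation Rn := 'rV[R]_n.
Local Notation LT := (lebesgueType R n).
Local Notation leb := (@leb R n).

Lemma rmeas_euclid_dist (y : Rn) : rmeas (fun x : LT => euclid_norm ((x : Rn) - y)).
Proof.
apply: (rmeas_comp (@sqrt_continuous R)).
elim: (index_enum _) => [|i s ih].
  by apply: rmeas_ext (rmeas_cst 0) => x; rewrite big_nil.
apply: rmeas_ext (rmeasD (rmeasX 2 (rmeasB (rmeas_coord i) (rmeas_cst (y ord0 i)))) ih) => x.
by rewrite big_cons !mxE.
Qed.

Lemma measurable_euclid_ball (y : Rn) r : measurable (euclid_ball y r : set LT).
Proof.
have -> : (euclid_ball y r : set LT) =
    (fun x : LT => euclid_norm ((x : Rn) - y)) @^-1` `]-oo, r[.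
  by apply/seteqP; split => x; rewrite /euclid_ball/= in_itv.
by rewrite -[X in measurable X]setTI; exact: (rmeas_euclid_dist y measurableT (measurable_itv _)).
Qed.

Lemma bounded_euclid_ball (y : Rn) r : bounded_set (euclid_ball y r).
Proof.
exists (`|y| + r); split; first exact: num_real.
move=> M hM x /= xy; apply: ltW; apply: le_lt_trans hM.
rewrite -[x](subrK y) addrC; apply: le_trans (ler_normD _ _) _; rewrite lerD2l.
by apply: le_trans (rV_norm_le_euclid _) _; exact: ltW.
Qed.

Lemma leb_euclid_ball_gt0 (y : Rn) r : 0 < r -> (0 < leb (euclid_ball y r))%E.
Proof.
(* A cube of this half-side fits into the ball, as the Euclidean norm is at most n times the maximum
   norm. *)
move=> r0; pose s := r / (n%:R + 1).
have s0 : 0 < s by rewrite divr_gt0// ltr_wpDl.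
have mc : measurable (cube s : set LT) by exact: measurable_cube.
have n10 : (1 : R) != 0 by exact: oner_neq0.
pose C : set Rn := (fun x => 1 *: x + - y) @^-1` cube s.
have mC : measurable (C : set LT) by exact: measurable_preimage_affine.
have cE : leb C = leb (cube s) by rewrite leb_affine// invr1 normr1 expr1n mul1e.
have CB : C `<=` euclid_ball y r.
  move=> x; rewrite /C /= scale1r => h; rewrite /euclid_ball/=.
  apply: le_lt_trans (euclid_norm_le _) _.
  have : `|x - y| <= s by exact: rV_norm_le (ltW s0) h.
  move=> /(ler_wpM2l (ler0n R n)) /le_lt_trans; apply.
  by rewrite /s mulrA ltr_pdivrMr ?ltr_wpDl// mulrC ltr_pM2l// ltrDl.
apply: (@lt_le_trans _ _ (leb C)).
  rewrite cE leb_cube ?(ltW s0)// lte_fin exprn_gt0// pmulrn_rgt0//.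
exact: (le_measure leb (mem_set mC) (mem_set (measurable_euclid_ball y r)) CB).
Qed.

End euclid_balls.

(** * Banach function spaces *)

Arguments bfs_norm {R n} rho f%_ring_scope.
Arguments bfsO_norm {R n} rho Omega f%_ring_scope.

Section banach_function_spaces.
Context {R : realType} {n : nat}.
Local Notation Rn := 'rV[R]_n.
Local Notation LT := (lebesgueType R n).
Local Notation leb := (@leb R n).
Local Notation normc := Normc.normc.
Variable rho : (Rn -> \bar R) -> \bar R.
Hypothesis Hrho : banach_function_norm rho.
Local Notation NX := (bfs_norm rho).
Implicit Types u v w : Rn -> R[i].

Lemma nonneg_cabs u : cmeasurable u -> nonneg_measurable (cabs u).
Proof.
move=> mu; split; first exact: rmeas_EFin (rmeas_normc mu).
by move=> x; rewrite lee_fin normc_ge0.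
Qed.

Lemma nonneg_indic (A : set Rn) (s : R) : measurable (A : set LT) -> 0 <= s ->
  nonneg_measurable (fun x : Rn => (s * \1_A x)%:E).
Proof.
move=> mA s0; split.
  by apply: rmeas_EFin; apply: rmeasM (rmeas_cst s) _; exact: rmeas_indic.
by move=> x; rewrite lee_fin mulr_ge0// indicE.
Qed.

Lemma bfs_norm_ge0 u : cmeasurable u -> (0 <= NX u)%E.
Proof. by move=> mu; apply: (bfn_ge0 Hrho); exact: nonneg_cabs. Qed.

Lemma bfs_norm_le u v : cmeasurable u -> cmeasurable v ->
  (\forall x \ae leb, normc (u x) <= normc (v x)) -> (NX u <= NX v)%E.
Proof.
move=> mu mv uv; apply: (bfn_mono Hrho); [exact: nonneg_cabs|exact: nonneg_cabs|].
by apply: aeS uv => x; rewrite lee_fin.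
Qed.

Lemma bfs_norm_eq0 u : cmeasurable u -> NX u = 0%E <-> \forall x \ae leb, u x = 0.
Proof.
move=> mu; apply: (iff_trans (bfn_eq0 Hrho (nonneg_cabs mu))).
split=> h; apply: aeS h => x; last by rewrite /cabs => ->; rewrite normcE sqn0 sqrtr0.
move=> [h]; apply: sqn_eq0.
by rewrite -normc_sqr h expr0n.
Qed.

Lemma bfs_norm_sub u v : NX (u - v) = NX (v - u).
Proof.
by congr rho; apply/funext => x; congr EFin; exact: normc_sub.
Qed.

Lemma bfs_normB_le u v : cmeasurable u -> cmeasurable v -> (NX (u - v) <= NX u + NX v)%E.
Proof.
move=> mu mv; have nu := nonneg_cabs mu; have nv := nonneg_cabs mv.
apply: le_trans (bfn_triangle Hrho nu nv).
have nuv : nonneg_measurable (fun x => cabs u x + cabs v x)%E.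
  split; last by move=> x; rewrite adde_ge0// ?nu.2 ?nv.2.
  exact: emeasurable_funD nu.1 nv.1.
apply: (bfn_mono Hrho nuv (nonneg_cabs (cmeasurableB mu mv))).
by apply: nearW => x; rewrite lee_fin normcB.
Qed.

Lemma bfs_norm_tri u v w : cmeasurable u -> cmeasurable v -> cmeasurable w ->
  (NX (u - w) <= NX (u - v) + NX (v - w))%E.
Proof.
move=> mu mv mw; rewrite [X in (_ <= _ + X)%E]bfs_norm_sub.
have -> : u - w = (u - v) - (w - v) by rewrite opprB subrKA.
by apply: bfs_normB_le; exact: cmeasurableB.
Qed.

Definition ind_norm (A : set Rn) : \bar R := rho (fun x => (\1_A x)%:E).

Lemma ind_normZ (A : set Rn) (s : R) : measurable (A : set LT) -> 0 <= s ->
  rho (fun x => (s * \1_A x)%:E) = (s%:E * ind_norm A)%E.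
Proof.
move=> mA s0; have n1 : nonneg_measurable (fun x : Rn => (\1_A x)%:E).
  by have := nonneg_indic mA ler01; under eq_fun do rewrite mul1r.
exact: (bfn_scale Hrho s0 n1).
Qed.

(** Together with the upper bound that follows, this is how the norms of packets and of their images
    are estimated. *)
Lemma bfs_norm_ge_indic u (A : set Rn) (s : R) : cmeasurable u ->
  measurable (A : set LT) -> 0 <= s ->
  (\forall x \ae leb, A x -> s <= normc (u x)) -> (s%:E * ind_norm A <= NX u)%E.
Proof.
move=> mu mA s0 h; rewrite -ind_normZ//.
apply: (bfn_mono Hrho (nonneg_cabs mu) (nonneg_indic mA s0)).
apply: aeS h => x h; rewrite lee_fin indicE; have [Ax|_] := boolP (x \in A).
  by rewrite mulr1; apply: h; rewrite -in_setE.
by rewrite mulr0 normc_ge0.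
Qed.

Lemma bfs_norm_le_indic u (A : set Rn) (s : R) : cmeasurable u ->
  measurable (A : set LT) -> 0 <= s ->
  (forall x, normc (u x) <= s * \1_A x) -> (NX u <= s%:E * ind_norm A)%E.
Proof.
move=> mu mA s0 h; rewrite -ind_normZ//.
apply: (bfn_mono Hrho (nonneg_indic mA s0) (nonneg_cabs mu)).
by apply: nearW => x; rewrite lee_fin.
Qed.

(** If the norm were 0, the indicator would vanish almost everywhere and the ball would be null. *)
Lemma ind_norm_ball_gt0 (y : Rn) (r : R) : 0 < r -> (0 < ind_norm (euclid_ball y r))%E.
Proof.
move=> r0; have mB := measurable_euclid_ball y r.
have nB := nonneg_indic mB ler01.
have E : ind_norm (euclid_ball y r) = rho (fun x : Rn => (1 * \1_(euclid_ball y r) x)%:E).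
  by rewrite ind_normZ// mul1e.
rewrite lt_neqAle {2}E (bfn_ge0 Hrho nB) andbT; apply/eqP => /esym; rewrite E.
move/(bfn_eq0 Hrho nB) => [N [mN N0 hN]].
have : (leb (euclid_ball y r) <= leb N)%E.
  apply: (le_measure leb (mem_set mB) (mem_set mN)) => x Bx; apply: hN => /=.
  by rewrite indicE mem_set// mulr1 => -[] /eqP; rewrite oner_eq0.
by rewrite N0 leNgt leb_euclid_ball_gt0.
Qed.

Lemma ind_norm_ball_fin (y : Rn) (r : R) : (ind_norm (euclid_ball y r) < +oo)%E.
Proof.
exact: (bfn_bounded_fin Hrho (measurable_euclid_ball y r) (bounded_euclid_ball y r)).
Qed.

Section domain.
Variable Omega : set Rn.
Hypothesis mO : measurable (Omega : set LT).

Lemma ext0_restrE u x : ext0 (restr Omega u) x = if x \in Omega then u x else 0.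
Proof. by rewrite -[LHS]/((valL_ 0 \o sigL Omega) u x) sigLK. Qed.

Lemma ext0B (f g : Omega -> R[i]) : ext0 (f - g) = ext0 f - ext0 g.
Proof.
apply/funext => x; rewrite -[RHS]/(ext0 f x - ext0 g x) /ext0 /valL_ /=.
by case: ('oinv_set_val x) => [?|] //=; rewrite subr0.
Qed.

Lemma cmeasurable_restr u : cmeasurable u -> cmeasurable (ext0 (restr Omega u)).
Proof.
move=> [mr mi]; have m1 := @rmeas_indic _ LT R _ mO.
split.
- apply: rmeas_ext (rmeasM m1 mr) => x; rewrite ext0_restrE indicE.
  by case: (_ \in _); rewrite ?mul1r ?mul0r.
- apply: rmeas_ext (rmeasM m1 mi) => x; rewrite ext0_restrE indicE.
  by case: (_ \in _); rewrite ?mul1r ?mul0r.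
Qed.

Lemma bfsO_restr_le u : cmeasurable u -> (bfsO_norm rho Omega (restr Omega u) <= NX u)%E.
Proof.
move=> mu; apply: (bfs_norm_le (cmeasurable_restr mu) mu).
apply: nearW => x; rewrite ext0_restrE; case: (_ \in _) => //.
by rewrite [leLHS]normcE sqn0 sqrtr0 normc_ge0.
Qed.

Lemma bfsO_norm_indic (A : set Rn) : A `<=` Omega ->
  bfsO_norm rho Omega (restr Omega \1_A) = ind_norm A.
Proof.
move=> AO; congr rho; apply/funext => x; congr EFin; rewrite ext0_restrE.
have [xO|xO] := boolP (x \in Omega).
  by rewrite !indicE; case: (_ \in _); rewrite normcE /sqn /= ?expr1n ?expr0n ?addr0 ?sqrtr1 ?sqrtr0.
rewrite normcE sqn0 sqrtr0 indicE memNset// => /AO xO'.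
by rewrite mem_set in xO.
Qed.

End domain.

End banach_function_spaces.

(** * The Wiener-Hopf operator on its dense domain *)

Section wiener_hopf_norm.
Context {R : realType} {n : nat}.
Local Notation Rn := 'rV[R]_n.
Local Notation LT := (lebesgueType R n).
Local Notation leb := (@leb R n).
Local Notation normc := Normc.normc.
Variable rho : (Rn -> \bar R) -> \bar R.
Hypothesis Hrho : banach_function_norm rho.
Local Notation NX := (bfs_norm rho).
Variables (a b : Rn -> R[i]) (M : R).
Hypothesis ma : cmeasurable a.
Hypothesis aM : forall x, normc (a x) <= M.
Hypothesis ab : forall u, L2 u -> multiplier_op b u = multiplier_op a u.
Hypothesis bX : multiplier rho b.
Implicit Types u v w : Rn -> R[i].

Let L2_0 : L2 (0 : Rn -> R[i]).
Proof. exact/schwartz_L2/(conj (@schwartz0 R n) (@schwartz0 R n)). Qed.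

(** The supremum defining the multiplier class omits functions that vanish almost everywhere. For
    these the operator returns its value at 0, which is null by additivity. *)
Lemma multiplier_bounded : exists2 N, 0 <= N &
  forall u, L2 u -> bfs rho u -> (NX (multiplier_op a u) <= N%:E * NX u)%E.
Proof.
have [_] := bX; set s := ereal_sup _ => soo.
exists `|fine s|; first by [].
move=> u u2 uX; have mu := u2.1; have a2 := multiplier_op_L2 ma aM u2.
have [u0|u0] := pselect (\forall x \ae leb, u x = 0).
  have -> : multiplier_op a u = multiplier_op a 0 by exact: (multiplier_op_ae a u2 L2_0).
  suff /(bfs_norm_eq0 Hrho (multiplier_op_L2 ma aM L2_0).1) -> :
      \forall x \ae leb, multiplier_op a 0 x = 0.
    by rewrite ((bfs_norm_eq0 Hrho mu).2 u0) mule0.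
  have := multiplier_opB_ae ma aM L2_0 L2_0; rewrite subrr.
  by apply: aeS => x ->; rewrite subrr.
have us : (NX (multiplier_op b u) / NX u <= s)%E.
  by apply: ereal_sup_ubound; exists u => //; split => //; exact/L2P.
rewrite (ab u2) in us.
have pos : (0 < NX u)%E.
  rewrite lt_neqAle (bfs_norm_ge0 Hrho mu) andbT; apply/eqP => /esym.
  by move/(bfs_norm_eq0 Hrho mu).
have fin : NX u \is a fin_num by rewrite ge0_fin_numE ?(ltW pos)//; exact: uX.2.
have n0 := bfs_norm_ge0 Hrho a2.1.
have s0 : (0 <= s)%E.
  by apply: le_trans us; rewrite mule_ge0// inve_ge0 ltW.
have sf : s \is a fin_num by rewrite ge0_fin_numE.
apply: (@le_trans _ _ (s * NX u)%E); last first.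
  by rewrite -{1}(fineK sf); apply: (lee_wpmul2r (ltW pos)); rewrite lee_fin ler_norm.
move: us; rewrite -(fineK fin) => us.
have f0 : 0 < fine (NX u) by rewrite fine_gt0// pos ltey_eq fin.
by move: us; rewrite inver gt_eqF// lee_pdivrMr.
Qed.

Section domain.
Variable Omega : set Rn.
Hypothesis mO : measurable (Omega : set LT).
Local Notation NO := (bfsO_norm rho Omega).
Local Notation W := (wiener_hopf rho b : (Omega -> R[i]) -> (Omega -> R[i])).

Lemma L2_bfsO_L2 (u : Omega -> R[i]) : L2_bfsO rho Omega u -> L2 (ext0 u).
Proof. by move=> [/L2P]. Qed.

Lemma wiener_hopf0E (u : Omega -> R[i]) x : L2 (ext0 u) ->
  ext0 (wiener_hopf0 b u) x = if x \in Omega then multiplier_op a (ext0 u) x else 0.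
Proof. by move=> u2; rewrite /wiener_hopf0 (ab u2) ext0_restrE. Qed.

Lemma wiener_hopf0_bfsO (u : Omega -> R[i]) : L2_bfsO rho Omega u ->
  bfsO rho Omega (wiener_hopf0 b u).
Proof.
move=> uL; have u2 := L2_bfsO_L2 uL; rewrite /wiener_hopf0 (ab u2).
have a2 := multiplier_op_L2 ma aM u2; have [N N0 hN] := multiplier_bounded.
split; first exact: cmeasurable_restr a2.1.
apply: le_lt_trans (bfsO_restr_le Hrho mO a2.1) _.
apply: le_lt_trans (hN _ u2 uL.2) _.
by rewrite lte_mul_pinfty// ?lee_fin//; exact: uL.2.2.
Qed.

Let mask_dist (p q p' q' : R[i]) (t : bool) : p = (if t then p' else 0) ->
  q = (if t then q' else 0) -> normc (p - q) <= normc (p' - q').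
Proof.
by move=> -> ->; case: t; rewrite ?subrr // [leLHS]normcE sqn0 sqrtr0 normc_ge0.
Qed.

(** Boundedness is phrased as a Lipschitz condition because additivity is available only almost
    everywhere. *)
Lemma wiener_hopf0_lip : exists2 N, 0 <= N & forall u v : Omega -> R[i],
  L2_bfsO rho Omega u -> L2_bfsO rho Omega v ->
  (NO (wiener_hopf0 b u - wiener_hopf0 b v) <= N%:E * NO (u - v))%E.
Proof.
have [N N0 hN] := multiplier_bounded; exists N => // u v uL vL.
have u2 := L2_bfsO_L2 uL; have v2 := L2_bfsO_L2 vL.
have uv2 := L2B u2 v2; have a2 := multiplier_op_L2 ma aM uv2.
have uvX : bfs rho (ext0 u - ext0 v).
  split; first exact: uv2.1.
  apply: le_lt_trans (bfs_normB_le Hrho u2.1 v2.1) _.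
  by rewrite lte_add_pinfty//; [exact: uL.2.2|exact: vL.2.2].
rewrite /bfsO_norm !ext0B; apply: le_trans (hN _ uv2 uvX).
have le_pt x : normc (ext0 (wiener_hopf0 b u) x - ext0 (wiener_hopf0 b v) x) <=
    normc (multiplier_op a (ext0 u) x - multiplier_op a (ext0 v) x).
  exact: (mask_dist (wiener_hopf0E x u2) (wiener_hopf0E x v2)).
have mW (u' : Omega -> R[i]) : L2 (ext0 u') -> cmeasurable (ext0 (wiener_hopf0 b u' : Omega -> R[i])).
  by move=> u2'; rewrite /wiener_hopf0 (ab u2'); exact: (cmeasurable_restr mO (multiplier_op_L2 ma aM u2').1).
apply: (bfs_norm_le Hrho (cmeasurableB (mW u u2) (mW v v2)) a2.1).
apply: aeS (multiplier_opB_ae ma aM u2 v2) => x ->.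
exact: le_pt.
Qed.

(** A constant sequence shows that the extension has a value to choose, and the Lipschitz bound
    shows that any two such values differ by a null function. *)
Lemma wiener_hopfP (u : Omega -> R[i]) : L2_bfsO rho Omega u ->
  bfsO rho Omega (W u) /\ NO (W u - wiener_hopf0 b u) = 0%E.
Proof.
move=> uL; have W0X := wiener_hopf0_bfsO uL.
have NO0 : NO 0 = 0%E.
  apply/(bfs_norm_eq0 Hrho) => [|]; last first.
    by apply: nearW => x; rewrite /ext0 /valL_ /=; case: ('oinv_set_val x).
  rewrite (_ : ext0 _ = 0); first exact: L2_0.1.
  by apply/funext => x; rewrite /ext0 /valL_ /=; case: ('oinv_set_val x).
rewrite /wiener_hopf /continuous_extension.
case: xgetP => [w _ [wX [u_ [uk cu cw]]]|/(_ (wiener_hopf0 b u))]; last first.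
  case; split => //; exists (fun=> u); split => //;
    by rewrite subrr NO0; exact: cvg_cst.
split => //; have [N N0 hN] := wiener_hopf0_lip.
have mw := wX.1; have m0 := W0X.1.
have n0 : (0 <= NO (w - wiener_hopf0 b u))%E.
  by rewrite /bfsO_norm ext0B; apply: (bfs_norm_ge0 Hrho); exact: cmeasurableB.
apply/eqP; rewrite eq_le n0 andbT; apply/lee_addgt0Pr => e e0; rewrite add0e.
pose d := e / (N + 1).
have N1 : 0 < N + 1 by rewrite ltr_wpDl.
have d0 : 0 < d by rewrite divr_gt0.
have [k [h1 h2]] : exists k, (NO (u_ k - u) <= d%:E)%E /\
    (NO (wiener_hopf0 b (u_ k) - w) <= d%:E)%E.
  near \oo => k; exists k; split; near: k; exact: ecvg0_le.
have mk := (wiener_hopf0_bfsO (uk k)).1.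
have h3 := hN _ _ (uk k) uL.
have h2' : (NX (ext0 w - ext0 (wiener_hopf0 b (u_ k))) <= d%:E)%E.
  by rewrite bfs_norm_sub -ext0B.
have h3' : (NX (ext0 (wiener_hopf0 b (u_ k)) - ext0 (wiener_hopf0 b u)) <= N%:E * NO (u_ k - u))%E.
  by rewrite -ext0B.
rewrite /bfsO_norm ext0B; apply: le_trans (bfs_norm_tri Hrho mw mk m0) _.
have h4 : (N%:E * NO (u_ k - u) <= (N * d)%:E)%E.
  by rewrite EFinM; apply: lee_wpmul2l => //; rewrite lee_fin.
apply: le_trans (leeD h2' (le_trans h3' h4)) _.
by rewrite -EFinD lee_fin /d -[X in X + _]mul1r -mulrDl addrC mulrC divfK// gt_eqF.
Unshelve. all: by end_near. Qed.

End domain.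
End wiener_hopf_norm.

(** * Sharpening the doubling constant *)

Section doubling_refinement.
Context {R : realType}.

Lemma bernoulli_le (h : R) k : 0 <= h -> 1 + k%:R * h <= (1 + h) ^+ k.
Proof.
move=> h0; elim: k => [|k ih]; first by rewrite mul0r addr0 expr0.
rewrite exprS; apply: le_trans (ler_wpM2l _ ih); last by rewrite addr_ge0.
have : 0 <= k%:R * h * h by rewrite !mulr_ge0.
rewrite -natr1; lra.
Qed.

Lemma exists_expr_ge (C C' : R) : 1 < C' -> exists2 m, (0 < m)%N & C <= C' ^+ m.
Proof.
move=> C1; have h0 : 0 < C' - 1 by rewrite subr_gt0.
have hb := archi_boundP (normr_ge0 (C / (C' - 1))).
set k := Num.bound _ in hb; exists k.+1 => //.
have : C / (C' - 1) <= k.+1%:R.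
  rewrite -natr1; apply: le_trans (ler_norm _) _.
  by apply: ltW; apply: lt_le_trans hb _; rewrite lerDl.
rewrite ler_pdivrMr// => h; apply: le_trans h _.
have := bernoulli_le k.+1 (ltW h0).
have -> : 1 + (C' - 1) = C' by ring.
by apply: le_trans; rewrite lerDr.
Qed.

(** If every step exceeded the factor C', the total growth over m steps would exceed C'^m >= C. *)
Lemma geometric_step (p : nat -> R) m (C C' : R) : (forall i, 0 < p i) -> 0 < C' ->
  (0 < m)%N -> p m <= C * p 0%N -> C <= C' ^+ m -> exists2 i, (i < m)%N & p i.+1 <= C' * p i.
Proof.
move=> p0 C0 m0 pm Cm; apply: contrapT => H.
have {}H i : (i < m)%N -> C' * p i < p i.+1.
  by move=> im; rewrite ltNge; apply/negP => h; apply: H; exists i.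
have G i : (i < m)%N -> C' ^+ i.+1 * p 0%N < p i.+1.
  elim: i => [|i ih] im; first by rewrite expr1; exact: H.
  apply: lt_trans (H _ im); rewrite exprS -mulrA ltr_pM2l//; apply: ih; exact: ltnW.
have := G m.-1; rewrite prednK// => /(_ (leqnn _)).
rewrite ltNge => /negP; apply; apply: le_trans pm _.
by rewrite ler_pM2r.
Qed.

Lemma exists_root (tau : R) m : 1 < tau -> (0 < m)%N -> exists2 t, 1 < t & t ^+ m = tau.
Proof.
move=> tau1 m0; have tau0 : 0 < tau by exact: lt_trans tau1.
have E : (tau `^ (m%:R^-1)) ^+ m = tau.
  by rewrite -powR_mulrn ?powR_ge0// -powRrM mulVf ?powRr1 ?ltW// pnatr_eq0 -lt0n.
exists (tau `^ (m%:R^-1)) => //; rewrite ltNge; apply/negP => h.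
have := exprn_ile1 m (powR_ge0 tau (m%:R^-1)) h.
by rewrite E leNgt tau1.
Qed.

Context {n : nat}.
Local Notation Rn := 'rV[R]_n.
Local Notation LT := (lebesgueType R n).
Variable rho : (Rn -> \bar R) -> \bar R.
Hypothesis Hrho : banach_function_norm rho.

Lemma sub_euclid_ball (y : Rn) (r s : R) : r <= s -> euclid_ball y r `<=` euclid_ball y s.
Proof. by move=> rs x /= xr; exact: lt_le_trans xr rs. Qed.

(* Between r j and tau * r j there are m radii in geometric progression; for one
   of the m steps the norm grows by at most the m-th root of the given constant. *)
Lemma doubling_refinement (Omega : set Rn) (C' : R) : 1 < C' -> separated_doubling rho Omega ->
  exists (t : R) (r : nat -> R) (y : nat -> Rn),
  [/\ 1 < t, (forall j, 0 < r j) /\ r @ \oo --> +oo,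
      forall j, euclid_ball (y j) (t * r j) `<=` Omega,
      forall j k, j <> k ->
        euclid_ball (y j) (t * r j) `&` euclid_ball (y k) (t * r k) = set0 &
      forall j, fine (ind_norm rho (euclid_ball (y j) (t * r j))) <=
        C' * fine (ind_norm rho (euclid_ball (y j) (r j)))].
Proof.
move=> C1 [tau [C [r [y [[tau1 C0] [r0 ndr roo] BO dB hC]]]]].
(* The number m depends only on C and C', so the ratio t with t^m = tau is the same for all j, and a
   single cutoff function serves all balls. *)
have [m m0 Cm] := exists_expr_ge C C1.
have [t t1 tm] := exists_root tau1 m0.
have t0 : 0 < t by exact: lt_trans t1.
pose q j i := fine (ind_norm rho (euclid_ball (y j) (t ^+ i * r j))).
have q0 j i : 0 < q j i.
  apply: fine_gt0; rewrite (ind_norm_ball_gt0 Hrho) ?(ind_norm_ball_fin Hrho)//.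
  by rewrite mulr_gt0// exprn_gt0.
have qm j : q j m <= C * q j 0%N.
  have := hC j.
  have sub : euclid_ball (y j) (r j) `<=` Omega.
    apply: subset_trans (BO j).2; apply: sub_euclid_ball.
    by rewrite ler_peMl ?ltW.
  rewrite (bfsO_norm_indic _ (BO j).2) (bfsO_norm_indic _ sub).
  have fin s : 0 < s -> ind_norm rho (euclid_ball (y j) s) = (fine (ind_norm rho (euclid_ball (y j) s)))%:E.
    move=> s0; rewrite fineK// ge0_fin_numE ?(ind_norm_ball_fin Hrho)//.
    by apply: ltW; exact: ind_norm_ball_gt0.
  have qm0 := q0 j 0%N; rewrite /q expr0 mul1r tm in qm0 *.
  rewrite (fin _ (r0 j)) (fin (tau * r j)) ?mulr_gt0 ?(lt_trans _ tau1)//.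
  by rewrite inver gt_eqF// lee_pdivrMr// -EFinM lee_fin.
have /choice[i hi] j : exists i, (i < m)%N /\ q j i.+1 <= C' * q j i.
  have [i im h] := geometric_step (q0 j) (lt_trans ltr01 C1) m0 (qm j) Cm.
  by exists i.
have ti1 j : 1 <= t ^+ i j by rewrite exprn_ege1// ltW.
have tle j : t * (t ^+ i j * r j) <= tau * r j.
  rewrite mulrA -exprS -tm ler_pM2r// ler_weXn2l ?ltW//; exact: (hi j).1.
exists t, (fun j => t ^+ i j * r j), y; split => //.
- split; first by move=> j; rewrite mulr_gt0// exprn_gt0.
  apply/cvgryPge => A; have [N _ h] : \forall j \near \oo, A <= r j by exact: (cvgryPge _).1 roo A.
  exists N => // j /h /= Aj; apply: le_trans Aj _.
  by rewrite ler_peMl// ltW.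
- by move=> j; apply: subset_trans (BO j).2; apply: sub_euclid_ball.
- move=> j k jk; apply/seteqP; split => // x [xj xk].
  by rewrite -(dB j k jk); split; [exact: (sub_euclid_ball (tle j)) xj|exact: (sub_euclid_ball (tle k)) xk].
- by move=> j; have := (hi j).2; rewrite /q exprS mulrA.
Qed.

End doubling_refinement.

(** * Covers of the image of the unit ball *)

Section covers_of_the_image.
Context {R : realType} {n : nat}.
Local Notation Rn := 'rV[R]_n.
Local Notation LT := (lebesgueType R n).
Local Notation leb := (@leb R n).
Local Notation normc := Normc.normc.
Local Notation c := (@fourier_cst R n).
Variable rho : (Rn -> \bar R) -> \bar R.
Hypothesis Hrho : banach_function_norm rho.
Local Notation NX := (bfs_norm rho).
Variables (a b : Rn -> R[i]) (M : R).
Hypothesis M0 : 0 <= M.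
Hypothesis ma : cmeasurable a.
Hypothesis aM : forall x, normc (a x) <= M.
Hypothesis ab : forall u, L2 u -> multiplier_op b u = multiplier_op a u.
Hypothesis bX : multiplier rho b.
Variable Omega : set Rn.
Hypothesis mO : measurable (Omega : set LT).
Local Notation NO := (bfsO_norm rho Omega).
Local Notation W := (wiener_hopf rho b : (Omega -> R[i]) -> (Omega -> R[i])).

(** Here p and q stand for the images of two packets at a point where the first packet has the value
    w and the second vanishes. *)
Lemma normc_separation (p q z w : R[i]) (d e : R) :
  normc (p - z * w) <= d -> normc q <= e -> normc z * normc w - (d + e) <= normc (p - q).
Proof.
move=> h1 h2; rewrite -normcM.
have E : z * w = (p - q) + (q - (p - z * w)) by ring.
have h3 := normcD (p - q) (q - (p - z * w)); rewrite -E in h3.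
have h4 := normcB q (p - z * w).
lra.
Qed.

(** P and Q are the norms of the indicators of the larger and the smaller ball; X / P is the lower
    bound for the modulus of the difference on the smaller ball. *)
Lemma scaled_bound_absurd (r X P Q C' : R) : 0 <= r -> 0 < P -> 0 < Q -> P <= C' * Q ->
  r * C' < X -> P^-1 * X * Q <= r -> False.
Proof.
move=> r0 P0 Q0 PQ rX; rewrite -mulrA ler_pdivrMl// => h.
have h5 : P * r <= C' * Q * r by rewrite ler_wpM2r.
have h6 : r * C' * Q < X * Q by rewrite ltr_pM2r.
lra.
Qed.

Lemma ext0_restr_id (w : Rn -> R[i]) : (forall x, ~ Omega x -> w x = 0) ->
  ext0 (restr Omega w) = w.
Proof.
move=> w0; apply/funext => x; rewrite ext0_restrE; have [//|xO] := boolP (x \in Omega).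
by apply/esym/w0 => Ox; rewrite mem_set in xO.
Qed.

Lemma L2_bfsO_restr (w : Rn -> R[i]) : schwartz w -> bfs rho w ->
  (forall x, ~ Omega x -> w x = 0) -> L2_bfsO rho Omega (restr Omega w).
Proof.
move=> Sw wX w0; have eE := ext0_restr_id w0.
have h1 : cLp 2%:E (ext0 (restr Omega w)) by rewrite eE; exact: (L2P w).2 (schwartz_L2 Sw).
have h2 : bfs rho (ext0 (restr Omega w)) by rewrite eE.
exact: (conj h1 h2).
Qed.

(** A function that vanishes outside Omega is the zero extension of its restriction, so the estimate
    for the multiplier on R^n passes to W almost everywhere on Omega. *)
Lemma wiener_hopf_wave_packet (w : Rn -> R[i]) (z : R[i]) (d : R) :
  schwartz w -> bfs rho w -> (forall x, ~ Omega x -> w x = 0) ->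
  (\forall x \ae leb, normc (multiplier_op a w x - z * w x) <= d) ->
  exists g, [/\ g = ext0 (W (restr Omega w)), cmeasurable g &
    \forall x \ae leb, Omega x -> normc (g x - z * w x) <= d].
Proof.
move=> Sw wX w0 hd.
have eE := ext0_restr_id w0; have uL := L2_bfsO_restr Sw wX w0.
have [gX g0] := wiener_hopfP Hrho ma aM ab bX mO uL.
have u2 : L2 (ext0 (restr Omega w)) by rewrite eE; exact: schwartz_L2.
have W0X := wiener_hopf0_bfsO Hrho ma aM ab bX mO uL.
have gE x := wiener_hopf0E ab x u2.
rewrite eE in gE.
exists (ext0 (W (restr Omega w))); split; [by []|exact: gX.1|].
move: g0; rewrite /bfsO_norm ext0B => g0.
have := (bfs_norm_eq0 Hrho (cmeasurableB gX.1 W0X.1)).1 g0.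
apply: aeS2 hd => x hx h Ox.
have e : ext0 (W (restr Omega w)) x = ext0 (wiener_hopf0 b (restr Omega w)) x.
  by apply/eqP; rewrite -subr_eq0; apply/eqP.
by rewrite e gE mem_set.
Qed.

Lemma no_small_cover (r e : R) m (S : 'I_m -> set (Omega -> R[i])) (E : set Rn) k :
  separated_doubling rho Omega -> 0 <= r -> 0 < e ->
  (forall i, S i `<=` bfsO rho Omega /\
    forall v w, S i v -> S i w -> (NO (v - w) <= r%:E)%E) ->
  W @` [set u | bfsO2 rho Omega u /\ (NO u <= 1)%E] `<=` \bigcup_i S i ->
  measurable (E : set LT) -> E `<=` cube k%:R -> (0 < leb E)%E ->
  (forall x, E x -> r + e < normc (a x)) -> False.
Proof.
move=> sd r0 e0 hS cover mE Ek E0 Ea.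
have c0 := @fourier_cst_gt0 R n.
have re0 : 0 < r + e by rewrite ltr_wpDl.
(* Gives r C' <= r + e / 8; the summand 1 in the denominator allows r = 0. *)
pose C' := 1 + e / (8 * (r + 1)).
have r1 : 0 < r + 1 by rewrite ltr_wpDl.
have C1 : 1 < C' by rewrite ltrDl divr_gt0// mulr_gt0.
have rC : r * C' <= r + e / 8.
  rewrite /C' mulrDr mulr1 lerD2l mulrA ler_pdivrMr ?mulr_gt0//.
  have : 0 <= r * e by rewrite mulr_ge0// ltW.
  nra.
have [t [rr [y [t1 [rr0 rroo] BO dB hC]]]] := doubling_refinement Hrho C1 sd.
(* The loss caused by the cutoff is then (r + e) e' = e / 8. *)
pose e' := e / (8 * (r + e)).
have e'0 : 0 < e' by rewrite divr_gt0// mulr_gt0.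
have [f [Sf f01 f1 ft]] := @exists_cutoff R n _ _ t1 e'0.
pose d := e / 8.
have d0 : 0 < d by rewrite divr_gt0.
(* Cancels the constant 8 / c of the packet estimate and leaves the error d. *)
pose s := d * c / 8.
have s0 : 0 < s by rewrite divr_gt0// mulr_gt0.
(* Asking for m + 1 consecutive radii, one more than the number of sets, prepares the pigeonhole
   argument. *)
have [eta [N [Eeta osc]]] := common_frequency (@kernel_ge0 _ _ f) (kernel_continuous Sf)
  (kernel_rapid Sf) M0 ma aM m.+1 mE Ek E0 rr0 rroo s0.
pose z := a eta.
have zr : r + e < normc z := Ea _ Eeta.
pose B j := euclid_ball (y j) (t * rr j).
pose A j := euclid_ball (y j) (rr j).
have t0 : 0 < t by exact: lt_trans t1.
have trr0 j : 0 < t * rr j by rewrite mulr_gt0.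
pose p j := fine (ind_norm rho (B j)); pose q j := fine (ind_norm rho (A j)).
have p0 j : 0 < p j.
  by apply: fine_gt0; rewrite (ind_norm_ball_gt0 Hrho) ?(ind_norm_ball_fin Hrho).
have q0 j : 0 < q j.
  by apply: fine_gt0; rewrite (ind_norm_ball_gt0 Hrho) ?(ind_norm_ball_fin Hrho).
have pE j : ind_norm rho (B j) = (p j)%:E.
  rewrite fineK// ge0_fin_numE ?(ind_norm_ball_fin Hrho)//.
  by apply: ltW; exact: ind_norm_ball_gt0.
have qE j : ind_norm rho (A j) = (q j)%:E.
  rewrite fineK// ge0_fin_numE ?(ind_norm_ball_fin Hrho)//.
  by apply: ltW; exact: ind_norm_ball_gt0.
pose w j x := Complex (p j)^-1 0 * wave_packet f (rr j)^-1 (- ((rr j)^-1 *: y j)) eta x.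
have rn0 j : (rr j)^-1 != 0 by rewrite invr_eq0 gt_eqF.
have Sw j : schwartz (w j) by exact/schwartz_scale/schwartz_wave_packet.
have normw j x : normc (w j x) = (p j)^-1 * f ((rr j)^-1 *: (x - y j)).
  rewrite normcM normc_wave_packet normcE /sqn/= expr0n addr0 sqrtr_sqr.
  rewrite ger0_norm ?invr_ge0 ?(ltW (p0 j))// scalerBr ger0_norm//.
  by have /andP[] := f01 ((rr j)^-1 *: x - (rr j)^-1 *: y j).
have dist j x : euclid_norm ((rr j)^-1 *: (x - y j)) = euclid_norm (x - y j) / rr j.
  by rewrite euclid_norm_scale ger0_norm ?invr_ge0 ?(ltW (rr0 j))// mulrC.
have w_out j x : ~ B j x -> w j x = 0.
  move=> nB; apply: sqn_eq0; rewrite -normc_sqr normw ft ?mulr0 ?expr0n//.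
  by rewrite dist ler_pdivlMr// leNgt; apply/negP.
have w_le j x : normc (w j x) <= (p j)^-1 * \1_(B j) x.
  have [Bx|nBx] := pselect (B j x).
    rewrite normw indicE mem_set// ler_wpM2l ?invr_ge0 ?(ltW (p0 j))//.
    by have /andP[] := f01 ((rr j)^-1 *: (x - y j)).
  by rewrite (w_out _ _ nBx) normcE sqn0 sqrtr0 indicE memNset// mulr0.
have w_ge j x : A j x -> (p j)^-1 * (1 - e') <= normc (w j x).
  move=> Ax; rewrite normw ler_wpM2l ?invr_ge0 ?(ltW (p0 j))//; apply: f1.
  by rewrite dist ler_pdivrMr// mul1r ltW.
have mB j : measurable (B j : set LT) by exact: measurable_euclid_ball.
have mA j : measurable (A j : set LT) by exact: measurable_euclid_ball.
have wn j : (NX (w j) <= 1)%E.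
  have := bfs_norm_le_indic Hrho (schwartz_cmeasurable (Sw j)) (mB j) _ (w_le j).
  by rewrite invr_ge0 (ltW (p0 j)) pE -EFinM mulVf ?gt_eqF//; apply.
have wX j : bfs rho (w j).
  by split; [exact: schwartz_cmeasurable|exact: le_lt_trans (wn j) (ltry _)].
have w_outO j x : ~ Omega x -> w j x = 0.
  by move=> nO; apply: w_out => /BO.
have eE j := ext0_restr_id (w_outO j).
have uL j := L2_bfsO_restr (Sw j) (wX j) (w_outO j).
have main j : (j < m.+1)%N -> \forall x \ae leb,
    normc (multiplier_op a (w (N + j)%N) x - z * w (N + j)%N x) <= (p (N + j)%N)^-1 * d.
  move=> jm; have pi0 : 0 <= (p (N + j)%N)^-1 by rewrite invr_ge0 ltW.
  have := wave_packet_multiplier ma aM (- ((rr (N + j)%N)^-1 *: y (N + j)%N)) eta pi0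
    (rr0 (N + j)%N) Sf.
  apply: aeS => x hx.
  apply: le_trans hx _; apply: ler_wpM2l => //.
  have := osc j jm; rewrite /s ler_pdivlMr// => h.
  by rewrite mulrAC ler_pdivrMr// mulrC.
have /choice[g hg] (j : 'I_m.+1) := wiener_hopf_wave_packet (Sw (N + j)%N) (wX _)
  (w_outO _) (main j (ltn_ord j)).
have /choice[i hi] (j : 'I_m.+1) : exists i, S i (W (restr Omega (w (N + j)%N))).
  have [|i _ Si] := cover (W (restr Omega (w (N + j)%N))); last by exists i.
  exists (restr Omega (w (N + j)%N)); last by [].
  split; last by rewrite /bfsO_norm eE.
  split; first exact: (uL _).2.
  (* The packets lie in L2 already, so each is its own approximation in the closure. *)
  move=> e1 e10; exists (restr Omega (w (N + j)%N)); first exact: uL.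
  rewrite subrr.
  have -> : NO 0 = 0%E; last by rewrite lte_fin.
  have E00 : ext0 (0 : Omega -> R[i]) = 0.
    by apply/funext => x; rewrite /ext0 /valL_ /=; case: ('oinv_set_val x).
  rewrite /bfsO_norm E00; apply/(bfs_norm_eq0 Hrho).
    by apply: schwartz_cmeasurable; exact: (conj (@schwartz0 R n) (@schwartz0 R n)).
  exact: nearW.
(* The index j has the smaller norm, so the error d / p_l of the other image is at most d / p_j; all
   terms on the ball of j then scale like 1 / p_j. *)
have pair (j l : 'I_m.+1) : j != l -> i j = i l ->
    p (N + j)%N <= p (N + l)%N -> False.
  move=> jl ijl ple.
  have gr : (NX (g j - g l) <= r%:E)%E.
    have [-> _ _] := hg j; have [-> _ _] := hg l.
    rewrite -ext0B; apply: (hS (i j)).2; first exact: hi.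
    by rewrite ijl; exact: hi.
  have [_ mgj hj] := hg j; have [_ mgl hl] := hg l.
  have Aout x : A (N + j)%N x -> w (N + l)%N x = 0.
    move=> Ax; apply: w_out => Bx.
    have jl' : (N + j)%N <> (N + l)%N.
      by move=> /addnI /val_inj /eqP; rewrite (negbTE jl).
    have : (B (N + j)%N `&` B (N + l)%N) x.
      split => //; apply: sub_euclid_ball Ax.
      by rewrite ler_peMl// ltW.
    by rewrite /B (dB _ _ jl').
  pose sg := (p (N + j)%N)^-1 * (normc z * (1 - e') - 2 * d).
  have low : \forall x \ae leb, A (N + j)%N x -> sg <= normc ((g j - g l) x).
    apply: aeS2 hj hl => x hj hl Ax.
    have Ox : Omega x.
      by apply: (BO (N + j)%N); apply: sub_euclid_ball Ax; rewrite ler_peMl// ltW.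
    have := hl Ox; rewrite (Aout _ Ax) mulr0 subr0 => hl'.
    apply: le_trans (normc_separation (hj Ox) hl').
    have h1 := w_ge _ _ Ax.
    have h2 : normc z * ((p (N + j)%N)^-1 * (1 - e')) <= normc z * normc (w (N + j)%N x).
      by rewrite ler_wpM2l// normc_ge0.
    have h3 : (p (N + l)%N)^-1 * d <= (p (N + j)%N)^-1 * d.
      by rewrite ler_wpM2r ?(ltW d0)// lef_pV2 ?posrE.
    rewrite /sg; move: h2 h3; lra.
  (* The left side is at most r + e / 8, the right side at least r + e - e / 8 - 2 e / 8. *)
  have num : r * C' < normc z * (1 - e') - 2 * d.
    have e're : e' * (r + e) = e / 8 by rewrite /e'; field; rewrite gt_eqF.
    have e'1 : e' < 1.
      rewrite /e' ltr_pdivrMr ?mulr_gt0// mul1r; lra.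
    have : (r + e) * (1 - e') <= normc z * (1 - e').
      by rewrite ler_wpM2r ?subr_ge0 ?(ltW e'1)// ltW.
    rewrite mulrBr mulr1 (mulrC (r + e)) e're /d; lra.
  have rC0 : 0 <= r * C' by rewrite mulr_ge0// ltW// (lt_trans _ C1).
  have sg0 : 0 <= sg.
    by rewrite mulr_ge0 ?invr_ge0 ?(ltW (p0 _))// (le_trans rC0)// ltW.
  have := bfs_norm_ge_indic Hrho (cmeasurableB mgj mgl) (mA _) sg0 low.
  move=> /le_trans /(_ gr); rewrite qE -EFinM lee_fin /sg.
  move=> h; exact: (scaled_bound_absurd r0 (p0 _) (q0 _) (hC _) num h).
(* Pigeonhole: m + 1 images in m sets. *)
have [j [l [jl ijl]]] : exists j l : 'I_m.+1, j != l /\ i j = i l.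
  apply: contrapT => H.
  have inj : injective i.
    move=> j l ijl; apply/eqP; apply: contrapT => /negP jl; apply: H; by exists j, l.
  by have := leq_card i inj; rewrite !card_ord ltnn.
have [h|h] := leP (p (N + j)%N) (p (N + l)%N); first exact: (pair j l).
by apply: (pair l j); [rewrite eq_sym|by []|exact: ltW].
Qed.

End covers_of_the_image.

Theorem theorem1p3 (R : realType) (n : nat)
    (rho : ('rV[R]_n -> \bar R) -> \bar R)
    (Omega : set 'rV[R]_n) (a : 'rV[R]_n -> R[i]) :
  banach_function_norm rho ->
  measurable (Omega : set (lebesgueType R n)) ->
  leb Omega = +oo%E ->
  separated_doubling rho Omega ->
  multiplier rho a ->
  ((2^-1)%:E * cLnorm +oo a <=
     kuratowski_norm (bfsO_norm rho Omega) (bfsO_norm rho Omega)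
       (bfsO2 rho Omega) (bfsO rho Omega)
       (wiener_hopf rho a))%E.
Proof.
move=> Hrho mO Ooo sd aX.
have lT : (0 < leb (setT : set (lebesgueType R n)))%E.
  apply: (@lt_le_trans _ _ (leb Omega)); first by rewrite Ooo ltry.
  exact: (le_measure leb (mem_set mO) (mem_set measurableT) (@subsetT _ Omega)).
have [M M0 aM] := cLp_infty_bound lT aX.1.
have ma := aX.1.1.
(* The operator keeps the symbol a, while the estimates are made for its bounded representative; on
   L2 both give the same multiplier operator. *)
have mc := cmeasurable_clip M ma.
have cM x : Normc.normc (clip M a x) <= M by exact: clip_le.
have ac := clip_ae aM.
have op u : L2 u -> multiplier_op a u = multiplier_op (clip M a) u.
  by move=> u2; exact: (multiplier_symbol_ae mc cM ma ac u2).
rewrite /kuratowski_norm; apply: lee_wpmul2l; first by rewrite lee_fin invr_ge0.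
apply: le_ereal_inf_tmp => _ [r /= [r0 [m [S [hS cover]]]] <-].
rewrite /cLnorm unlock lT; apply/ess_supP.
have [h|h] := pselect (\forall x \ae (@leb R n), Normc.normc (clip M a x) <= r).
  apply: aeS2 h ac => x h e; rewrite /= lee_fin e ger0_norm //; exact: normc_ge0.
exfalso.
have mn := rmeas_normc mc.
pose E l k : set 'rV[R]_n :=
  [set x | r + l.+1%:R^-1 < Normc.normc (clip M a x)] `&` cube k%:R.
have mE l k : measurable (E l k : set (lebesgueType R n)).
  apply: measurableI; last exact: measurable_cube.
  rewrite (_ : [set x | _] = (fun x : lebesgueType R n => Normc.normc (clip M a x)) @^-1`
    `]r + l.+1%:R^-1, +oo[).
    by rewrite -[X in measurable X]setTI; exact: (mn measurableT _ (measurable_itv _)).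
  by apply/seteqP; split => x; rewrite /= in_itv /= andbT.
have [l [k El]] : exists l k, (0 < leb (E l k))%E.
  apply: contrapT => H; apply: h.
  have Z l k : leb (E l k) = 0%E.
    apply/eqP; rewrite eq_le measure_ge0 andbT leNgt; apply/negP => p.
    by apply: H; exists l, k.
  have ae0 : \forall x \ae (@leb R n), forall l k, ~ E l k x.
    apply/ae_foralln => l; apply/ae_foralln => k.
    exists (E l k); split; [exact: mE|exact: Z|].
    by move=> x /= nn; exact: contrapT nn.
  apply: aeS ae0 => x Ex; rewrite leNgt; apply/negP => rx.
  have [l _ hl] : \forall l \near \oo, l.+1%:R^-1 < Normc.normc (clip M a x) - r.
    by apply: (near_infty_natSinv_lt (PosNum _)); rewrite subr_gt0.
  have hb := archi_boundP (normr_ge0 x).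
  apply: (Ex l (Num.bound `|x|)); split.
    by have := hl l (leqnn l); rewrite /= ltrBrDl.
  move=> i; apply: le_trans (rV_norm_coord _ _) _; exact: ltW.
have l0 : 0 < l.+1%:R^-1 :> R by rewrite invr_gt0.
have Ek : E l k `<=` cube k%:R by move=> x [].
have Ea x : E l k x -> r + l.+1%:R^-1 < Normc.normc (clip M a x) by case.
exact: (no_small_cover Hrho M0 mc cM op aX mO sd r0 l0 hS cover (mE l k) Ek El Ea).
Qed.
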